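(* Let $G$ be a cograph with countably many vertices. Then the number of siblings of $G$, counted up to isomorphism, is either exactly $1$ or infinite.
   Context: Graphs are undirected and loopless. A graph $G$ embeds into a graph $G'$ if $G$ is isomorphic to an induced subgraph of $G'$. Two graphs are equimorphic if each embeds into the other. A sibling of $G$ is any graph equimorphic to $G$ (in particular $G$ is a sibling of itself); siblings are counted up to isomorphism. A cograph is a graph with no induced subgraph isomorphic to $P_4$, the path on four vertices. *)

(* Defs.v *)
From Stdlib Require Import Arith Lia.

Record graph : Type := Graph {
  vert : Type;
  adj : vert -> vert -> Prop;
  adj_sym : forall x y, adj x y -> adj y x;
  adj_irrefl : forall x, ~ adj x x
}.

Definition countable_graph (G : graph) : Prop :=
  exists f : vert G -> nat, forall x y, f x = f y -> x = y.

Definition embeds (G H : graph) : Prop :=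
  exists f : vert G -> vert H,
    (forall x y, f x = f y -> x = y) /\
    (forall x y, adj G x y <-> adj H (f x) (f y)).

Definition isomorphic (G H : graph) : Prop :=
  exists (f : vert G -> vert H) (g : vert H -> vert G),
    (forall x, g (f x) = x) /\ (forall y, f (g y) = y) /\
    (forall x y, adj G x y <-> adj H (f x) (f y)).

Definition equimorphic (G H : graph) : Prop := embeds G H /\ embeds H G.

Definition sibling (H G : graph) : Prop := equimorphic H G.

Definition P4_adj (x y : {n : nat | n < 4}) : Prop :=
  proj1_sig x = S (proj1_sig y) \/ proj1_sig y = S (proj1_sig x).

Lemma P4_adj_sym x y : P4_adj x y -> P4_adj y x.
Proof. unfold P4_adj; tauto. Qed.

Lemma P4_adj_irrefl x : ~ P4_adj x x.
Proof. unfold P4_adj; destruct x as [n Hn]; simpl; lia. Qed.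

Definition P4 : graph := @Graph {n : nat | n < 4} P4_adj P4_adj_sym P4_adj_irrefl.

Definition cograph (G : graph) : Prop := ~ embeds P4 G.

(* The number of siblings of G up to isomorphism is exactly 1:
   every sibling is isomorphic to G (G itself is a sibling). *)
Definition one_sibling (G : graph) : Prop :=
  forall H : graph, sibling H G -> isomorphic H G.

Definition infinitely_many_siblings (G : graph) : Prop :=
  forall n : nat, exists F : nat -> graph,
    (forall i, i < n -> sibling (F i) G) /\
    (forall i j, i < n -> j < n -> i <> j -> ~ isomorphic (F i) (F j)).

(* Main.v *)
Require Import Defs.
From Stdlib Require Import Arith Lia List Bool FinFun Classical ClassicalEpsilon FunctionalExtensionality PropExtensionality.
Import ListNotations.

(** A countable cograph is described by its strong modules: those containing a fixed vertex form a
    chain, so the graph is a chain labelled by smaller cographs.  Call a set of vertices good when it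
    is a finite lexicographic sum of cliques and independent sets.  A good graph has finitely many
    twin classes, and a power of any self-embedding preserves each of them; a Schroeder-Bernstein
    argument inside the classes then shows that it is its only sibling.

    Suppose the graph is not good.  Nash-Williams' theory (continuous arrays and minimal bad arrays)
    makes good graphs and countable chains labelled by them better-quasi-ordered under embedding, as
    in Laver's theorem, and it follows that some bad strong module [C] is minimal for embedding among
    the bad strong modules.  The relation "the least strong module containing x and y embeds into
    [C]" is an equivalence, its classes are strong modules, and isomorphisms between the modified
    graphs below map classes to classes.  Each class into which [C] embeds can be replaced, without
    leaving its equimorphy type, by a graph from which the number [n] can be read off: if the class
    has a root node, by adjusting the number of leaves at this node to [n]; otherwise the class is
    an increasing union of smaller strong modules, and its tail is repeated [n] times and
    interspersed with blocks of [n] leaves, so that from some point on the number of leaves at a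
    node is [n] cofinally often and always a multiple of [n].  Since [N+1, ..., 2N] do not divide
    each other, these values of [n] give [N] siblings. *)

(** A well-quasi-order would not suffice for the minimal bad module. Along a descending sequence of
    bad modules, the failure of the [i]-th one to embed into the [j]-th is witnessed by data
    depending on both [i] and [j], so bad arrays indexed by pairs have to be excluded; the infinite
    terms that code chains need arrays as well. Bad modules have no code of their own. An embedding
    between two of them is built by successive refinement: around a chosen vertex a module is a
    chain of children; good children are mapped at once, while bad ones, all labelled [Star], only
    receive a bad target and are treated later. Countability ensures that every vertex is reached.
    In the limit case leaves alone cannot record [n], since the class may have leaves of its own at
    arbitrarily high nodes; repeating the whole tail turns their unknown numbers into multiples of
    [n]. This is why the invariants are compared by divisibility and not by equality. *)

Lemma choice_fun {A B : Type} (R : A -> B -> Prop) :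
  (forall x, exists y, R x y) -> exists f, forall x, R x (f x).
Proof.
  intros H. exists (fun x => proj1_sig (constructive_indefinite_description _ (H x))).
  intros x. exact (proj2_sig (constructive_indefinite_description _ (H x))).
Qed.

Lemma dep_choice {A : Type} (P : nat -> A -> Prop) (R : nat -> A -> A -> Prop) (x0 : A) :
  P 0 x0 -> (forall n x, P n x -> exists y, P (S n) y /\ R n x y) ->
  exists s : nat -> A, s 0 = x0 /\ (forall n, P n (s n)) /\ (forall n, R n (s n) (s (S n))).
Proof.
  intros H0 H.
  assert (Hf : forall p : nat * A, exists y, P (fst p) (snd p) -> P (S (fst p)) y /\ R (fst p) (snd p) y).
  { intros [n x]; cbn. destruct (classic (P n x)) as [Hp|Hp].
    - destruct (H n x Hp) as [y Hy]; exists y; auto.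
    - exists x; tauto. }
  destruct (choice_fun _ Hf) as [f Hf'].
  exists (fun n => nat_rect (fun _ => A) x0 (fun n x => f (n, x)) n).
  assert (HP : forall n, P n (nat_rect (fun _ => A) x0 (fun n x => f (n, x)) n)).
  { induction n as [|n IH]; [exact H0|]. cbn. apply (Hf' (n, _)). exact IH. }
  split; [reflexivity|]. split; [exact HP|].
  intros n. cbn. apply (Hf' (n, _)), HP.
Qed.

Lemma wf_no_descent {A : Type} (R : A -> A -> Prop) (s : nat -> A) :
  well_founded R -> ~ (forall n, R (s (S n)) (s n)).
Proof.
  intros W Hs.
  assert (K : forall x, forall n, x <> s n).
  { induction x as [x IH] using (well_founded_induction W).
    intros n ->. exact (IH (s (S n)) (Hs n) (S n) eq_refl). }
  exact (K (s 0) 0 eq_refl).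
Qed.

(** * Infinite sets of natural numbers *)

Definition inc (X : nat -> nat) : Prop := forall i, X i < X (S i).

Definition subs (X A : nat -> nat) : Prop := inc X /\ forall i, exists j, X i = A j.

Definition shift (X : nat -> nat) : nat -> nat := fun i => X (S i).

Definition agree (n : nat) (X Y : nat -> nat) : Prop := forall i, i < n -> X i = Y i.

Lemma inc_lt X : inc X -> forall i j, i < j -> X i < X j.
Proof.
  intros H i j Hij. induction Hij as [|j Hij IH]; [apply H|].
  specialize (H j); lia.
Qed.

Lemma inc_le X : inc X -> forall i j, i <= j -> X i <= X j.
Proof.
  intros H i j Hij. destruct (Nat.eq_dec i j) as [->|Hn]; [lia|].
  apply Nat.lt_le_incl, inc_lt; auto; lia.
Qed.

Lemma inc_lt_inv X : inc X -> forall i j, X i < X j -> i < j.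
Proof.
  intros H i j Hij. destruct (le_lt_dec j i) as [L|L]; auto.
  pose proof (inc_le X H j i L); lia.
Qed.

Lemma inc_inj X : inc X -> forall i j, X i = X j -> i = j.
Proof.
  intros H i j E. destruct (lt_eq_lt_dec i j) as [[L|L]|L]; auto;
  pose proof (inc_lt X H _ _ L); lia.
Qed.

Lemma inc_ge X : inc X -> forall i, i <= X i.
Proof. intros H i. induction i as [|i IH]; [lia|]. specialize (H i); lia. Qed.

Lemma inc_shift X : inc X -> inc (shift X).
Proof. intros H i. apply H. Qed.

Lemma inc_comp A h : inc A -> inc h -> inc (fun i => A (h i)).
Proof. intros HA Hh i. apply inc_lt; auto. Qed.

Lemma inc_id : inc (fun i => i).
Proof. intros i; lia. Qed.

Lemma subs_refl A : inc A -> subs A A.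
Proof. intros H; split; auto. intros i; exists i; auto. Qed.

Lemma subs_trans X Y Z : subs X Y -> subs Y Z -> subs X Z.
Proof.
  intros [HX X1] [HY Y1]. split; auto. intros i.
  destruct (X1 i) as [j Hj]. destruct (Y1 j) as [k Hk]. exists k; congruence.
Qed.

Lemma subs_shift X A : subs X A -> subs (shift X) A.
Proof. intros [H1 H2]; split; [now apply inc_shift|]. intros i; apply H2. Qed.

Lemma subs_inc X A : subs X A -> inc X.
Proof. now intros []. Qed.

Lemma subs_comp A h : inc A -> inc h -> subs (fun i => A (h i)) A.
Proof. intros; split; [now apply inc_comp|]. intros i; eexists; reflexivity. Qed.

Lemma subs_factor X A : inc A -> subs X A -> exists h, inc h /\ X = fun i => A (h i).
Proof.
  intros HA [HX H]. destruct (choice_fun _ H) as [h Hh].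
  exists h; split.
  - intros i. apply (inc_lt_inv A HA). rewrite <- !Hh. apply HX.
  - extensionality i; apply Hh.
Qed.

Lemma inf_seq (p : nat -> Prop) :
  (forall n, exists m, n <= m /\ p m) -> exists k, inc k /\ forall i, p (k i).
Proof.
  intros H. destruct (H 0) as [m0 [_ Hm0]].
  destruct (dep_choice (fun _ m => p m) (fun _ m m' => m < m') m0 Hm0) as [s [_ [Hs Hr]]].
  { intros _ m _. destruct (H (S m)) as [m' [L Hm']]. exists m'; split; auto. }
  exists s; split; auto.
Qed.

Lemma pigeon (p : nat -> Prop) :
  exists k, inc k /\ ((forall i, p (k i)) \/ (forall i, ~ p (k i))).
Proof.
  destruct (classic (forall n, exists m, n <= m /\ p m)) as [H|H].
  - destruct (inf_seq p H) as [k [Hk Hp]]. exists k; auto.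
  - apply not_all_ex_not in H. destruct H as [n Hn].
    exists (fun i => n + i). split; [intros i; lia|]. right.
    intros i Hi. apply Hn. exists (n + i); split; [lia|auto].
Qed.

(** * The clopen Ramsey theorem *)

Definition scons (n : nat) (X : nat -> nat) : nat -> nat :=
  fun i => match i with 0 => n | S j => X j end.

(** A well-founded tree deciding [c]: when the entries are chosen one by one, [c] becomes constant
    after finitely many of them. [m] bounds the remaining entries from below. The Ramsey theorem is
    then a recursion on this tree. *)
Inductive bar : nat -> ((nat -> nat) -> Prop) -> Prop :=
| bar_const m c (b : Prop) : (forall X, inc X -> m <= X 0 -> (c X <-> b)) -> bar m c
| bar_cons m c : (forall n, m <= n -> bar (S n) (fun X => c (scons n X))) -> bar m c.

Definition hom (c : (nat -> nat) -> Prop) (B : nat -> nat) : Prop :=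
  (forall X, subs X B -> c X) \/ (forall X, subs X B -> ~ c X).

(** For each successive first entry, a subset homogeneous for the rest is chosen inside the previous
    one. The sequence of first entries is homogeneous once the pigeonhole principle has made the
    colours equal. *)
Lemma bar_hom m c : bar m c ->
  forall A, inc A -> m <= A 0 -> exists B, subs B A /\ hom c B.
Proof.
  induction 1 as [m c b Hc|m c Hb IH]; intros A HA Hm.
  - exists A; split; [now apply subs_refl|].
    assert (K : forall X, subs X A -> (c X <-> b)).
    { intros X [HX H]. apply Hc; auto. destruct (H 0) as [j Hj]. rewrite Hj.
      etransitivity; [exact Hm|]. apply inc_le; auto; lia. }
    destruct (classic b) as [Hb|Hb]; [left|right]; intros X HX; specialize (K X HX); tauto.
  - destruct (dep_choice (fun _ B => inc B /\ m <= B 0)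
                (fun _ B B' => subs B' (shift B) /\ hom (fun X => c (scons (B 0) X)) B') A)
      as [s [Hs0 [Hs1 Hs2]]]; [auto| |].
    { intros _ B [HB HmB].
      destruct (IH (B 0) HmB (shift B) (inc_shift _ HB)) as [B' [H1 H2]].
      - unfold shift. specialize (HB 0); lia.
      - exists B'. split; [|auto]. split; [apply H1|].
        destruct H1 as [_ H1]. destruct (H1 0) as [j Hj]. rewrite Hj. unfold shift.
        pose proof (inc_le B HB 0 (S j)); lia. }
    set (D := fun j => s j 0).
    assert (Hsub : forall i j, i < j -> subs (s j) (shift (s i))).
    { intros i j L. induction L as [|j L IHL]; [apply Hs2|].
      eapply subs_trans; [apply Hs2|]. eapply subs_trans; [|exact IHL].
      apply subs_shift, subs_refl. apply Hs1. }
    assert (HD : inc D).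
    { intros i. destruct (Hsub i (S i)) as [_ K]; [lia|]. destruct (K 0) as [j Hj].
      unfold D. rewrite Hj. unfold shift. apply inc_lt; [apply Hs1|lia]. }
    assert (HDA : subs D A).
    { split; auto. intros [|i]; [exists 0; unfold D; now rewrite Hs0|].
      destruct (Hsub 0 (S i)) as [_ K]; [lia|]. destruct (K 0) as [j Hj].
      exists (S j). unfold D. rewrite Hj. unfold shift. now rewrite Hs0. }
    destruct (pigeon (fun j => forall X, subs X (s (S j)) -> c (scons (D j) X))) as [k [Hk Hcol]].
    exists (fun i => D (k i)). split; [eapply subs_trans; [|exact HDA]; now apply subs_comp|].
    assert (K : forall X, subs X (fun i => D (k i)) ->
                exists i, subs (shift X) (s (S (k i))) /\ X = scons (D (k i)) (shift X)).
    { intros X HX. destruct (subs_factor X _ (inc_comp _ _ HD Hk) HX) as [h [Hh ->]].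
      exists (h 0). split.
      - split; [apply inc_shift, inc_comp; auto; apply inc_comp; auto|].
        intros i. unfold shift.
        assert (L : S (k (h 0)) <= k (h (S i))) by (apply inc_lt; auto; apply inc_lt; auto; lia).
        unfold D. destruct (Nat.eq_dec (S (k (h 0))) (k (h (S i)))) as [E|E].
        + exists 0. now rewrite E.
        + destruct (Hsub (S (k (h 0))) (k (h (S i)))) as [_ Q]; [lia|].
          destruct (Q 0) as [j Hj]. exists (S j). exact Hj.
      - extensionality i. destruct i; reflexivity. }
    destruct Hcol as [Hcol|Hcol]; [left|right]; intros X HX;
      destruct (K X HX) as [i [H1 H2]]; rewrite H2.
    + apply Hcol; auto.
    + destruct (proj2 (Hs2 (k i))) as [Q|Q].
      * exfalso. apply (Hcol i). exact Q.
      * apply Q; auto.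
Qed.

Definition splice (s : nat -> nat) (k : nat) (Y : nat -> nat) : nat -> nat :=
  fun i => if i <? k then s i else Y (i - k).

(** If there is no such tree, the failures propagate along one infinite branch [x]; continuity at
    [x] contradicts this at a finite stage. *)
Lemma bar_of_continuous (c : (nat -> nat) -> Prop) :
  (forall X, inc X -> exists n, forall Y, inc Y -> agree n X Y -> (c X <-> c Y)) -> bar 0 c.
Proof.
  intros Hc. apply NNPP; intros Hn.
  destruct (dep_choice (fun _ p => ~ bar (fst p) (snd p))
              (fun _ p q => exists n, fst p <= n /\ fst q = S n /\
                             snd q = fun X => snd p (scons n X)) (0, c) Hn)
    as [s [Hs0 [Hs1 Hs2]]].
  { intros _ [m d] Hd; cbn in *. apply NNPP; intros H. apply Hd. apply bar_cons.
    intros n L. apply NNPP; intros H'. apply H. exists (S n, fun X => d (scons n X)); cbn.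
    split; auto. exists n; auto. }
  destruct (choice_fun _ Hs2) as [x Hx].
  assert (Hinc : inc x).
  { intros i. destruct (Hx i) as [_ [E _]]. destruct (Hx (S i)) as [L _]. lia. }
  assert (Hsp : forall k Y, snd (s k) Y = c (splice x k Y)).
  { induction k as [|k IH]; intros Y.
    - rewrite Hs0; cbn. f_equal. extensionality i. unfold splice. cbn. now rewrite Nat.sub_0_r.
    - destruct (Hx k) as [_ [_ E]]. rewrite E, IH. f_equal. extensionality i. unfold splice, scons.
      destruct (Nat.ltb_spec i k), (Nat.ltb_spec i (S k)); try lia; auto.
      + replace i with k by lia. now rewrite Nat.sub_diag.
      + replace (i - k) with (S (i - S k)) by lia. auto. }
  destruct (Hc x Hinc) as [n Hxn].
  (* Stage [S n] rather than [n]: the lower bound there is [S (x n)], which makes the spliced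
     sequence increasing. *)
  apply (Hs1 (S n)). apply bar_const with (b := c x). intros Y HY L.
  rewrite Hsp. symmetry. apply Hxn.
  - intros i. unfold splice. destruct (Hx n) as [_ [E _]]. rewrite E in L.
    destruct (Nat.ltb_spec i (S n)), (Nat.ltb_spec (S i) (S n)); try lia.
    + apply Hinc.
    + replace (S i - S n) with 0 by lia. replace i with n by lia. lia.
    + replace (S i - S n) with (S (i - S n)) by lia. apply HY.
  - intros i Li. unfold splice. destruct (Nat.ltb_spec i (S n)); auto; lia.
Qed.

Definition cont_on {Q : Type} (A : nat -> nat) (f : (nat -> nat) -> Q) : Prop :=
  forall X, subs X A -> exists n, forall Y, subs Y A -> agree n X Y -> f Y = f X.

Lemma agree_sym n X Y : agree n X Y -> agree n Y X.
Proof. intros H i L; symmetry; auto. Qed.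

Lemma agree_le n m X Y : n <= m -> agree m X Y -> agree n X Y.
Proof. intros L H i Li; apply H; lia. Qed.

Lemma agree_shift n X Y : agree (S n) X Y -> agree n (shift X) (shift Y).
Proof. intros H i L. apply H; lia. Qed.

Lemma cont_on_sub {Q} A B (f : (nat -> nat) -> Q) : subs B A -> cont_on A f -> cont_on B f.
Proof.
  intros HBA Hf X HX. destruct (Hf X (subs_trans _ _ _ HX HBA)) as [n Hn].
  exists n. intros Y HY. apply Hn. eapply subs_trans; eauto.
Qed.

Lemma cont_on_shift {Q} A (f : (nat -> nat) -> Q) : cont_on A f -> cont_on A (fun X => f (shift X)).
Proof.
  intros Hf X HX. destruct (Hf _ (subs_shift _ _ HX)) as [n Hn].
  exists (S n). intros Y HY HXY. apply Hn; [now apply subs_shift|now apply agree_shift].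
Qed.

Lemma cont_on_pair {P Q} A (f : (nat -> nat) -> P) (g : (nat -> nat) -> Q) :
  cont_on A f -> cont_on A g -> cont_on A (fun X => (f X, g X)).
Proof.
  intros Hf Hg X HX. destruct (Hf X HX) as [n Hn]. destruct (Hg X HX) as [m Hm].
  exists (n + m). intros Y HY H. f_equal; [apply Hn|apply Hm]; auto; apply (agree_le _ (n + m)); auto; lia.
Qed.

Lemma cont_on_map {P Q} A (f : (nat -> nat) -> P) (g : P -> Q) :
  cont_on A f -> cont_on A (fun X => g (f X)).
Proof.
  intros Hf X HX. destruct (Hf X HX) as [n Hn]. exists n. intros Y HY H. f_equal; auto.
Qed.

Theorem ramsey_clopen {Q : Type} (A : nat -> nat) (f : (nat -> nat) -> Q) (p : Q -> Prop) :
  inc A -> cont_on A f -> exists B, subs B A /\ hom (fun X => p (f X)) B.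
Proof.
  intros HA Hf.
  assert (Hb : bar 0 (fun h => p (f (fun i => A (h i))))).
  { apply bar_of_continuous. intros h Hh.
    destruct (Hf _ (subs_comp A h HA Hh)) as [n Hn]. exists n. intros k Hk Hag.
    rewrite (Hn (fun i => A (k i))); [tauto|now apply subs_comp|].
    intros i L. rewrite (Hag i L); auto. }
  destruct (bar_hom _ _ Hb (fun i => i) inc_id) as [B [HB Hh]]; [lia|].
  exists (fun i => A (B i)). split; [apply subs_comp; auto; apply HB|].
  assert (K : forall X, subs X (fun i => A (B i)) -> exists h, subs h B /\ X = fun i => A (h i)).
  { intros X HX.
    destruct (subs_factor X _ (inc_comp A B HA (subs_inc _ _ HB)) HX) as [h [Hih ->]].
    exists (fun i => B (h i)). split; auto. apply subs_comp; auto. apply HB. }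
  destruct Hh as [Hh|Hh]; [left|right]; intros X HX; destruct (K X HX) as [h [H1 ->]]; auto.
Qed.

(** * Minimal bad arrays *)

Lemma finitely_many_lists {T : Type} (E : list T) n :
  exists ts : list (list T), forall t, length t <= n -> (forall x, In x t -> In x E) -> In t ts.
Proof.
  induction n as [|n [ts IH]].
  - exists [[]]. intros [|x t] L _; cbn in *; [auto|lia].
  - exists ([] :: flat_map (fun x => map (cons x) ts) E). intros [|x t] L H; cbn in *; [auto|right].
    apply in_flat_map. exists x. split; [auto|]. apply in_map. apply IH; [lia|auto].
Qed.

Section MinimalBadArray.
Variable Q : Type.
Variable le : Q -> Q -> Prop.
Variable low : Q -> Q -> Prop.
Hypothesis low_wf : well_founded low.
Hypothesis low_trans : forall x y z, low x y -> low y z -> low x z.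
Hypothesis le_low : forall x y z, le x y -> low y z -> le x z.

Definition bad_on (A : nat -> nat) (f : (nat -> nat) -> Q) : Prop :=
  inc A /\ cont_on A f /\ forall X, subs X A -> ~ le (f X) (f (shift X)).

(* An array together with a modulus of continuity [lenf]: the prefixes of length [lenf X] form a
   barrier, which is the meaning of [lenf X <= S (lenf (shift X))]. *)
Record arr := Arr { dom : nat -> nat; val : (nat -> nat) -> Q; lenf : (nat -> nat) -> nat }.

Record valid (s : arr) : Prop := Valid {
  v_inc : inc (dom s);
  v_mod : forall X Y, subs X (dom s) -> subs Y (dom s) -> agree (lenf s X) X Y ->
            val s Y = val s X /\ lenf s Y = lenf s X;
  v_bad : forall X, subs X (dom s) -> ~ le (val s X) (val s (shift X));
  v_bar : forall X, subs X (dom s) -> lenf s X <= S (lenf s (shift X));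
  v_pos : forall X, subs X (dom s) -> 1 <= lenf s X }.

(* A refinement may lower a value only if it lengthens the corresponding prefix. *)
Definition refines (s' s : arr) : Prop :=
  subs (dom s') (dom s) /\
  forall X, subs X (dom s') ->
    (val s' X = val s X /\ lenf s' X = lenf s X) \/
    (low (val s' X) (val s X) /\ lenf s X < lenf s' X).

Definition fixes (k : nat) (s' s : arr) : Prop := forall i, i <= k -> dom s' i = dom s i.

(** Every barrier prefix through [t] is longer than [t]. Since refinement never shortens a prefix, a
    dead sequence stays dead. *)
Definition dead (s : arr) (t : list nat) : Prop :=
  forall X, subs X (dom s) -> map X (seq 0 (length t)) = t -> length t < lenf s X.

Lemma refines_refl s : valid s -> refines s s.
Proof. intros V. split; [apply subs_refl, V|]. auto. Qed.

Lemma refines_trans s1 s2 s3 : refines s1 s2 -> refines s2 s3 -> refines s1 s3.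
Proof.
  intros [A1 R1] [A2 R2]. split; [eapply subs_trans; eauto|].
  intros X HX. destruct (R1 X HX) as [[E1 E2]|[E1 E2]];
    destruct (R2 X (subs_trans _ _ _ HX A1)) as [[E3 E4]|[E3 E4]].
  - left; split; congruence.
  - right; split; [congruence|lia].
  - right; split; [congruence|lia].
  - right; split; [eauto|lia].
Qed.

Lemma fixes_trans k s1 s2 s3 : fixes k s1 s2 -> fixes k s2 s3 -> fixes k s1 s3.
Proof. intros H1 H2 i L. rewrite H1, H2; auto. Qed.

Lemma refines_len s' s X : refines s' s -> subs X (dom s') -> lenf s X <= lenf s' X.
Proof. intros [_ R] HX. destruct (R X HX) as [[_ E]|[_ E]]; lia. Qed.

Lemma dead_refines s' s t : refines s' s -> dead s t -> dead s' t.
Proof.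
  intros R D X HX E. pose proof (refines_len _ _ X R HX).
  specialize (D X (subs_trans _ _ _ HX (proj1 R)) E). lia.
Qed.

(** The greedy choice of the construction: what can be killed without moving the first [k + 1]
    points of the domain has been killed. *)
Definition settled (k : nat) (s : arr) (t : list nat) : Prop :=
  dead s t \/ forall s', valid s' -> refines s' s -> fixes k s' s -> ~ dead s' t.

Lemma settle_all k ts s : valid s ->
  exists s', valid s' /\ refines s' s /\ fixes k s' s /\ forall t, In t ts -> settled k s' t.
Proof.
  intros V. induction ts as [|t ts [s1 [V1 [R1 [F1 S1]]]]].
  - exists s. split; [auto|split; [now apply refines_refl|split; [intros i _; auto|intros t []]]].
  - destruct (classic (exists s', valid s' /\ refines s' s1 /\ fixes k s' s1 /\ dead s' t))
      as [[s2 [V2 [R2 [F2 D2]]]]|H].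
    + exists s2. split; [auto|split; [eapply refines_trans; eauto|split; [eapply fixes_trans; eauto|]]].
      intros t' [<-|Hin]; [now left|]. destruct (S1 t' Hin) as [D|N].
      * left; eapply dead_refines; eauto.
      * right. intros s' V' R' F'. apply N; auto;
          [eapply refines_trans; eauto|eapply fixes_trans; eauto].
    + exists s1. split; [auto|split; [auto|split; [auto|]]].
      intros t' [<-|Hin]; [right|auto]. intros s' V' R' F' D'. apply H. exists s'; auto.
Qed.

(** A length changes only together with a strict descent of the value, and descents stop. *)
Lemma eventually_constant (v : nat -> Q) (l : nat -> nat) :
  (forall k, (v (S k) = v k /\ l (S k) = l k) \/ (low (v (S k)) (v k) /\ l k < l (S k))) ->
  exists K, forall k, K <= k -> v k = v K /\ l k = l K.
Proof.
  intros H.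
  assert (G : forall q K, v K = q -> exists K', forall k, K' <= k -> v k = v K' /\ l k = l K').
  { induction q as [q IH] using (well_founded_induction low_wf). intros K E.
    destruct (classic (exists k, K <= k /\ low (v (S k)) (v k))) as [HE|HE].
    - assert (HE' : exists k, K <= k /\ low (v (S k)) q).
      { destruct HE as [k [L Hk]].
        assert (Hle : forall j, K <= j -> v j = q \/ low (v j) q).
        { intros j Lj. induction Lj as [|j Lj IHj]; [auto|].
          destruct (H j) as [[E1 _]|[E1 _]]; [rewrite E1; auto|].
          right. destruct IHj as [E2|E2]; [now rewrite <- E2|eauto]. }
        exists k. split; auto. destruct (Hle k L) as [E2|E2]; [congruence|eauto]. }
      destruct HE' as [k [L Hk]]. eapply IH; [exact Hk|reflexivity].
    - exists K. intros k L. induction L as [|k L IHk]; [auto|].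
      destruct (H k) as [[E1 E2]|[E1 _]]; [rewrite E1, E2; auto|].
      exfalso; apply HE; exists k; auto. }
  exact (G _ 0 eq_refl).
Qed.

(** A least modulus is constant on all sequences sharing the prefix it cuts off, so these prefixes
    are pairwise incomparable. *)
Lemma least_modulus A (f : (nat -> nat) -> Q) : cont_on A f ->
  exists l : (nat -> nat) -> nat, forall X Y, subs X A -> subs Y A -> agree (l X) X Y ->
     f Y = f X /\ l Y = l X.
Proof.
  intros Hf.
  pose (ismod X n := forall Y, subs Y A -> agree n X Y -> f Y = f X).
  assert (Hl : forall X, exists n, subs X A -> ismod X n /\ forall m, ismod X m -> n <= m).
  { intros X. destruct (classic (subs X A)) as [HX|HX]; [|exists 0; tauto].
    destruct (Hf X HX) as [n Hn]. assert (Hm : exists n, ismod X n) by (exists n; exact Hn). clear n Hn.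
    destruct (dec_inh_nat_subset_has_unique_least_element (ismod X)) as [n [[H1 H2] _]]; auto.
    - intros n; apply classic.
    - exists n; auto. }
  destruct (choice_fun _ Hl) as [l H]. exists l. intros X Y HX HY HXY.
  destruct (H X HX) as [M1 L1]. destruct (H Y HY) as [M2 L2].
  assert (E : f Y = f X) by (apply M1; auto). split; [exact E|].
  assert (MY : ismod Y (l X)).
  { intros Z HZ HYZ. rewrite E. apply M1; auto. intros i Li. rewrite HXY, HYZ; auto. }
  pose proof (L2 _ MY) as L. apply Nat.le_antisymm; auto. apply L1.
  intros Z HZ HXZ. rewrite <- E. apply M2; auto. intros i Li. rewrite <- HXZ, HXY; auto; lia.
Qed.

(** Otherwise some subset satisfies [S (l (shift X)) < l X] throughout, and [l] decreases forever
    along its tails. *)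
Lemma barrier_refine A (l : (nat -> nat) -> nat) : inc A -> cont_on A l ->
  exists B, subs B A /\ forall X, subs X B -> l X <= S (l (shift X)).
Proof.
  intros HA Hl.
  destruct (ramsey_clopen A (fun X => (l X, l (shift X))) (fun p => fst p <= S (snd p)) HA)
    as [B [HB Hh]].
  { apply cont_on_pair; auto. now apply cont_on_shift. }
  exists B; split; auto. destruct Hh as [Hh|Hh]; [exact Hh|]. exfalso.
  cbn in Hh.
  assert (K : forall n, subs (fun i => B (n + i)) B).
  { intros n. apply (subs_comp B (fun i => n + i)); [apply HB|]. intros i; lia. }
  apply (wf_no_descent _ (fun n => l (fun i => B (n + i))) lt_wf). intros n.
  specialize (Hh _ (K n)). unfold shift in Hh.
  replace (fun i => B (S n + i)) with (fun i => B (n + S i)); [lia|].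
  extensionality i; f_equal; lia.
Qed.

Lemma valid_of_bad A f : bad_on A f ->
  exists s, valid s /\ subs (dom s) A /\ forall X, subs X (dom s) -> val s X = f X.
Proof.
  intros [HA [Hc Hb]]. destruct (least_modulus A f Hc) as [l Hl].
  (* The successor makes the lengths positive, as [v_pos] demands. *)
  assert (Hlc : cont_on A (fun X => S (l X))).
  { intros X HX. exists (l X). intros Y HY H. f_equal. apply Hl; auto. }
  destruct (barrier_refine A _ HA Hlc) as [B [HB Hbar]].
  exists (Arr B f (fun X => S (l X))). split; [|auto].
  split; cbn.
  - apply HB.
  - intros X Y HX HY H. destruct (Hl X Y) as [E1 E2]; [eapply subs_trans; eauto..| |].
    + eapply agree_le; [|exact H]; lia.
    + auto.
  - intros X HX. apply Hb. eapply subs_trans; eauto.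
  - exact Hbar.
  - intros; lia.
Qed.

Lemma In_prefix (X : nat -> nat) n i : i < n -> In (X i) (map X (seq 0 n)).
Proof. intros L. apply in_map, in_seq. lia. Qed.

(** Fusion: stage [k] kills every sequence of length at most [k + 1] over the first [k + 1] points
    that can be killed without moving them. A bad array strictly below the limit, grafted onto it,
    would kill a sequence that an earlier stage has left alive. *)
Theorem minimal_bad_array A f : bad_on A f ->
  exists B g, bad_on B g /\ subs B A /\
    (forall X, subs X B -> g X = f X \/ low (g X) (f X)) /\
    forall C h, bad_on C h -> subs C B -> (forall X, subs X C -> low (h X) (g X)) -> False.
Proof.
  intros Hbad. destruct (valid_of_bad A f Hbad) as [s0 [V0 [D0 E0]]].
  destruct (dep_choice (fun _ s => valid s)
     (fun k s s' => refines s' s /\ fixes k s' s /\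
        forall t, length t <= S k -> (forall x, In x t -> In x (map (dom s) (seq 0 (S k)))) ->
          settled k s' t) s0 V0) as [s [Hs0 [Hv Hr]]].
  { intros k s V. destruct (finitely_many_lists (map (dom s) (seq 0 (S k))) (S k)) as [ts Hts].
    destruct (settle_all k ts s V) as [s' [V' [R' [F' S']]]].
    exists s'; split; [auto|split; [auto|split; [auto|]]]. intros t L H. apply S', Hts; auto. }
  assert (Rle : forall i j, i <= j -> refines (s j) (s i)).
  { intros i j L. induction L as [|j L IH]; [apply refines_refl, Hv|].
    eapply refines_trans; [apply Hr|exact IH]. }
  assert (Fle : forall i j, i <= j -> forall k, k <= i -> dom (s j) k = dom (s i) k).
  { intros i j L. induction L as [|j L IH]; [auto|]. intros k Lk.
    destruct (Hr j) as [_ [F _]]. rewrite F by lia. auto. }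
  (* From stage [k] on the [k]-th point no longer moves, so the diagonal lies in every
     [dom (s k)]. *)
  set (B := fun k => dom (s k) k).
  assert (HB : inc B).
  { intros k. unfold B. rewrite <- (Fle k (S k)) by lia. apply (v_inc _ (Hv (S k))). }
  assert (HBs : forall k, subs B (dom (s k))).
  { intros k. split; auto. intros i. unfold B. destruct (le_lt_dec i k) as [L|L].
    - exists i. symmetry. apply Fle; lia.
    - destruct (Rle k i) as [[_ K] _]; [lia|]. apply K. }
  assert (HX : forall X k, subs X B -> subs X (dom (s k))).
  { intros X k H. eapply subs_trans; [exact H|apply HBs]. }
  assert (Hev : forall X, exists K, subs X B -> forall k, K <= k ->
              val (s k) X = val (s K) X /\ lenf (s k) X = lenf (s K) X).
  { intros X. destruct (classic (subs X B)) as [HXB|HXB]; [|exists 0; tauto].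
    destruct (eventually_constant (fun k => val (s k) X) (fun k => lenf (s k) X)) as [K HK].
    - intros k. destruct (Hr k) as [[_ R] _]. apply R. auto.
    - exists K; auto. }
  destruct (choice_fun _ Hev) as [K HK].
  (* The limit array: on each [X] the values and lengths have become constant by stage [K X]. *)
  set (w := Arr B (fun X => val (s (K X)) X) (fun X => lenf (s (K X)) X)).
  assert (Hw : forall X k, subs X B -> K X <= k -> val w X = val (s k) X /\ lenf w X = lenf (s k) X).
  { intros X k HXB L. destruct (HK X HXB k L) as [E1 E2]. cbn. auto. }
  assert (Vw : valid w).
  { split.
    - exact HB.
    - intros X Y HX1 HY1 Hag. cbn in HX1, HY1.
      destruct (Hw X (K X + K Y) HX1) as [E1 E2]; [lia|]. destruct (Hw Y (K X + K Y) HY1) as [E3 E4]; [lia|].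
      rewrite E1, E2, E3, E4. rewrite E2 in Hag. apply (v_mod _ (Hv (K X + K Y))); auto.
    - intros X HX1. cbn in HX1. pose proof (subs_shift _ _ HX1) as HX2.
      destruct (Hw X (K X + K (shift X)) HX1) as [E1 E2]; [lia|].
      destruct (Hw (shift X) (K X + K (shift X)) HX2) as [E3 E4]; [lia|].
      rewrite E1, E3. apply (v_bad _ (Hv (K X + K (shift X)))); auto.
    - intros X HX1. cbn in HX1. pose proof (subs_shift _ _ HX1) as HX2.
      destruct (Hw X (K X + K (shift X)) HX1) as [E1 E2]; [lia|].
      destruct (Hw (shift X) (K X + K (shift X)) HX2) as [E3 E4]; [lia|].
      rewrite E2, E4. apply (v_bar _ (Hv (K X + K (shift X)))); auto.
    - intros X HX1. apply (v_pos _ (Hv (K X))). auto. }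
  assert (Rw : forall k, refines w (s k)).
  { intros k. split; [apply HBs|]. intros X HX1. cbn in HX1.
    destruct (Hw X (k + K X) HX1) as [E1 E2]; [lia|]. rewrite E1, E2.
    destruct (Rle k (k + K X)) as [_ R]; [lia|]. apply R. auto. }
  exists B, (val w). split; [|split; [|split]].
  - split; [exact HB|split; [|apply (v_bad _ Vw)]].
    intros X HX1. exists (lenf w X). intros Y HY1 H. now apply (v_mod _ Vw).
  - eapply subs_trans; [apply (HBs 0)|]. now rewrite Hs0.
  - intros X HX1. specialize (Rw 0). rewrite Hs0 in Rw. destruct Rw as [R1 R2].
    rewrite <- E0 by (eapply subs_trans; eauto). destruct (R2 X HX1) as [[E _]|[E _]]; auto.
  - intros C0 h Hh HCB Hlow.
    destruct (valid_of_bad C0 h Hh) as [c0 [Vc0 [Dc0 Ec0]]].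
    assert (Dc0B : subs (dom c0) B) by exact (subs_trans _ _ _ Dc0 HCB).
    assert (Hlc : cont_on (dom c0) (fun X => lenf c0 X + lenf w X)).
    { intros X HX1. exists (lenf c0 X + lenf w X). intros Y HY1 Hag. f_equal.
      - apply (v_mod _ Vc0); auto. eapply agree_le; [|exact Hag]; lia.
      - apply (v_mod _ Vw); auto; try (eapply agree_le; [|exact Hag]; lia);
        (eapply subs_trans; [eassumption|exact Dc0B]). }
    destruct (barrier_refine _ _ (v_inc _ Vc0) Hlc) as [C [HC Hbar]].
    assert (HCB' : subs C B) by exact (subs_trans _ _ _ HC Dc0B).
    assert (HClow : forall X, subs X C -> low (val c0 X) (val w X)).
    { intros X HX1. rewrite Ec0 by exact (subs_trans _ _ _ HX1 HC). apply Hlow.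
      exact (subs_trans _ _ _ HX1 (subs_trans _ _ _ HC Dc0)). }
    (* The barrier prefix [t] of [C] has length [n0] and last entry [B k]. It is alive in [w], hence
       in [s (S k)]. *)
    set (n0 := lenf w C).
    assert (Hn0 : 1 <= n0) by (apply (v_pos _ Vw); exact HCB').
    destruct HCB' as [HCi HCB2] eqn:EQ; clear EQ.
    destruct (HCB2 (n0 - 1)) as [k Hk].
    assert (HCB3 : subs C B) by (split; auto).
    set (t := map C (seq 0 n0)).
    assert (Lt : length t = n0) by (unfold t; now rewrite length_map, length_seq).
    (* The grafted domain: [B] up to the entry [B k], then only points of [C]. *)
    set (A' := fun i => if i <=? k then B i else C (n0 + (i - S k))).
    assert (HA'i : inc A').
    { intros i. unfold A'. destruct (Nat.leb_spec i k), (Nat.leb_spec (S i) k); try lia.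
      - apply HB.
      - replace i with k by lia. rewrite <- Hk. apply inc_lt; auto; lia.
      - apply inc_lt; auto; lia. }
    assert (HA'B : subs A' B).
    { split; auto. intros i. unfold A'. destruct (Nat.leb_spec i k); [eauto|apply HCB2]. }
    assert (HA'gt : forall i, B k < A' i -> exists j, A' i = C j).
    { intros i L. unfold A' in *. destruct (Nat.leb_spec i k); [|eauto].
      apply (inc_lt_inv B HB) in L; lia. }
    (* The lowered array is used where [X] lies in [C] and its prefix reaches [B k]; the barrier
       inequality makes this persist under [shift]. *)
    pose (U X := (forall i, exists j, X i = C j) /\ B k <= X (lenf w X - 1)).
    assert (HUsub : forall X, subs X A' -> U X -> subs X C) by (intros X [H1 _] [H2 _]; split; auto).
    assert (HUag : forall X Y, subs X A' -> subs Y A' -> agree (lenf w X) X Y -> U X -> U Y).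
    { intros X Y HX1 HY1 Hag [U1 U2].
      assert (E : lenf w Y = lenf w X) by (apply (v_mod _ Vw); auto; eapply subs_trans; eauto).
      pose proof (v_pos _ Vw X (subs_trans _ _ _ HX1 HA'B)) as Hp.
      split.
      - intros i. destruct (le_lt_dec (lenf w X) i) as [L|L].
        + destruct HY1 as [HYi HY1]. destruct (HY1 i) as [j Hj]. rewrite Hj. apply HA'gt.
          rewrite <- Hj. apply Nat.le_lt_trans with (Y (lenf w X - 1)).
          * rewrite <- Hag by lia. exact U2.
          * apply inc_lt; auto; lia.
        + rewrite <- Hag by lia. apply U1.
      - rewrite E, <- Hag by lia. exact U2. }
    assert (HUsh : forall X, subs X A' -> U X -> U (shift X)).
    { intros X HX1 [U1 U2]. split; [intros i; apply U1|].
      pose proof (v_bar _ Vw X (subs_trans _ _ _ HX1 HA'B)) as Hb.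
      pose proof (v_pos _ Vw _ (subs_trans _ _ _ (subs_shift _ _ HX1) HA'B)) as Hp.
      unfold shift at 1. eapply Nat.le_trans; [exact U2|]. apply inc_le; [apply HX1|lia]. }
    pose (pick (X : nat -> nat) := if excluded_middle_informative (U X) then true else false).
    set (s' := Arr A' (fun X => if pick X then val c0 X else val w X)
                 (fun X => if pick X then lenf c0 X + lenf w X else lenf w X)).
    assert (Hpt : forall X, U X -> pick X = true)
      by (intros X HU; unfold pick; destruct excluded_middle_informative; tauto).
    assert (Hpf : forall X, ~ U X -> pick X = false)
      by (intros X HU; unfold pick; destruct excluded_middle_informative; tauto).
    assert (Hc0 : forall X, subs X C -> subs X (dom c0)) by (intros X H; eapply subs_trans; eauto).
    assert (Vs' : valid s').
    { split; cbn [dom val lenf s'].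
      - exact HA'i.
      - intros X Y HX1 HY1 Hag. destruct (classic (U X)) as [HU|HU].
        + rewrite (Hpt X HU) in *.
          assert (HUY : U Y) by (apply (HUag X Y); auto; eapply agree_le; [|exact Hag]; lia).
          rewrite (Hpt Y HUY).
          destruct (v_mod _ Vc0 X Y) as [E1 E2]; auto; [eapply agree_le; [|exact Hag]; lia|].
          destruct (v_mod _ Vw X Y (subs_trans _ _ _ HX1 HA'B) (subs_trans _ _ _ HY1 HA'B)) as [E3 E4];
            [eapply agree_le; [|exact Hag]; lia|]. split; auto; lia.
        + rewrite (Hpf X HU) in *.
          destruct (v_mod _ Vw X Y (subs_trans _ _ _ HX1 HA'B) (subs_trans _ _ _ HY1 HA'B) Hag)
            as [E3 E4].
          assert (HUY : ~ U Y).
          { intros HUY. apply HU. eapply HUag; [exact HY1|exact HX1| |exact HUY].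
            rewrite E4. now apply agree_sym. }
          rewrite (Hpf Y HUY). auto.
      - intros X HX1. destruct (classic (U X)) as [HU|HU].
        + rewrite (Hpt X HU), (Hpt _ (HUsh X HX1 HU)). apply (v_bad _ Vc0); auto.
        + rewrite (Hpf X HU). pose proof (v_bad _ Vw X (subs_trans _ _ _ HX1 HA'B)) as Hb.
          destruct (classic (U (shift X))) as [HU'|HU'].
          (* Here an old value meets a lowered one; [le_low] reduces the comparison to the badness
             of [w]. *)
          * rewrite (Hpt _ HU'). intros H. apply Hb. eapply le_low; [exact H|].
            apply HClow. apply HUsub; auto. now apply subs_shift.
          * rewrite (Hpf _ HU'). exact Hb.
      - intros X HX1. destruct (classic (U X)) as [HU|HU].
        + rewrite (Hpt X HU), (Hpt _ (HUsh X HX1 HU)). apply Hbar; auto.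
        + rewrite (Hpf X HU). pose proof (v_bar _ Vw X (subs_trans _ _ _ HX1 HA'B)) as Hb.
          destruct (pick (shift X)); lia.
      - intros X HX1. pose proof (v_pos _ Vw X (subs_trans _ _ _ HX1 HA'B)). destruct (pick X); lia. }
    assert (Rs' : refines s' w).
    { split; [exact HA'B|]. cbn [dom val lenf s']. intros X HX1.
      destruct (classic (U X)) as [HU|HU]; [right; rewrite (Hpt X HU)|left; rewrite (Hpf X HU); auto].
      split; [apply HClow; auto|]. pose proof (v_pos _ Vc0 X (Hc0 _ (HUsub X HX1 HU))). lia. }
    destruct (Hr k) as [_ [Fk Sk]].
    assert (Ht1 : length t <= S k).
    { rewrite Lt. assert (L : n0 - 1 <= k); [|lia].
      assert (G : forall i, exists j, C i = B j /\ i <= j).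
      { induction i as [|i [j [E L]]].
        - destruct (HCB2 0) as [j E]. exists j; split; auto; lia.
        - destruct (HCB2 (S i)) as [j' E']. exists j'; split; auto.
          assert (B j < B j') by (rewrite <- E, <- E'; apply HCi).
          apply (inc_lt_inv B HB) in H. lia. }
      destruct (G (n0 - 1)) as [j [E L]]. rewrite Hk in E. apply (inc_inj B HB) in E. lia. }
    assert (Ht2 : forall x, In x t -> In x (map (dom (s k)) (seq 0 (S k)))).
    { intros x Hx. unfold t in Hx. apply in_map_iff in Hx. destruct Hx as [i [<- Hi]].
      apply in_seq in Hi. destruct (HCB2 i) as [j Hj].
      assert (L : B j <= B k) by (rewrite <- Hj, <- Hk; apply inc_le; auto; lia).
      assert (L' : j <= k) by (destruct (le_lt_dec j k); auto; pose proof (inc_lt B HB k j); lia).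
      rewrite Hj. unfold B. rewrite <- (Fle j k) by lia. apply In_prefix. lia. }
    destruct (Sk t Ht1 Ht2) as [D|N].
    + assert (HtC : map C (seq 0 (length t)) = t) by (rewrite Lt; reflexivity).
      specialize (D C (HX _ _ HCB3) HtC). rewrite Lt in D.
      pose proof (refines_len _ _ C (Rw (S k)) HCB3). unfold n0 in D. lia.
    + apply (N s' Vs').
      * eapply refines_trans; eauto.
      * intros i Li. cbn [dom s']. unfold A'. destruct (Nat.leb_spec i k); [|lia].
        unfold B. rewrite <- (Fle i (S k)) by lia. reflexivity.
      * intros X HX1 Hpre. cbn [dom s' lenf] in *. rewrite Lt in Hpre |- *.
        assert (Hag : agree n0 C X).
        { intros i Li. assert (E : nth i (map X (seq 0 n0)) 0 = nth i t 0) by (now rewrite Hpre).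
          unfold t in E. rewrite !(nth_indep _ 0 (X 0)) in E by (rewrite length_map, length_seq; auto).
          rewrite (map_nth X (seq 0 n0) 0), seq_nth in E by auto.
          rewrite (nth_indep _ (X 0) (C 0)) in E by (rewrite length_map, length_seq; auto).
          rewrite (map_nth C (seq 0 n0) 0), seq_nth in E by auto. cbn in E. auto. }
        assert (El : lenf w X = n0) by (apply (v_mod _ Vw C X); auto; eapply subs_trans; eauto).
        assert (HU : U X).
        { split.
          - intros i. destruct (le_lt_dec n0 i) as [L|L].
            + destruct HX1 as [HXi HX1]. destruct (HX1 i) as [j Hj]. rewrite Hj. apply HA'gt.
              rewrite <- Hj, <- Hk, (Hag (n0 - 1)) by lia. apply inc_lt; auto; lia.
            + exists i. symmetry; auto.
          - rewrite El, <- Hag, Hk by lia. lia. }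
        rewrite (Hpt X HU). pose proof (v_pos _ Vc0 X (Hc0 _ (HUsub X HX1 HU))). lia.
Qed.

End MinimalBadArray.

Arguments bad_on {Q} le A f.

(** * Better-quasi-orders and their Ramsey consequences *)

Definition bqo {Q : Type} (le : Q -> Q -> Prop) : Prop := forall A f, ~ bad_on le A f.

Lemma bqo_homogeneous {Q} (le : Q -> Q -> Prop) A f : bqo le -> inc A -> cont_on A f ->
  exists B, subs B A /\ forall X, subs X B -> le (f X) (f (shift X)).
Proof.
  intros HQ HA Hf.
  destruct (ramsey_clopen A (fun X => (f X, f (shift X))) (fun p => le (fst p) (snd p)) HA)
    as [B [HB Hh]]; [apply cont_on_pair; auto; now apply cont_on_shift|].
  exists B; split; auto. destruct Hh as [Hh|Hh]; [exact Hh|]. exfalso.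
  apply (HQ B f). split; [apply HB|split; [eapply cont_on_sub; eauto|exact Hh]].
Qed.

Lemma ramsey_finite (n : nat) : forall A (f : (nat -> nat) -> nat), inc A -> cont_on A f ->
  (forall X, subs X A -> f X < n) -> exists B v, subs B A /\ forall X, subs X B -> f X = v.
Proof.
  induction n as [|n IH]; intros A f HA Hf Hn.
  - exfalso. specialize (Hn A (subs_refl _ HA)). lia.
  - destruct (ramsey_clopen A f (fun v => v = n) HA Hf) as [B [HB [Hh|Hh]]].
    + exists B, n; auto.
    + destruct (IH B f) as [B' [v [HB' Hv]]].
      * apply HB.
      * eapply cont_on_sub; eauto.
      * intros X HX. specialize (Hh X HX). specialize (Hn X (subs_trans _ _ _ HX HB)). lia.
      * exists B', v. split; auto. eapply subs_trans; eauto.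
Qed.

(** Minimality combined with Ramsey: the other homogeneous colour would be a bad array strictly
    below the minimal one. *)
Lemma minimal_below {Q} (le low : Q -> Q -> Prop) A g B (h : (nat -> nat) -> Q) :
  (forall C h, bad_on le C h -> subs C A -> (forall X, subs X C -> low (h X) (g X)) -> False) ->
  subs B A -> cont_on B h -> (forall X, subs X B -> low (h X) (g X)) ->
  exists C, subs C B /\ forall X, subs X C -> le (h X) (h (shift X)).
Proof.
  intros Hmin HB Hh Hlow.
  destruct (ramsey_clopen B (fun X => (h X, h (shift X))) (fun p => le (fst p) (snd p)))
    as [C [HC Hc]]; [apply HB|apply cont_on_pair; auto; now apply cont_on_shift|].
  exists C; split; auto. destruct Hc as [Hc|Hc]; [exact Hc|]. exfalso.
  apply (Hmin C h).
  - split; [apply HC|split; [eapply cont_on_sub; eauto|exact Hc]].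
  - eapply subs_trans; eauto.
  - intros X HX. apply Hlow. eapply subs_trans; eauto.
Qed.

(** * Terms for good graphs and for labelled chains *)

(* [Dot], [Kinf] and [Iinf] stand for a vertex, an infinite clique and an infinite independent set;
   [Star] is a catch-all for graphs that are not good. *)
Inductive atom := Dot | Kinf | Iinf | Star.

(** [gB o s t] stands for the disjoint sum of [s] and [t], with all edges between the two if [o] is
    [true] and none otherwise. *)
Inductive gterm := gA (a : atom) | gB (o : bool) (s t : gterm).

Inductive gle : gterm -> gterm -> Prop :=
| gle_a a : gle (gA a) (gA a)
| gle_b o s s' t t' : gle s s' -> gle t t' -> gle (gB o s t) (gB o s' t')
| gle_l o u s t : gle u s -> gle u (gB o s t)
| gle_r o u s t : gle u t -> gle u (gB o s t).

Lemma gle_trans t u v : gle t u -> gle u v -> gle t v.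
Proof.
  intros H1 H2. revert t H1. induction H2 as [a|o s s' t t' _ IH1 _ IH2|o u s t _ IH|o u s t _ IH];
    intros x H1; auto using gle.
  inversion H1; subst; auto using gle.
Qed.

Fixpoint glow (u v : gterm) : Prop :=
  match v with
  | gA _ => False
  | gB _ s t => (u = s \/ glow u s) \/ (u = t \/ glow u t)
  end.

Lemma glow_trans x y z : glow x y -> glow y z -> glow x z.
Proof.
  intros H. induction z as [a|o s IH1 t IH2]; cbn; [auto|].
  intros [[->|K]|[->|K]]; auto.
Qed.

Lemma glow_wf : well_founded glow.
Proof.
  assert (H : forall v, Acc glow v).
  { induction v as [a|o s IH1 t IH2]; constructor; cbn; [tauto|].
    intros u [[->|K]|[->|K]]; auto; [eapply Acc_inv; [exact IH1|auto]|eapply Acc_inv; [exact IH2|auto]]. }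
  exact H.
Qed.

Lemma gle_glow x y z : gle x y -> glow y z -> gle x z.
Proof.
  intros H. induction z as [a|o s IH1 t IH2]; cbn; [tauto|].
  intros [[->|K]|[->|K]]; auto using gle.
Qed.

Definition ghead (t : gterm) : nat :=
  match t with
  | gA Dot => 0 | gA Kinf => 1 | gA Iinf => 2 | gA Star => 3 | gB true _ _ => 4 | gB false _ _ => 5
  end.

(** Once the outermost constructor is constant, the two immediate subterms form arrays below a
    minimal bad one and become comparable on a further subset; then so are the terms. *)
Theorem gle_bqo : bqo gle.
Proof.
  intros A0 f0 Hbad.
  destruct (minimal_bad_array _ gle glow glow_wf glow_trans gle_glow A0 f0 Hbad)
    as [A [f [[HA [Hc Hb]] [_ [_ Hmin]]]]].
  destruct (ramsey_finite 6 A (fun X => ghead (f X)) HA) as [B [v [HB Hv]]].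
  { now apply cont_on_map. }
  { intros X _. destruct (f X) as [[]|[] ? ?]; cbn; lia. }
  assert (HcB : cont_on B f) by (eapply cont_on_sub; eauto).
  destruct (f B) as [a|o s t] eqn:E.
  - apply (Hb B HB). pose proof (Hv B (subs_refl _ (subs_inc _ _ HB))) as E1.
    pose proof (Hv _ (subs_shift _ _ (subs_refl _ (subs_inc _ _ HB)))) as E2.
    rewrite E in E1. rewrite E. rewrite <- E1 in E2.
    destruct (f (shift B)) as [b|[] ? ?], a; try destruct b; cbn in E2; try discriminate; constructor.
  - pose (left u := match u with gA _ => u | gB _ s _ => s end).
    pose (right u := match u with gA _ => u | gB _ _ t => t end).
    assert (Hsh : forall X, subs X B -> f X = gB o (left (f X)) (right (f X))).
    { intros X HX. pose proof (Hv B (subs_refl _ (subs_inc _ _ HB))) as E1. pose proof (Hv X HX) as E2.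
      rewrite E in E1. rewrite <- E1 in E2.
      destruct (f X) as [[]|o' s' t']; destruct o; try destruct o'; cbn in E2; try discriminate; reflexivity. }
    destruct (minimal_below gle glow A f B (fun X => left (f X)) Hmin HB) as [C [HC H1]].
    { now apply cont_on_map. }
    { intros X HX. rewrite (Hsh X HX). cbn. auto. }
    assert (HCA : subs C A) by (eapply subs_trans; eauto).
    destruct (minimal_below gle glow A f C (fun X => right (f X)) Hmin HCA) as [D [HD H2]].
    { apply cont_on_map. exact (cont_on_sub _ _ _ HCA Hc). }
    { intros X HX. rewrite (Hsh X) by (eapply subs_trans; eauto). cbn. auto. }
    assert (HDD : subs D D) by (apply subs_refl, HD).
    assert (HDB : subs D B) by exact (subs_trans _ _ _ HD HC).
    apply (Hb D (subs_trans _ _ _ HDB HB)). rewrite (Hsh D HDB), (Hsh _ (subs_shift _ _ HDB)).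
    constructor; [apply H1; exact HD|apply H2; exact HDD].
Qed.

Definition label : Type := bool * gterm.

Definition lle (l m : label) : Prop := fst l = fst m /\ gle (snd l) (snd m).

Lemma lle_trans l m n : lle l m -> lle m n -> lle l n.
Proof. intros [A1 B1] [A2 B2]. split; [congruence|eapply gle_trans; eauto]. Qed.

Lemma lle_bqo : bqo lle.
Proof.
  intros A f [HA [Hc Hb]].
  destruct (ramsey_finite 2 A (fun X => if fst (f X) then 1 else 0) HA) as [B [v [HB Hv]]].
  { apply (cont_on_map A f (fun l => if fst l then 1 else 0) Hc). }
  { intros X _. destruct (fst (f X)); lia. }
  destruct (bqo_homogeneous gle B (fun X => snd (f X)) gle_bqo) as [C [HC H]].
  { apply HB. }
  { eapply cont_on_sub; [exact HB|]. apply (cont_on_map A f snd Hc). }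
  apply (Hb C (subs_trans _ _ _ HC HB)). split.
  - pose proof (Hv C HC) as E1. pose proof (Hv _ (subs_shift _ _ HC)) as E2.
    destruct (fst (f C)), (fst (f (shift C))); lia || reflexivity.
  - apply H. apply subs_refl, HC.
Qed.

Inductive kind := Om | OmRev | Eta.

(** [cI k f] codes an infinite sum. For [Om] and [OmRev] the summands form a sequence of type omega,
    or its reverse, in which every [f i] recurs cofinally; for [Eta] they are shuffled densely. *)
Inductive cterm := cS (l : label) | cC (s t : cterm) | cI (k : kind) (f : nat -> cterm).

(** The rule [cle_i] disregards the order and multiplicity of the members: as each of them recurs,
    domination member by member is enough for an embedding. *)
Inductive cle : cterm -> cterm -> Prop :=
| cle_s l m : lle l m -> cle (cS l) (cS m)
| cle_c s s' t t' : cle s s' -> cle t t' -> cle (cC s t) (cC s' t')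
| cle_l u s t : cle u s -> cle u (cC s t)
| cle_r u s t : cle u t -> cle u (cC s t)
| cle_i k f g : (forall i, exists j, cle (f i) (g j)) -> cle (cI k f) (cI k g)
| cle_m k u f i : cle u (f i) -> cle u (cI k f).

Fixpoint clow (u v : cterm) : Prop :=
  match v with
  | cS _ => False
  | cC s t => (u = s \/ clow u s) \/ (u = t \/ clow u t)
  | cI _ f => exists i, u = f i \/ clow u (f i)
  end.

Lemma clow_trans x y z : clow x y -> clow y z -> clow x z.
Proof.
  intros H. induction z as [a|s IH1 t IH2|k f IH]; cbn; [auto| |].
  - intros [[->|K]|[->|K]]; auto.
  - intros [i [->|K]]; exists i; auto.
Qed.

Lemma clow_wf : well_founded clow.
Proof.
  assert (H : forall v, Acc clow v).
  { induction v as [a|s IH1 t IH2|k f IH]; constructor; cbn; [tauto| |].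
    - intros u [[->|K]|[->|K]]; auto; [eapply Acc_inv; [exact IH1|auto]|eapply Acc_inv; [exact IH2|auto]].
    - intros u [i [->|K]]; auto. eapply Acc_inv; [apply (IH i)|auto]. }
  exact H.
Qed.

Lemma cle_clow x y z : cle x y -> clow y z -> cle x z.
Proof.
  intros H. induction z as [a|s IH1 t IH2|k f IH]; cbn; [tauto| |].
  - intros [[->|K]|[->|K]]; auto using cle_l, cle_r.
  - intros [i [->|K]]; apply (cle_m _ _ _ i); auto.
Qed.

Definition chead (t : cterm) : nat :=
  match t with
  | cS _ => 0 | cC _ _ => 1 | cI Om _ => 2 | cI OmRev _ => 3 | cI Eta _ => 4
  end.

(** The new case is that of infinite terms. If the family of [f X] is not dominated by that of
    [f (shift X)], it has a member below no member of the latter; these members form a bad array of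
    strictly lower terms. *)
Theorem cle_bqo : bqo cle.
Proof.
  intros A0 f0 Hbad.
  destruct (minimal_bad_array _ cle clow clow_wf clow_trans cle_clow A0 f0 Hbad)
    as [A [f [[HA [Hc Hb]] [_ [_ Hmin]]]]].
  destruct (ramsey_finite 5 A (fun X => chead (f X)) HA) as [B [v [HB Hv]]].
  { now apply cont_on_map. }
  { intros X _. destruct (f X) as [|? ?|[] ?]; cbn; lia. }
  assert (HcB : cont_on B f) by (eapply cont_on_sub; eauto).
  assert (HBB : subs B B) by (apply subs_refl, HB).
  pose proof (Hv B HBB) as E1.
  destruct (f B) as [l0|s0 t0|k g0] eqn:E.
  - pose (lab u := match u with cS l => l | _ => l0 end).
    assert (Hsh : forall X, subs X B -> f X = cS (lab (f X))).
    { intros X HX. pose proof (Hv X HX) as E2. rewrite <- E1 in E2.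
      destruct (f X) as [|? ?|[] ?]; cbn in E2; try discriminate; reflexivity. }
    destruct (bqo_homogeneous lle B (fun X => lab (f X)) lle_bqo) as [C [HC H]];
      [apply HB|now apply cont_on_map|].
    apply (Hb C (subs_trans _ _ _ HC HB)). rewrite (Hsh C HC), (Hsh _ (subs_shift _ _ HC)).
    constructor. apply H. apply subs_refl, HC.
  - pose (left u := match u with cC s _ => s | _ => u end).
    pose (right u := match u with cC _ t => t | _ => u end).
    assert (Hsh : forall X, subs X B -> f X = cC (left (f X)) (right (f X))).
    { intros X HX. pose proof (Hv X HX) as E2. rewrite <- E1 in E2.
      destruct (f X) as [|? ?|[] ?]; cbn in E2; try discriminate; reflexivity. }
    destruct (minimal_below cle clow A f B (fun X => left (f X)) Hmin HB) as [C [HC H1]].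
    { now apply cont_on_map. }
    { intros X HX. rewrite (Hsh X HX). cbn. auto. }
    assert (HCA : subs C A) by (eapply subs_trans; eauto).
    destruct (minimal_below cle clow A f C (fun X => right (f X)) Hmin HCA) as [D [HD H2]].
    { apply cont_on_map. exact (cont_on_sub _ _ _ HCA Hc). }
    { intros X HX. rewrite (Hsh X) by (eapply subs_trans; eauto). cbn. auto. }
    assert (HDD : subs D D) by (apply subs_refl, HD).
    assert (HDB : subs D B) by exact (subs_trans _ _ _ HD HC).
    apply (Hb D (subs_trans _ _ _ HDB HB)). rewrite (Hsh D HDB), (Hsh _ (subs_shift _ _ HDB)).
    constructor; [apply H1; exact HD|apply H2; exact HDD].
  - pose (fam u := match u with cI _ g => g | _ => g0 end).
    assert (Hsh : forall X, subs X B -> f X = cI k (fam (f X))).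
    { intros X HX. pose proof (Hv X HX) as E2. rewrite <- E1 in E2.
      destruct k; destruct (f X) as [|? ?|[] ?]; cbn in E2; try discriminate; reflexivity. }
    assert (Hpick : forall p : cterm * cterm, exists i,
       (exists i, forall j, ~ cle (fam (fst p) i) (fam (snd p) j)) ->
       forall j, ~ cle (fam (fst p) i) (fam (snd p) j)).
    { intros p. destruct (classic (exists i, forall j, ~ cle (fam (fst p) i) (fam (snd p) j))) as [[i Hi]|H].
      - exists i; auto.
      - exists 0; tauto. }
    destruct (choice_fun _ Hpick) as [pk Hpk].
    pose (h X := fam (f X) (pk (f X, f (shift X)))).
    assert (Hh : forall X, subs X B -> forall j, ~ cle (h X) (fam (f (shift X)) j)).
    { intros X HX. unfold h. apply (Hpk (f X, f (shift X))). cbn. apply NNPP; intros H.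
      apply (Hb X (subs_trans _ _ _ HX HB)). rewrite (Hsh X HX), (Hsh _ (subs_shift _ _ HX)).
      constructor. intros i. apply NNPP; intros H'. apply H. exists i. intros j Hj. apply H'.
      exists j; auto. }
    apply (Hmin B h); [|exact HB|].
    + split; [apply HB|split].
      * apply (cont_on_map B (fun X => (f X, f (shift X))) (fun p => fam (fst p) (pk p))).
        apply cont_on_pair; auto. now apply cont_on_shift.
      * intros X HX. apply (Hh X HX).
    + intros X HX. rewrite (Hsh X HX). cbn. eexists; left; reflexivity.
Qed.

(** * Sequences and double sequences in a better-quasi-order *)

Lemma cont_on_2 {Q} (t : nat -> nat -> Q) : cont_on (fun i => i) (fun X => t (X 0) (X 1)).
Proof.
  intros X _. exists 2. intros Y _ H. rewrite (H 0), (H 1) by lia. reflexivity.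
Qed.

Lemma bqo_2 {Q} (le : Q -> Q -> Prop) (t : nat -> nat -> Q) : bqo le ->
  exists i j k, i < j /\ j < k /\ le (t i j) (t j k).
Proof.
  intros H. apply NNPP; intros HN.
  apply (H (fun i => i) (fun X => t (X 0) (X 1))). split; [apply inc_id|split; [apply cont_on_2|]].
  intros X [HX _] Hle. apply HN. exists (X 0), (X 1), (X 2). auto.
Qed.

Lemma bqo_seq {Q} (le : Q -> Q -> Prop) (t : nat -> Q) : bqo le -> exists i j, i < j /\ le (t i) (t j).
Proof.
  intros H. destruct (bqo_2 le (fun i _ => t i) H) as [i [j [_ [L [_ Hl]]]]]. eauto.
Qed.

(** Otherwise the terms that are below none of the sufficiently late terms occur arbitrarily far
    out, and can be strung into a sequence without comparable pairs. *)
Lemma bqo_recurrent {Q} (le : Q -> Q -> Prop) (t : nat -> Q) : bqo le ->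
  exists K, forall k, K <= k -> forall m, exists l, m <= l /\ le (t k) (t l).
Proof.
  intros H. apply NNPP; intros HN.
  assert (Hinf : forall n, exists k, n <= k /\ exists m, forall l, m <= l -> ~ le (t k) (t l)).
  { intros n. apply NNPP; intros H1. apply HN. exists n. intros k L m. apply NNPP; intros H2.
    apply H1. exists k. split; auto. exists m. intros l Ll Hl. apply H2. eauto. }
  destruct (Hinf 0) as [k0 [_ H0]].
  destruct (dep_choice (fun _ k => exists m, forall l, m <= l -> ~ le (t k) (t l))
     (fun _ k k' => k < k' /\ forall l, k' <= l -> ~ le (t k) (t l)) k0 H0) as [s [_ [_ Hs]]].
  { intros _ k [m Hm]. destruct (Hinf (S (k + m))) as [k' [L Hk']]. exists k'. split; [exact Hk'|].
    split; [lia|]. intros l Ll. apply Hm. lia. }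
  destruct (bqo_seq le (fun i => t (s i)) H) as [i [j [L Hl]]].
  destruct (Hs i) as [_ Hn]. apply (Hn (s j)); auto.
  assert (Hi : inc s) by (intros n; apply Hs). apply inc_le; auto.
Qed.

Lemma pred_ext {A : Type} (P Q : A -> Prop) : (forall x, P x <-> Q x) -> P = Q.
Proof. intros H. extensionality x. apply propositional_extensionality, H. Qed.

Lemma least_element {V : Type} (idx : V -> nat) (K : V -> Prop) :
  (exists x, K x) -> exists x, K x /\ forall y, K y -> idx x <= idx y.
Proof.
  intros [x Hx].
  destruct (dec_inh_nat_subset_has_unique_least_element (fun n => exists y, K y /\ idx y = n))
    as [n [[[y [H1 H2]] H3] _]].
  - intros n. apply classic.
  - exists (idx x), x; auto.
  - exists y. split; auto. intros z Hz. rewrite H2. apply H3. eauto.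
Qed.

(** * Countable back-and-forth by successive refinement *)

Section Refinement.
Variables (V W I : Type) (idx : V -> nat).
Hypothesis idx_inj : forall x y, idx x = idx y -> x = y.
Variable rho : V -> V -> W -> W -> Prop.
Variable R : (V -> Prop) -> (W -> Prop) -> Prop.

(** One stage works on a task, that is, a domain [K] with a set [K'] of permitted values. Elements
    in [s_done] receive their final value; the others are sorted by [s_cls] into subtasks whose
    permitted values are given by [s_tgt]. *)
Record step := Step { s_val : V -> W; s_done : V -> Prop; s_cls : V -> I; s_tgt : I -> W -> Prop }.

Definition pend (K : V -> Prop) (s : step) (v : V) : V -> Prop :=
  fun u => K u /\ ~ s_done s u /\ s_cls s u = s_cls s v.

Record step_ok (K : V -> Prop) (K' : W -> Prop) (x : V) (s : step) : Prop := StepOk {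
  so_done : s_done s x;
  so_val : forall v, K v -> s_done s v -> K' (s_val s v);
  so_sub : forall v, K v -> ~ s_done s v -> forall w, s_tgt s (s_cls s v) w -> K' w;
  so_R : forall v, K v -> ~ s_done s v -> R (pend K s v) (s_tgt s (s_cls s v));
  so_dd : forall u v, K u -> K v -> s_done s u -> s_done s v -> rho u v (s_val s u) (s_val s v);
  so_dp : forall u v w, K u -> K v -> s_done s u -> ~ s_done s v -> s_tgt s (s_cls s v) w ->
            rho u v (s_val s u) w /\ rho v u w (s_val s u);
  so_pp : forall u v w w', K u -> K v -> ~ s_done s u -> ~ s_done s v -> s_cls s u <> s_cls s v ->
            s_tgt s (s_cls s u) w -> s_tgt s (s_cls s v) w' -> rho u v w w' }.

(** Each stage finishes the element of least index of every task, so [v] has its value after at most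
    [idx v + 1] stages. [rho] holds between two elements because the stage that separates them
    guarantees it for all values still permitted. *)
Lemma refinement (K0 : V -> Prop) (K0' : W -> Prop) :
  (forall K K', R K K' -> forall x, K x -> exists s, step_ok K K' x s) -> R K0 K0' ->
  (exists x, K0 x) ->
  exists f, (forall v, K0 v -> K0' (f v)) /\ forall u v, K0 u -> K0 v -> rho u v (f u) (f v).
Proof.
  intros Hstep HR0 [v0 Hv0].
  destruct (Hstep K0 K0' HR0 v0 Hv0) as [s0 _].
  assert (HF : forall p : (V -> Prop) * (W -> Prop), exists s : step, R (fst p) (snd p) ->
      (exists x, fst p x) -> exists x, fst p x /\ (forall y, fst p y -> idx x <= idx y) /\
      step_ok (fst p) (snd p) x s).
  { intros [K K']; cbn. destruct (classic (R K K' /\ exists x, K x)) as [[H1 H2]|H].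
    - destruct (least_element idx K H2) as [x [Hx Hl]]. destruct (Hstep K K' H1 x Hx) as [s Hs].
      exists s. intros _ _. exists x; auto.
    - exists s0. intros H1 H2. exfalso; auto. }
  destruct (choice_fun _ HF) as [F HFs]. clear HF.
  pose (dn (s : step) v := if excluded_middle_informative (s_done s v) then true else false).
  pose (next (v : V) (st : ((V -> Prop) * (W -> Prop)) + W) :=
     match st with
     | inl p => if dn (F p) v then inr (s_val (F p) v)
                else inl (pend (fst p) (F p) v, s_tgt (F p) (s_cls (F p) v))
     | inr w => inr w
     end).
  pose (st := fix st n v := match n with 0 => inl (K0, K0') | S n => next v (st n v) end).
  assert (Hdt : forall s v, s_done s v -> dn s v = true)
    by (intros s v H; unfold dn; destruct excluded_middle_informative; tauto).
  assert (Hdf : forall s v, ~ s_done s v -> dn s v = false)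
    by (intros s v H; unfold dn; destruct excluded_middle_informative; tauto).
  assert (Inv : forall n v p, K0 v -> st n v = inl p ->
     fst p v /\ R (fst p) (snd p) /\ (forall u, fst p u -> K0 u /\ st n u = inl p /\ n <= idx u)).
  { induction n as [|n IH]; intros v p Hv E.
    - cbn in E. injection E as <-. cbn. repeat split; auto; lia.
    - cbn in E. destruct (st n v) as [q|w] eqn:Eq; cbn in E; [|discriminate].
      destruct (IH v q Hv Eq) as [Q1 [Q2 Q3]].
      destruct (HFs q Q2 (ex_intro _ v Q1)) as [x [Hx [Hl Hok]]].
      destruct (classic (s_done (F q) v)) as [D|D]; [rewrite Hdt in E by auto; discriminate|].
      rewrite Hdf in E by auto. injection E as <-. cbn [fst snd].
      split; [unfold pend; auto|]. split; [now apply (so_R _ _ _ _ Hok)|].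
      intros u [U1 [U2 U3]]. destruct (Q3 u U1) as [U4 [U5 U6]]. split; [auto|]. split.
      + cbn. rewrite U5. cbn. rewrite Hdf by auto. f_equal. f_equal; [|now rewrite U3].
        apply pred_ext. intros z. unfold pend. rewrite U3. tauto.
      + destruct (Q3 x Hx) as [_ [_ Lx]]. specialize (Hl u U1).
        assert (idx x <> idx u).
        { intros Ex. apply idx_inj in Ex. subst u. apply U2, Hok. }
        lia. }
  pose (tgt (q : ((V -> Prop) * (W -> Prop)) + W) (w : W) :=
          match q with inl p => snd p w | inr w' => w = w' end).
  assert (Tg : forall n v w, K0 v -> tgt (st (S n) v) w -> tgt (st n v) w).
  { intros n v w Hv. cbn. destruct (st n v) as [q|w'] eqn:Eq; cbn; [|auto].
    destruct (Inv n v q Hv Eq) as [Q1 [Q2 Q3]].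
    destruct (HFs q Q2 (ex_intro _ v Q1)) as [x [Hx [Hl Hok]]].
    destruct (classic (s_done (F q) v)) as [D|D].
    - rewrite Hdt by auto. cbn. intros ->. now apply (so_val _ _ _ _ Hok).
    - rewrite Hdf by auto. cbn. now apply (so_sub _ _ _ _ Hok). }
  assert (Rel : forall n u v, K0 u -> K0 v ->
     (exists p, st n u = inl p /\ st n v = inl p) \/
     (forall w w', tgt (st n u) w -> tgt (st n v) w' -> rho u v w w')).
  { induction n as [|n IH]; intros u v Hu Hv; [left; exists (K0, K0'); auto|].
    destruct (IH u v Hu Hv) as [[q [Eu Ev]]|H].
    2:{ right. intros w w' H1 H2. apply H; apply Tg; auto. }
    destruct (Inv n u q Hu Eu) as [Q1 [Q2 Q3]]. destruct (Inv n v q Hv Ev) as [Q1' _].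
    destruct (HFs q Q2 (ex_intro _ v Q1')) as [x [Hx [Hl Hok]]].
    cbn. rewrite Eu, Ev. cbn.
    destruct (classic (s_done (F q) u)) as [D|D]; destruct (classic (s_done (F q) v)) as [D'|D'].
    - right. rewrite !Hdt by auto. cbn. intros w w' -> ->. now apply (so_dd _ _ _ _ Hok).
    - right. rewrite (Hdt _ u), (Hdf _ v) by auto. cbn. intros w w' -> Hw'.
      now apply (so_dp _ _ _ _ Hok).
    - right. rewrite (Hdf _ u), (Hdt _ v) by auto. cbn. intros w w' Hw ->.
      now apply (so_dp _ _ _ _ Hok).
    - rewrite !Hdf by auto. destruct (classic (s_cls (F q) u = s_cls (F q) v)) as [E|E].
      + left. eexists. split; [reflexivity|]. f_equal. f_equal; [|now rewrite E].
        apply pred_ext. intros z. unfold pend. rewrite E. tauto.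
      + right. cbn. intros w w' H1 H2. now apply (so_pp _ _ _ _ Hok) with (u := u) (v := v). }
  assert (Fin : forall v, exists w, K0 v -> st (S (idx v)) v = inr w).
  { intros v. destruct (classic (K0 v)) as [Hv|Hv]; [|exists (s_val s0 v); tauto].
    destruct (st (S (idx v)) v) as [p|w] eqn:E; [|exists w; auto].
    destruct (Inv _ _ _ Hv E) as [H1 [_ H3]]. destruct (H3 v H1) as [_ [_ L]]. lia. }
  destruct (choice_fun _ Fin) as [f Hf].
  assert (Mono : forall n m v w, n <= m -> st n v = inr w -> st m v = inr w).
  { intros n m v w L E. induction L as [|m L IH]; auto. cbn. now rewrite IH. }
  exists f. split.
  - intros v Hv.
    assert (G : forall n w, tgt (st n v) w -> K0' w).
    { induction n as [|n IH]; intros w H; [exact H|]. apply IH, Tg; auto. }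
    apply (G (S (idx v))). rewrite (Hf v Hv). reflexivity.
  - intros u v Hu Hv. set (n := S (idx u) + S (idx v)).
    assert (Eu : st n u = inr (f u)) by (apply (Mono (S (idx u))); [unfold n; lia|auto]).
    assert (Ev : st n v = inr (f v)) by (apply (Mono (S (idx v))); [unfold n; lia|auto]).
    destruct (Rel n u v Hu Hv) as [[p [E _]]|H]; [congruence|].
    apply H; [rewrite Eu|rewrite Ev]; reflexivity.
Qed.
End Refinement.

(** * Labelled chains *)

Record chain (U : Type) := Chain {
  clt : U -> U -> Prop;
  clab : U -> label;
  clt_irr : forall x, ~ clt x x;
  clt_trans : forall x y z, clt x y -> clt y z -> clt x z;
  clt_tot : forall x y, x = y \/ clt x y \/ clt y x }.
Arguments clt {U}. Arguments clab {U}. Arguments clt_irr {U}. Arguments clt_trans {U}. Arguments clt_tot {U}.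

Definition incl {U : Type} (S T : U -> Prop) : Prop := forall x, S x -> T x.

Definition blt {U : Type} (c : chain U) (S T : U -> Prop) : Prop := forall x y, S x -> T y -> clt c x y.

(* [cemb n c S c' S']: the chain obtained from [S] by repeating every element [n] times embeds
   into [S']. *)
Definition cemb (n : nat) {U U' : Type} (c : chain U) (S : U -> Prop) (c' : chain U') (S' : U' -> Prop) : Prop :=
  exists f : U -> nat -> U', forall x, S x -> forall i, i < n ->
    S' (f x i) /\ lle (clab c x) (clab c' (f x i)) /\
    (forall j, j < n -> i < j -> clt c' (f x i) (f x j)) /\
    (forall y, S y -> clt c x y -> forall j, j < n -> clt c' (f x i) (f y j)).

(** [Dn] and [Up] are the two halves of the meaning of a code: [Dn c t S] bounds [S] from above by
    [t], while [Up c t S] says that [t] is realised inside [S]. A chain bounded by [t] embeds into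
    any chain realising [t] often enough. *)
Inductive Dn {U : Type} (c : chain U) : cterm -> (U -> Prop) -> Prop :=
| Dn_s l S : (forall x y, S x -> S y -> x = y) -> (forall x, S x -> clab c x = l) -> Dn c (cS l) S
| Dn_c s t S S1 S2 : Dn c s S1 -> Dn c t S2 -> blt c S1 S2 -> (forall x, S x -> S1 x \/ S2 x) -> Dn c (cC s t) S
| Dn_o f S P (i : nat -> nat) : (forall k, Dn c (f (i k)) (P k)) ->
    (forall k k', k < k' -> blt c (P k) (P k')) -> (forall x, S x -> exists k, P k x) -> Dn c (cI Om f) S
| Dn_r f S P (i : nat -> nat) : (forall k, Dn c (f (i k)) (P k)) ->
    (forall k k', k < k' -> blt c (P k') (P k)) -> (forall x, S x -> exists k, P k x) -> Dn c (cI OmRev f) S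
| Dn_e f S (E : U -> U -> Prop) (i : U -> nat) :
    (forall x, S x -> E x x) -> (forall x y z, E x y -> (E x z <-> E y z)) ->
    (forall x y, S x -> S y -> ~ E x y -> clt c x y -> blt c (E x) (E y)) ->
    (forall x, S x -> Dn c (f (i x)) (E x)) -> Dn c (cI Eta f) S.

(** In [Up_e] the family [J] collects sets that realise the whole shuffle: each contains, for every
    [i], a realisation of [f i] with a member of [J] on either side. *)
Inductive Up {U : Type} (c : chain U) : cterm -> (U -> Prop) -> Prop :=
| Up_s l S x : S x -> lle l (clab c x) -> Up c (cS l) S
| Up_c s t S S1 S2 : Up c s S1 -> Up c t S2 -> blt c S1 S2 -> incl S1 S -> incl S2 S -> Up c (cC s t) S
| Up_o f S P (g : nat -> nat -> nat) : (forall k, incl (P k) S) ->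
    (forall k k', k < k' -> blt c (P k) (P k')) ->
    (forall i k, k <= g i k) -> (forall i k, Up c (f i) (P (g i k))) -> Up c (cI Om f) S
| Up_r f S P (g : nat -> nat -> nat) : (forall k, incl (P k) S) ->
    (forall k k', k < k' -> blt c (P k') (P k)) ->
    (forall i k, k <= g i k) -> (forall i k, Up c (f i) (P (g i k))) -> Up c (cI OmRev f) S
| Up_e f S (J : (U -> Prop) -> Prop) T0 (L M N : (U -> Prop) -> nat -> U -> Prop) :
    J T0 -> incl T0 S ->
    (forall T i, J T -> J (L T i) /\ J (N T i) /\ incl (L T i) T /\ incl (M T i) T /\ incl (N T i) T /\
       blt c (L T i) (M T i) /\ blt c (M T i) (N T i) /\ blt c (L T i) (N T i)) ->
    (forall T i, J T -> Up c (f i) (M T i)) -> Up c (cI Eta f) S.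

Lemma Up_incl {U} (c : chain U) t S S' : Up c t S -> incl S S' -> Up c t S'.
Proof.
  intros H HS. destruct H; unfold incl in *.
  - eapply Up_s; eauto.
  - eapply Up_c; eauto; unfold incl; auto.
  - eapply Up_o; eauto; unfold incl; eauto.
  - eapply Up_r; eauto; unfold incl; eauto.
  - eapply Up_e; eauto; unfold incl; eauto.
Qed.

Lemma Up_cle {U} (c : chain U) u S : Up c u S -> forall t, cle t u -> Up c t S.
Proof.
  induction 1 as [l S x Hx Hl|s t S S1 S2 H1 IH1 H2 IH2 HB I1 I2|f S P g HP HB Hg H IH
                 |f S P g HP HB Hg H IH|f S J T0 L M N HJ I0 HJs H IH]; intros u Hu.
  - inversion Hu; subst. eapply Up_s; eauto. eapply lle_trans; eauto.
  - inversion Hu; subst.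
    + apply (Up_c c s0 t0 S S1 S2); auto.
    + apply (Up_incl c u S1 S); auto.
    + apply (Up_incl c u S2 S); auto.
  - inversion Hu as [| | | |k f' g' Hd|k u' f' i Hd]; subst.
    + destruct (choice_fun _ Hd) as [j Hj]. apply (Up_o c f' S P (fun i k => g (j i) k)); auto.
    + eapply Up_incl; [apply (IH i 0); auto|auto].
  - inversion Hu as [| | | |k f' g' Hd|k u' f' i Hd]; subst.
    + destruct (choice_fun _ Hd) as [j Hj]. apply (Up_r c f' S P (fun i k => g (j i) k)); auto.
    + eapply Up_incl; [apply (IH i 0); auto|auto].
  - inversion Hu as [| | | |k f' g' Hd|k u' f' i Hd]; subst.
    + destruct (choice_fun _ Hd) as [j Hj].
      apply (Up_e c f' S J T0 (fun T i => L T (j i)) (fun T i => M T (j i)) (fun T i => N T (j i))); auto.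
    + eapply Up_incl; [apply (IH T0 i); auto|]. destruct (HJs T0 i HJ) as [_ [_ [_ [HM _]]]].
      intros x Hx. auto.
Qed.

(** Needed because one summand of a shuffle may require several consecutive realisations of its code
    when elements are repeated. They are gained by splitting the right-hand member of [J] again and
    again. *)
Lemma eta_split {U} (c : chain U) (f : nat -> cterm) (J : (U -> Prop) -> Prop)
  (L M N : (U -> Prop) -> nat -> U -> Prop) i :
  (forall T i, J T -> J (L T i) /\ J (N T i) /\ incl (L T i) T /\ incl (M T i) T /\ incl (N T i) T /\
     blt c (L T i) (M T i) /\ blt c (M T i) (N T i) /\ blt c (L T i) (N T i)) ->
  (forall T i, J T -> Up c (f i) (M T i)) ->
  forall n T, J T -> exists T1 T2 (D : nat -> U -> Prop), J T1 /\ J T2 /\ incl T1 T /\ incl T2 T /\ blt c T1 T2 /\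
    forall k, k < n -> incl (D k) T /\ Up c (f i) (D k) /\ blt c T1 (D k) /\ blt c (D k) T2 /\
      forall k', k < k' -> k' < n -> blt c (D k) (D k').
Proof.
  intros HJ HU. induction n as [|n IH]; intros T HT.
  - destruct (HJ T i HT) as [A1 [A2 [A3 [A4 [A5 [A6 [A7 A8]]]]]]].
    exists (L T i), (N T i), (fun _ => M T i). repeat split; auto; lia.
  - destruct (HJ T i HT) as [A1 [A2 [A3 [A4 [A5 [A6 [A7 A8]]]]]]].
    destruct (IH (N T i) A2) as [T1 [T2 [D [B1 [B2 [B3 [B4 [B5 B6]]]]]]]].
    exists (L T i), T2, (fun k => match k with 0 => M T i | S k => D k end).
    split; [auto|]. split; [auto|]. split; [auto|]. split; [intros x Hx; auto|].
    split; [intros x y Hx Hy; apply A8; auto|].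
    intros [|k] Hk.
    + split; [auto|]. split; [apply HU; auto|]. split; [auto|].
      split; [intros x y Hx Hy; apply A7; auto|].
      intros [|k'] L1 L2; [lia|]. intros x y Hx Hy. apply A7; auto.
      destruct (B6 k') as [C1 _]; [lia|auto].
    + destruct (B6 k) as [C1 [C2 [C3 [C4 C5]]]]; [lia|].
      split; [intros x Hx; auto|]. split; [auto|]. split; [intros x y Hx Hy; apply A8; auto|].
      split; [auto|]. intros [|k'] L1 L2; [lia|]. apply C5; lia.
Qed.

(** * Codes of chains determine embeddability *)

Lemma Up_inh {U} (c : chain U) t S : Up c t S -> exists x, S x.
Proof.
  induction 1 as [l S x Hx Hl|s t S S1 S2 H1 [x Hx] H2 IH2 HB I1 I2|f S P g HP HB Hg H IH
                 |f S P g HP HB Hg H IH|f S J T0 L M N HJ I0 HJs H IH]; eauto.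
  - destruct (IH 0 0) as [x Hx]. exists x. eapply HP; eauto.
  - destruct (IH 0 0) as [x Hx]. exists x. eapply HP; eauto.
  - destruct (IH T0 0 HJ) as [x Hx]. exists x. apply I0.
    destruct (HJs T0 0 HJ) as [_ [_ [_ [K _]]]]. auto.
Qed.

(** [N] consecutive realisations of [t] have room for [S] with each element repeated [n] times. Only
    single elements and finite sums cost more than one realisation, so a finite [N] exists. The
    clause for [n = 1] makes one realisation enough for plain embeddings. *)
Definition absorbs (n : nat) {U} (c : chain U) (t : cterm) (S : U -> Prop) (N : nat) : Prop :=
  1 <= N /\ (n = 1 -> N = 1) /\
  forall U' (c' : chain U') S' (D : nat -> U' -> Prop),
    (forall k, k < N -> incl (D k) S' /\ Up c' t (D k)) ->
    (forall k k', k < k' -> k' < N -> blt c' (D k) (D k')) -> cemb n c S c' S'.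

Lemma cemb_incl n {U U'} (c : chain U) S1 S2 (c' : chain U') S1' S2' :
  incl S2 S1 -> incl S1' S2' -> cemb n c S1 c' S1' -> cemb n c S2 c' S2'.
Proof.
  intros H1 H2 [f Hf]. exists f. intros x Hx i Hi. destruct (Hf x (H1 x Hx) i Hi) as [A1 [A2 [A3 A4]]].
  split; [auto|]. split; [auto|]. split; [auto|]. intros y Hy. apply A4; auto.
Qed.

Lemma absorbs_sing n {U} (c : chain U) l S : 1 <= n ->
  (forall x y, S x -> S y -> x = y) -> (forall x, S x -> clab c x = l) -> absorbs n c (cS l) S n.
Proof.
  intros Hn HS Hl. split; [auto|]. split; [auto|]. intros U' c' S' D HD Hb.
  assert (He : forall i, exists y, i < n -> D i y /\ lle l (clab c' y)).
  { intros i. destruct (le_lt_dec n i) as [L|L].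
    - destruct (HD 0) as [_ HU]; [lia|]. destruct (Up_inh _ _ _ HU) as [y _]. exists y; lia.
    - destruct (HD i L) as [_ HU]. inversion HU; subst. eauto. }
  destruct (choice_fun _ He) as [e He']. exists (fun _ i => e i).
  intros x Hx i Hi. destruct (He' i Hi) as [E1 E2]. split; [apply (HD i Hi); auto|].
  split; [now rewrite (Hl x Hx)|]. split.
  - intros j Hj L. destruct (He' j Hj) as [E3 _]. apply (Hb i j L Hj); auto.
  - intros y Hy Hlt. exfalso. rewrite (HS x y Hx Hy) in Hlt. eapply clt_irr; eauto.
Qed.

Lemma absorbs_cat n {U} (c : chain U) s t S S1 S2 N1 N2 :
  absorbs n c s S1 N1 -> absorbs n c t S2 N2 -> blt c S1 S2 -> (forall x, S x -> S1 x \/ S2 x) ->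
  absorbs n c (cC s t) S (N1 + N2 - 1).
Proof.
  intros [L1 [E1 H1]] [L2 [E2 H2]] HB HS. split; [lia|]. split; [intros ->; lia|].
  intros U' c' S' D HD Hb.
  assert (Hsp : forall k, exists p : (U' -> Prop) * (U' -> Prop), k < N1 + N2 - 1 ->
     Up c' s (fst p) /\ Up c' t (snd p) /\ blt c' (fst p) (snd p) /\ incl (fst p) (D k) /\ incl (snd p) (D k)).
  { intros k. destruct (le_lt_dec (N1 + N2 - 1) k) as [L|L]; [exists (S', S'); lia|].
    destruct (HD k L) as [_ HU]. inversion HU as [|s' t' S0 S1' S2' A1 A2 A3 A4 A5| | |]; subst.
    exists (S1', S2'); auto. }
  destruct (choice_fun _ Hsp) as [p Hp].
  assert (I1 : forall k y, k < N1 + N2 - 1 -> fst (p k) y -> D k y)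
    by (intros k y L Hy; destruct (Hp k L) as [_ [_ [_ [K _]]]]; auto).
  assert (I2 : forall k y, k < N1 + N2 - 1 -> snd (p k) y -> D k y)
    by (intros k y L Hy; destruct (Hp k L) as [_ [_ [_ [_ K]]]]; auto).
  destruct (H1 U' c' (fun y => exists k, k < N1 /\ fst (p k) y) (fun k => fst (p k))) as [f1 F1].
  { intros k Lk. split; [intros y Hy; eauto|]. apply Hp; lia. }
  { intros k k' L L' x y Hx Hy. apply (Hb k k'); try apply I1; auto; lia. }
  (* The two summands share the realisation number [N1 - 1], whose first part precedes its second
     part. This saves one realisation and keeps the total at [1] when both numbers are [1]. *)
  destruct (H2 U' c' (fun y => exists k, k < N2 /\ snd (p (N1 - 1 + k)) y) (fun k => snd (p (N1 - 1 + k)))) as [f2 F2].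
  { intros k Lk. split; [intros y Hy; eauto|]. apply Hp; lia. }
  { intros k k' L L' x y Hx Hy. apply (Hb (N1 - 1 + k) (N1 - 1 + k')); try apply I2; auto; lia. }
  exists (fun x => if excluded_middle_informative (S1 x) then f1 x else f2 x).
  intros x Hx i Hi. destruct (excluded_middle_informative (S1 x)) as [Sx|Sx].
  - destruct (F1 x Sx i Hi) as [[k [Lk Hk]] [A2 [A3 A4]]].
    split; [apply (HD k); [lia|]; apply I1; auto; lia|]. split; [auto|]. split; [auto|].
    intros y Hy Hlt j Hj. destruct (excluded_middle_informative (S1 y)) as [Sy|Sy]; [auto|].
    destruct (HS y Hy) as [Sy'|Sy']; [contradiction|].
    destruct (F2 y Sy' j Hj) as [[k' [Lk' Hk']] _].
    destruct (Nat.eq_dec k (N1 - 1 + k')) as [E|E].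
    + rewrite <- E in Hk'. destruct (Hp k) as [_ [_ [Q _]]]; [lia|]. apply Q; auto.
    + apply (Hb k (N1 - 1 + k')); [lia|lia|apply I1|apply I2]; auto; lia.
  - destruct (HS x Hx) as [Sx'|Sx']; [contradiction|].
    destruct (F2 x Sx' i Hi) as [[k [Lk Hk]] [A2 [A3 A4]]].
    split; [apply (HD (N1 - 1 + k)); [lia|]; apply I2; auto; lia|]. split; [auto|]. split; [auto|].
    intros y Hy Hlt j Hj. destruct (excluded_middle_informative (S1 y)) as [Sy|Sy].
    + exfalso. apply (clt_irr c x). eapply clt_trans; [exact Hlt|]. apply HB; auto.
    + destruct (HS y Hy) as [Sy'|Sy']; [contradiction|]. auto.
Qed.

Definition dlt (rev : bool) {U} (c : chain U) (A B : U -> Prop) : Prop := if rev then blt c B A else blt c A B.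

Lemma absorbs_omega (rev : bool) n {U} (c : chain U) (t : nat -> cterm) A0 P :
  1 <= n -> (forall k, exists N, absorbs n c (t k) (P k) N) ->
  (forall k k', k < k' -> dlt rev c (P k) (P k')) -> (forall x, A0 x -> exists k, P k x) ->
  forall U' (c' : chain U') S' P',
    (forall k, incl (P' k) S') -> (forall k k', k < k' -> dlt rev c' (P' k) (P' k')) ->
    (forall i k, exists k', k <= k' /\ Up c' (t i) (P' k')) -> cemb n c A0 c' S'.
Proof.
  intros Hn Habs HP HS U' c' S' P' HP'S HP' Hrec.
  destruct (choice_fun _ Habs) as [N HN].
  assert (Hg : forall ik : nat * nat, exists k', snd ik <= k' /\ Up c' (t (fst ik)) (P' k')) by (intros []; apply Hrec).
  destruct (choice_fun _ Hg) as [g Hgs].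
  (* [pos i m] lists sets from position [m] on that realise [t i]. Summand [k] will occupy sets from
     [start k] on and before [start (S k)]. *)
  pose (pos i m := fix pos j := match j with 0 => g (i, m) | S j => g (i, S (pos j)) end).
  assert (Hpos1 : forall i m j, m <= pos i m j).
  { intros i m j. induction j as [|j IH]; cbn [pos]; [apply (Hgs (i, m))|].
    destruct (Hgs (i, S (pos i m j))) as [L _]. cbn in L. fold (pos i m). lia. }
  assert (Hpos2 : forall i m, inc (pos i m)).
  { intros i m j. destruct (Hgs (i, S (pos i m j))) as [L _]. cbn in L |- *. fold (pos i m). lia. }
  assert (Hpos3 : forall i m j, Up c' (t i) (P' (pos i m j))).
  { intros i m [|j]; cbn [pos]; [apply (Hgs (i, m))|]. apply (Hgs (i, S (pos i m j))). }
  pose (start := fix start k := match k with 0 => 0 | S k => S (pos k (start k) (N k)) end).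
  assert (Hstart : forall k k', k < k' -> pos k (start k) (N k) < start k').
  { intros k k' L. induction L as [|k' L IH]; [cbn; fold start; lia|].
    pose proof (Hpos1 k' (start k') (N k')). cbn [start]. lia. }
  pose (Tg k := fun y => exists q, start k <= q /\ q <= pos k (start k) (N k) /\ P' q y).
  assert (HT : forall k k' y y', k < k' -> Tg k y -> Tg k' y' -> if rev then clt c' y' y else clt c' y y').
  { intros k k' y y' L [q [Q1 [Q2 Q3]]] [q' [Q1' [Q2' Q3']]]. pose proof (Hstart k k' L).
    assert (Lq : q < q') by lia. specialize (HP' q q' Lq). unfold dlt in HP'. destruct rev; apply HP'; auto. }
  assert (HF : forall k, cemb n c (P k) c' (Tg k)).
  { intros k. destruct (HN k) as [LN [_ HNk]].
    (* In the reversed case later positions lie lower, so the chosen sets are used backwards. *)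
    apply (HNk U' c' (Tg k) (fun j => P' (pos k (start k) (if rev then N k - S j else j)))).
    - intros j Lj. split; [|apply Hpos3]. intros y Hy. eexists. split; [apply Hpos1|]. split; [|exact Hy].
      apply inc_le; auto. destruct rev; lia.
    - intros j j' L L'. destruct rev.
      + apply HP'. apply inc_lt; auto; lia.
      + apply HP'. apply inc_lt; auto. }
  destruct (choice_fun _ HF) as [F HFs].
  assert (Hpk : forall x, exists k, A0 x -> P k x).
  { intros x. destruct (classic (A0 x)) as [Hx|Hx]; [destruct (HS x Hx) as [k Hk]; eauto|exists 0; tauto]. }
  destruct (choice_fun _ Hpk) as [pk Hpks].
  exists (fun x => F (pk x) x). intros x Hx i Hi.
  destruct (HFs (pk x) x (Hpks x Hx) i Hi) as [A1 [A2 [A3 A4]]].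
  split; [destruct A1 as [q [_ [_ A1]]]; eapply HP'S; eauto|]. split; [auto|]. split; [auto|].
  intros y Hy Hlt j Hj. destruct (HFs (pk y) y (Hpks y Hy) j Hj) as [B1 _].
  destruct (lt_eq_lt_dec (pk x) (pk y)) as [[L|L]|L].
  - pose proof (HT _ _ _ _ L A1 B1) as G. destruct rev; [|exact G]. exfalso.
    apply (clt_irr c x). eapply clt_trans; [exact Hlt|]. apply (HP _ _ L); auto.
  - rewrite <- L. apply A4; auto. rewrite L; auto.
  - pose proof (HT _ _ _ _ L B1 A1) as G. destruct rev; [exact G|]. exfalso.
    apply (clt_irr c x). eapply clt_trans; [exact Hlt|]. apply (HP _ _ L); auto.
Qed.

(** By successive refinement. A task is a union of [E]-classes to be mapped into a member of [J]. A
    stage places the whole class of one element by [eta_split]; the classes to its left and to its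
    right become subtasks for the two outer members of [J]. A value is the sequence of the [n]
    copies of an element. *)
Lemma absorbs_eta n {U} (idx : U -> nat) (idx_inj : forall x y, idx x = idx y -> x = y)
  (c : chain U) (f : nat -> cterm) S (E : U -> U -> Prop) (i : U -> nat) :
  1 <= n ->
  (forall x, S x -> E x x) -> (forall x y z, E x y -> (E x z <-> E y z)) ->
  (forall x y, S x -> S y -> ~ E x y -> clt c x y -> blt c (E x) (E y)) ->
  (forall x, S x -> exists N, absorbs n c (f (i x)) (E x) N) ->
  absorbs n c (cI Eta f) S 1.
Proof.
  intros Hn HE1 HE2 HE3 Habs. split; [auto|]. split; [auto|]. intros U' c' S' D HD _.
  destruct (HD 0) as [HD0 HU]; [lia|].
  destruct (classic (exists x, S x)) as [Hne|Hemp].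
  2:{ destruct (Up_inh _ _ _ HU) as [y _]. exists (fun _ _ => y). intros x Hx. exfalso; eauto. }
  inversion HU as [| | | |f' S0 J T0 L M N HJ0 I0 HJ HUp]; subst.
  pose (rho u v (p q : nat -> U') :=
     (u = v -> forall k, k < n -> lle (clab c u) (clab c' (p k)) /\ forall j, j < n -> k < j -> clt c' (p k) (p j)) /\ (clt c u v -> forall k j, k < n -> j < n -> clt c' (p k) (q j))).
  pose (all (T : U' -> Prop) (p : nat -> U') := forall k, k < n -> T (p k)).
  pose (R (K : U -> Prop) (K' : (nat -> U') -> Prop) := exists T, J T /\ K' = all T /\ incl K S /\ forall u v, K u -> S v -> E u v -> K v).
  destruct (refinement U (nat -> U') bool idx idx_inj rho R S (all T0)) as [F [F1 F2]].
  - intros K K' [T [HT [-> [HKS HKE]]]] x Kx.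
    assert (Sx := HKS x Kx). destruct (Habs x Sx) as [N' [LN [_ HN]]].
    destruct (eta_split c' f J L M N (i x) HJ HUp N' T HT) as [T1 [T2 [Ds [B1 [B2 [B3 [B4 [B5 B6]]]]]]]].
    destruct (HN U' c' (fun y => exists k, k < N' /\ Ds k y) Ds) as [g Hg].
    { intros k Lk. split; [intros y Hy; eauto|]. apply B6; auto. }
    { intros k k' Lk Lk'. apply B6; auto; lia. }
    assert (Hsym : forall u v, E u v -> S u -> E v u).
    { intros u v H Hu. apply (HE2 u v u H). auto. }
    assert (Htr : forall u v w, E u v -> E v w -> E u w).
    { intros u v w H1 H2. now apply (HE2 u v w H1). }
    pose (st := Step U (nat -> U') bool g (E x)
                 (fun v => if excluded_middle_informative (clt c v x) then true else false)
                 (fun b => if b then all T1 else all T2)).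
    assert (Hcls : forall v, K v -> ~ E x v ->
        (s_cls _ _ _ st v = true /\ clt c v x /\ blt c (E v) (E x)) \/
        (s_cls _ _ _ st v = false /\ clt c x v /\ blt c (E x) (E v))).
    { intros v Kv Ev. cbn. destruct (excluded_middle_informative (clt c v x)) as [Lv|Lv].
      - left. split; auto. split; auto. apply HE3; auto.
      - right. split; auto. destruct (clt_tot c x v) as [->|[L1|L1]]; [exfalso; auto| |contradiction].
        split; auto. }
    assert (Hcross : forall u v, K u -> K v -> ~ E x u -> ~ E x v ->
        s_cls _ _ _ st u = true -> s_cls _ _ _ st v = false -> clt c u v).
    { intros u v Ku Kv Eu Ev C1 C2. destruct (Hcls u Ku Eu) as [[_ [L1 _]]|[C _]]; [|congruence].
      destruct (Hcls v Kv Ev) as [[C _]|[_ [L2 _]]]; [congruence|]. eapply clt_trans; eauto. }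
    exists st. split.
    + cbn. auto.
    + intros v Kv Ev k Lk. cbn in *. destruct (Hg v Ev k Lk) as [[q [Lq Hq]] _].
      apply (B6 q Lq); auto.
    + intros v Kv Ev w Hw k Lk. cbn in Hw. destruct (excluded_middle_informative (clt c v x)); auto.
    + intros v Kv Ev. cbn in Ev.
      assert (G : forall T', J T' -> R (pend _ _ _ K st v) (all T')).
      { intros T' HT'. exists T'. split; [auto|]. split; [auto|]. split; [intros u [Hu _]; auto|].
        intros u w [U1 [U2 U3]] Sw Euw. cbn in U2.
        assert (Kw : K w) by (eapply HKE; eauto).
        assert (Ew : ~ E x w) by (intros Q; apply U2; eapply Htr; [exact Q|apply Hsym; auto]).
        split; [auto|]. split; [exact Ew|].
        destruct (Hcls u U1 U2) as [[C1 [C2 C3]]|[C1 [C2 C3]]];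
        destruct (Hcls w Kw Ew) as [[C4 [C5 C6]]|[C4 [C5 C6]]]; try congruence; exfalso.
        - apply (clt_irr c x). eapply clt_trans; [exact C5|]. apply C3; auto.
        - apply (clt_irr c x). eapply clt_trans; [|exact C5]. apply C3; auto. }
      cbn [s_tgt st]. destruct (s_cls U (nat -> U') bool st v); apply G; auto.
    + intros u v Ku Kv Eu Ev. cbn in *. split.
      * intros <- k Lk. destruct (Hg u Eu k Lk) as [_ [A2 [A3 _]]]. auto.
      * intros Lt k j Lk Lj. destruct (Hg u Eu k Lk) as [_ [_ [_ A4]]]. apply A4; auto.
    + intros u v w Ku Kv Eu Ev Hw. cbn [s_val s_done s_tgt st] in *.
      assert (G : forall k, k < n -> exists q, q < N' /\ Ds q (g u k)) by (intros k Lk; apply (Hg u Eu k Lk)).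
      destruct (Hcls v Kv Ev) as [[C1 [C2 C3]]|[C1 [C2 C3]]]; rewrite C1 in Hw.
      * assert (Lvu : clt c v u) by (apply C3; auto).
        split; split; try (intros ->; exfalso; eapply clt_irr; eauto); try (intros <-; exfalso; eapply clt_irr; eauto).
        -- intros Lt. exfalso. eapply clt_irr. eapply clt_trans; eauto.
        -- intros _ k j Lk Lj. destruct (G j Lj) as [q [Lq Hq]].
           destruct (B6 q Lq) as [_ [_ [Q1 [Q2 _]]]]. apply Q1; auto.
      * assert (Luv : clt c u v) by (apply C3; auto).
        split; split; try (intros ->; exfalso; eapply clt_irr; eauto); try (intros <-; exfalso; eapply clt_irr; eauto).
        -- intros _ k j Lk Lj. destruct (G k Lk) as [q [Lq Hq]].
           destruct (B6 q Lq) as [_ [_ [Q1 [Q2 _]]]]. apply Q2; auto.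
        -- intros Lt. exfalso. eapply clt_irr. eapply clt_trans; eauto.
    + intros u v w w' Ku Kv Eu Ev Hne' Hw Hw'. cbn [s_done s_tgt st] in *.
      split; [intros ->; congruence|]. intros Lt k j Lk Lj.
      destruct (s_cls U (nat -> U') bool st u) eqn:Cu; destruct (s_cls U (nat -> U') bool st v) eqn:Cv; try congruence.
      * apply B5; auto.
      * exfalso. eapply clt_irr. eapply clt_trans; [exact Lt|]. apply Hcross; auto.
  - exists T0. split; [auto|]. split; [auto|]. split; [intros x Hx; auto|auto].
  - exact Hne.
  - exists F. intros x Hx k Lk.
    split; [apply HD0, I0, F1; auto|]. destruct (F2 x x Hx Hx) as [G1 _].
    destruct (G1 eq_refl k Lk) as [G2 G3]. split; [auto|]. split; [auto|].
    intros y Hy Lt j Lj. destruct (F2 x y Hx Hy) as [_ G4]. apply G4; auto.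
Qed.

Theorem chain_absorb {U} (idx : U -> nat) (idx_inj : forall x y, idx x = idx y -> x = y)
  (c : chain U) t S n : 1 <= n -> Dn c t S -> exists N, absorbs n c t S N.
Proof.
  intros Hn. induction 1 as [l S H1 H2|s t S S1 S2 _ [N1 H1] _ [N2 H2] HB HS|f S P i _ IH HB HS
                            |f S P i _ IH HB HS|f S E i HE1 HE2 HE3 _ IH].
  - exists n. now apply absorbs_sing.
  - exists (N1 + N2 - 1). eapply absorbs_cat; eauto.
  - exists 1. split; [auto|]. split; [auto|]. intros U' c' S' D HD _.
    destruct (HD 0) as [HD0 HU]; [lia|]. inversion HU as [| |f' S0 P' g A1 A2 A3 A4| |]; subst.
    apply (cemb_incl n c S S c' (D 0) S'); [intros x; auto|auto|].
    apply (absorbs_omega false n c (fun k => f (i k)) S P Hn IH HB HS U' c' (D 0) P' A1 A2).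
    intros k m. exists (g (i k) m). auto.
  - exists 1. split; [auto|]. split; [auto|]. intros U' c' S' D HD _.
    destruct (HD 0) as [HD0 HU]; [lia|]. inversion HU as [| | |f' S0 P' g A1 A2 A3 A4|]; subst.
    apply (cemb_incl n c S S c' (D 0) S'); [intros x; auto|auto|].
    apply (absorbs_omega true n c (fun k => f (i k)) S P Hn IH HB HS U' c' (D 0) P' A1 A2).
    intros k m. exists (g (i k) m). auto.
  - exists 1. eapply (absorbs_eta n idx idx_inj c f S E i); eauto.
Qed.

Lemma gle_refl t : gle t t.
Proof. induction t; auto using gle. Qed.

Lemma lle_refl l : lle l l.
Proof. split; [reflexivity|apply gle_refl]. Qed.

(** The [k]-th step also overtakes the element of index [k], which makes the sequence cofinal. *)
Lemma cofinal_seq {U} (idx : U -> nat) (idx_inj : forall x y, idx x = idx y -> x = y)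
  (r : U -> U -> Prop) (K : U -> Prop) x0 :
  (forall x y z, r x y -> r y z -> r x z) -> (forall x y, x = y \/ r x y \/ r y x) ->
  K x0 -> (forall z, K z -> exists z', K z' /\ r z z') ->
  exists s : nat -> U, s 0 = x0 /\ (forall k, K (s k)) /\ (forall k, r (s k) (s (S k))) /\
    forall z, K z -> exists k, r z (s k).
Proof.
  intros Ht Htot H0 Hup.
  destruct (dep_choice (fun _ z => K z)
     (fun k z z' => r z z' /\ forall w, K w -> idx w = k -> r w z') x0 H0) as [s [S0 [S1 S2]]].
  { intros k z Hz. destruct (Hup z Hz) as [z1 [K1 R1]].
    destruct (classic (exists w, K w /\ idx w = k)) as [[w [Kw Ew]]|HN].
    - destruct (Htot w z1) as [->|[L|L]].
      + destruct (Hup z1 K1) as [z2 [K2 R2]]. exists z2. split; auto. split; eauto.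
        intros w' Kw' Ew'. rewrite <- Ew in Ew'. apply idx_inj in Ew'. now subst.
      + exists z1. split; auto. split; auto.
        intros w' Kw' Ew'. rewrite <- Ew in Ew'. apply idx_inj in Ew'. now subst.
      + destruct (Hup w Kw) as [z2 [K2 R2]]. exists z2. split; auto. split; eauto.
        intros w' Kw' Ew'. rewrite <- Ew in Ew'. apply idx_inj in Ew'. now subst.
    - exists z1. split; auto. split; auto. intros w Kw Ew. exfalso; eauto. }
  exists s. split; [auto|]. split; [auto|]. split; [apply S2|].
  intros z Kz. exists (S (idx z)). now apply S2.
Qed.

(** * Every countable labelled chain has a code *)

Section Laver.
Variables (U : Type) (idx : U -> nat).
Hypothesis idx_inj : forall x y, idx x = idx y -> x = y.
Variable c : chain U.
Local Notation lt := (clt c).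
Definition wle x y := x = y \/ lt x y.
Local Notation le := wle.

Lemma lt_asym x y : lt x y -> lt y x -> False.
Proof. intros H1 H2. exact (clt_irr c x (clt_trans c _ _ _ H1 H2)). Qed.

Lemma le_lt x y z : le x y -> lt y z -> lt x z.
Proof. intros [->|H] H'; auto. exact (clt_trans c _ _ _ H H'). Qed.

Lemma lt_le x y z : lt x y -> le y z -> lt x z.
Proof. intros H [<-|H']; auto. exact (clt_trans c _ _ _ H H'). Qed.

Lemma le_tr x y z : le x y -> le y z -> le x z.
Proof. intros [->|H] H'; auto. right. exact (lt_le _ _ _ H H'). Qed.

Lemma le_or_lt x y : le x y \/ lt y x.
Proof. destruct (clt_tot c x y) as [->|[H|H]]; unfold wle; auto. Qed.

Definition coded (S : U -> Prop) : Prop := exists t, Dn c t S /\ Up c t S.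

Lemma coded_single x : coded (eq x).
Proof.
  exists (cS (clab c x)). split.
  - apply Dn_s; [intros y z <- <-; auto|intros y <-; auto].
  - apply (Up_s c _ _ x); auto. apply lle_refl.
Qed.

Lemma coded_cat S S1 S2 : coded S1 -> coded S2 -> blt c S1 S2 -> (forall x, S x <-> S1 x \/ S2 x) -> coded S.
Proof.
  intros [t1 [D1 U1]] [t2 [D2 U2]] HB HS. exists (cC t1 t2). split.
  - apply (Dn_c c t1 t2 S S1 S2); auto. intros x; apply HS.
  - apply (Up_c c t1 t2 S S1 S2); auto; intros x Hx; apply HS; auto.
Qed.

(** By [bqo_recurrent] the codes of all pieces from some point on recur, so the tail is coded by an
    infinite term; the finitely many earlier pieces are added by [cC]. *)
Lemma coded_omega (rev : bool) A P : (forall k, coded (P k)) ->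
  (forall k k', k < k' -> dlt rev c (P k) (P k')) -> (forall x, A x <-> exists k, P k x) -> coded A.
Proof.
  intros HP Hd HA. destruct (choice_fun _ HP) as [t Ht].
  destruct (bqo_recurrent cle t cle_bqo) as [K HK].
  pose (tail n := fun x => exists k, n <= k /\ P k x).
  assert (HT : coded (tail K)).
  { exists (cI (if rev then OmRev else Om) (fun k => t (K + k))).
    assert (Hg : forall ik : nat * nat, exists l, snd ik <= l /\ cle (t (K + fst ik)) (t (K + l))).
    { intros [i k]. destruct (HK (K + i)) with (m := K + k) as [l [L Hl]]; [lia|].
      exists (l - K). cbn. split; [lia|]. now replace (K + (l - K)) with l by lia. }
    destruct (choice_fun _ Hg) as [g Hgs].
    assert (E1 : forall k, Dn c (t (K + k)) (P (K + k))) by (intros k; apply Ht).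
    assert (E2 : forall k k', k < k' -> dlt rev c (P (K + k)) (P (K + k'))) by (intros; apply Hd; lia).
    assert (E3 : forall x, tail K x -> exists k, P (K + k) x).
    { intros x [k [L Hk]]. exists (k - K). now replace (K + (k - K)) with k by lia. }
    assert (E4 : forall k, incl (P (K + k)) (tail K)) by (intros k x Hx; exists (K + k); split; [lia|auto]).
    assert (E5 : forall i k, k <= g (i, k)) by (intros i k; apply (Hgs (i, k))).
    assert (E6 : forall i k, Up c (t (K + i)) (P (K + g (i, k)))).
    { intros i k. eapply Up_cle; [apply Ht|]. apply (Hgs (i, k)). }
    destruct rev; split.
    - apply (Dn_r c _ _ (fun k => P (K + k)) (fun k => k)); auto.
    - apply (Up_r c _ _ (fun k => P (K + k)) (fun i k => g (i, k))); auto.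
    - apply (Dn_o c _ _ (fun k => P (K + k)) (fun k => k)); auto.
    - apply (Up_o c _ _ (fun k => P (K + k)) (fun i k => g (i, k))); auto. }
  assert (H0 : coded (tail 0)).
  { assert (G : forall m, m <= K -> coded (tail (K - m))).
    { induction m as [|m IH]; intros L; [now rewrite Nat.sub_0_r|].
      specialize (IH ltac:(lia)). set (j := K - S m). replace (K - m) with (S j) in IH by (unfold j; lia).
      assert (E : forall x, tail j x <-> P j x \/ tail (S j) x).
      { intros x. split.
        - intros [k [Lk Hk]]. destruct (Nat.eq_dec j k) as [->|Hn]; [auto|]. right. exists k; split; [lia|auto].
        - intros [Hx|[k [Lk Hk]]]; [exists j; auto|exists k; split; [lia|auto]]. }
      destruct rev.
      - apply (coded_cat _ (tail (S j)) (P j)); auto.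
        + intros x y [k [Lk Hx]] Hy. apply (Hd j k); auto.
        + intros x. rewrite E. tauto.
      - apply (coded_cat _ (P j) (tail (S j))); auto.
        intros x y Hx [k [Lk Hy]]. apply (Hd j k); auto. }
    specialize (G K (le_n _)). now rewrite Nat.sub_diag in G. }
  replace A with (tail 0); auto. apply pred_ext. intros x. rewrite HA. split.
  - intros [k [_ H]]; eauto.
  - intros [k H]; exists k; split; [lia|auto].
Qed.

Variable A : U -> Prop.

Definition iv a b : U -> Prop := fun z => A z /\ le a z /\ lt z b.

(** The condensation behind Laver's theorem: elements are identified when all intervals between them
    are coded. The classes turn out to be coded; were there several, they would be densely ordered,
    and a shuffle would code an interval that ought not to be coded. *)
Definition gi x y : Prop := forall a b, A a -> A b -> le x a -> lt a b -> le b y -> coded (iv a b).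

Definition E x y : Prop := A x /\ A y /\ gi x y /\ gi y x.

Lemma E_iv x y a b : E x y -> A a -> A b -> le x a -> lt a b -> le b y -> coded (iv a b).
Proof. intros [_ [_ [H _]]]. apply H. Qed.

Lemma E_refl x : A x -> E x x.
Proof.
  intros Hx. assert (G : gi x x); [|split; auto].
  intros a b _ _ L1 L2 L3. exfalso. apply (clt_irr c x). eapply le_lt; [exact L1|]. eapply lt_le; eauto.
Qed.

Lemma E_sym x y : E x y -> E y x.
Proof. intros [H1 [H2 [H3 H4]]]. split; auto. Qed.

Lemma gi_trans x y z : A y -> gi x y -> gi y z -> gi x z.
Proof.
  intros Hy H1 H2 a b Ha Hb L1 L2 L3.
  destruct (le_or_lt y a) as [L|L]; [apply H2; auto|].
  destruct (le_or_lt b y) as [L'|L']; [apply H1; auto|].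
  apply (coded_cat _ (iv a y) (iv y b)).
  - apply H1; auto. left; auto.
  - apply H2; auto. left; auto.
  - intros u v [_ [_ L4]] [_ [L5 _]]. eapply lt_le; eauto.
  - intros u. unfold iv. split.
    + intros [Hu [L4 L5]]. destruct (le_or_lt y u); auto.
    + intros [[Hu [L4 L5]]|[Hu [L4 L5]]].
      * split; auto. split; auto. eapply clt_trans; eauto.
      * split; auto. split; auto. right. eapply lt_le; eauto.
Qed.

Lemma E_trans x y z : E x y -> E y z -> E x z.
Proof.
  intros [H1 [H2 [H3 H4]]] [_ [H5 [H6 H7]]]. split; auto. split; auto.
  split; [exact (gi_trans x y z H2 H3 H6)|exact (gi_trans z y x H2 H7 H4)].
Qed.

Lemma E_conv x y z : E x z -> A y -> lt x y -> lt y z -> E x y.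
Proof.
  intros [Hx [Hz [H1 H2]]] Hy L1 L2. split; auto. split; auto. split.
  - intros a b Ha Hb M1 M2 M3. apply H1; auto. right. eapply le_lt; eauto.
  - intros a b Ha Hb M1 M2 M3. exfalso. apply (lt_asym x y L1). eapply le_lt; [exact M1|]. eapply lt_le; eauto.
Qed.

Lemma E_conv' x y z : E x z -> A y -> lt x y -> lt y z -> E y z.
Proof. intros H Hy L1 L2. eapply E_trans; [|exact H]. apply E_sym. eapply E_conv; eauto. Qed.

Lemma E_sep a b : ~ E a b -> lt a b -> blt c (E a) (E b).
Proof.
  intros HN L x y Hx Hy.
  assert (Ax : A x) by apply Hx. assert (Ay : A y) by apply Hy.
  assert (Aa : A a) by apply Hx. assert (Ab : A b) by apply Hy.
  assert (L1 : lt a y).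
  { destruct (clt_tot c a y) as [->|[H|H]]; auto; exfalso; apply HN.
    - apply E_sym; exact Hy.
    - apply E_conv' with (x := y); auto. apply E_sym; auto. }
  destruct (clt_tot c x y) as [->|[H|H]]; auto; exfalso; apply HN.
  - eapply E_trans; [exact Hx|]. apply E_sym; auto.
  - eapply E_trans; [|apply E_sym; exact Hy]. eapply E_conv; eauto.
Qed.

Definition upper x : U -> Prop := fun z => E x z /\ le x z.
Definition lower x : U -> Prop := fun z => E x z /\ lt z x.

(** Either there is a last element, or a cofinal sequence cuts the set into an omega-sum of
    intervals, each coded by the definition of [E]. *)
Lemma coded_upper x : A x -> coded (upper x).
Proof.
  intros Ax. destruct (classic (exists m, upper x m /\ forall z, upper x z -> le z m)) as [[m [[Hm Lm] Hmax]]|HN].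
  - destruct Lm as [<-|Lm].
    + replace (upper x) with (eq x); [apply coded_single|]. apply pred_ext. intros z. split.
      * intros <-. split; [now apply E_refl|left; auto].
      * intros Hz. destruct (Hmax z Hz) as [->|L]; auto. destruct Hz as [_ [L'|L']]; auto.
        exfalso; eapply lt_asym; eauto.
    + apply (coded_cat _ (iv x m) (eq m)).
      * apply (E_iv x m); auto; [apply Hm|left; auto|left; auto].
      * apply coded_single.
      * intros u v [_ [_ L]] <-; auto.
      * intros z. split.
        -- intros Hz. destruct (Hmax z Hz) as [->|L]; auto. left. split; [apply Hz|]. split; [apply Hz|auto].
        -- intros [[Az [L1 L2]]|<-]; [|split; [auto|right; auto]]. split; [|auto].
           destruct L1 as [<-|L1]; [now apply E_refl|]. eapply E_conv; eauto.
  - destruct (cofinal_seq idx idx_inj lt (upper x) x) as [s [S0 [S1 [S2 S3]]]].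
    + apply clt_trans.
    + apply clt_tot.
    + split; [now apply E_refl|left; auto].
    + intros z Hz. apply NNPP; intros H. apply HN. exists z. split; auto. intros w Hw.
      destruct (le_or_lt w z); auto. exfalso; eauto.
    + assert (Sm : forall i j, i <= j -> le (s i) (s j)).
      { intros i j L. induction L as [|j L IH]; [left; auto|]. right. eapply le_lt; eauto. }
      apply (coded_omega false _ (fun k => iv (s k) (s (S k)))).
      * intros k. destruct (S1 k) as [E1 L1]. destruct (S1 (S k)) as [E2 L2].
        apply (E_iv x (s (S k)) _ _ E2 (proj1 (proj2 E1)) (proj1 (proj2 E2)) L1 (S2 k)). left; auto.
      * intros k k' L u v [_ [_ L1]] [_ [L2 _]]. eapply lt_le; [exact L1|]. eapply le_tr; [|exact L2]. apply Sm. lia.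
      * intros z. split.
        -- intros Hz. destruct (S3 z Hz) as [k Hk]. induction k as [|k IH].
           ++ rewrite S0 in Hk. destruct Hz as [_ L]. exfalso. apply (clt_irr c x). eapply le_lt; eauto.
           ++ destruct (le_or_lt (s k) z) as [L|L]; auto. exists k. split; [apply Hz|auto].
        -- intros [k [Az [L1 L2]]]. destruct (S1 k) as [E1 M1]. destruct (S1 (S k)) as [E2 M2].
           assert (L : le x z) by exact (le_tr _ _ _ M1 L1). split; auto.
           destruct L as [<-|L]; [now apply E_refl|]. eapply E_conv; eauto.
Qed.

Lemma coded_lower x : A x -> (exists z, lower x z) -> coded (lower x).
Proof.
  intros Ax Hne. destruct (classic (exists m, lower x m /\ forall z, lower x z -> le m z)) as [[m [[Hm Lm] Hmin]]|HN].
  - replace (lower x) with (iv m x).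
    + apply (E_iv m x); auto; [now apply E_sym|apply Hm|left; auto|left; auto].
    + apply pred_ext. intros z. split.
      * intros [Az [[<-|L1] L2]]; [split; auto|]. split; [|auto]. apply E_sym. eapply E_conv'; eauto. now apply E_sym.
      * intros Hz. split; [apply Hz|]. split; [auto|apply Hz].
  - destruct (cofinal_seq idx idx_inj (fun a b => lt b a) (fun z => z = x \/ lower x z) x) as [s [S0 [S1 [S2 S3]]]].
    + intros a b d L1 L2. eapply clt_trans; eauto.
    + intros a b. destruct (clt_tot c a b) as [H|[H|H]]; auto.
    + auto.
    + intros z [->|Hz]; [destruct Hne as [w Hw]; exists w; split; [auto|apply Hw]|].
      apply NNPP; intros H. apply HN. exists z. split; auto. intros w Hw.
      destruct (le_or_lt z w); auto. exfalso; eauto.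
    + assert (Sm : forall i j, i <= j -> le (s j) (s i)).
      { intros i j L. induction L as [|j L IH]; [left; auto|]. right. eapply lt_le; eauto. }
      assert (SE : forall k, E x (s k)) by (intros k; destruct (S1 k) as [->|[H _]]; auto using E_refl).
      assert (SL : forall k, lower x (s (S k))).
      { intros k. destruct (S1 (S k)) as [H|H]; auto. exfalso. apply (clt_irr c x).
        specialize (S2 k). rewrite H in S2. eapply lt_le; [exact S2|]. rewrite <- S0. apply Sm. lia. }
      apply (coded_omega true _ (fun k => iv (s (S k)) (s k))).
      * intros k. apply (E_iv (s (S k)) x _ _ (E_sym _ _ (SE (S k))) (proj1 (proj2 (SE (S k)))) (proj1 (proj2 (SE k)))
                    (or_introl eq_refl) (S2 k)).
        rewrite <- S0. apply Sm. lia.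
      * intros k k' L u v [_ [_ L1]] [_ [L2 _]]. eapply lt_le; [exact L1|]. eapply le_tr; [|exact L2]. apply Sm. lia.
      * intros z. split.
        -- intros Hz. destruct (S3 z (or_intror Hz)) as [k Hk]. induction k as [|k IH].
           ++ rewrite S0 in Hk. destruct Hz as [_ L]. exfalso. eapply lt_asym; eauto.
           ++ destruct (le_or_lt (s k) z) as [L|L].
              ** destruct L as [<-|L]; [|auto]. destruct k as [|k].
                 --- exfalso. rewrite S0 in Hz. destruct Hz as [_ Hz]. eapply clt_irr; eauto.
                 --- exists k. split; [apply Hz|]. split; [left; auto|apply S2].
              ** exists k. split; [apply Hz|]. split; [right; auto|auto].
        -- intros [k [Az [L1 L2]]].
           assert (L : lt z x) by (eapply lt_le; [exact L2|]; rewrite <- S0; apply Sm; lia).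
           split; auto. destruct L1 as [<-|L1]; auto. apply E_sym. eapply E_conv'; eauto. apply E_sym, SE.
Qed.

Lemma coded_class x : A x -> coded (E x).
Proof.
  intros Ax. destruct (classic (exists z, lower x z)) as [H|H].
  - apply (coded_cat _ (lower x) (upper x)).
    + now apply coded_lower.
    + now apply coded_upper.
    + intros u v [_ L1] [_ L2]. eapply lt_le; eauto.
    + intros z. unfold lower, upper. destruct (le_or_lt x z); tauto.
  - replace (E x) with (upper x); [now apply coded_upper|]. apply pred_ext. intros z. unfold upper.
    split; [tauto|]. intros Hz. split; auto. destruct (le_or_lt x z) as [L|L]; auto.
    exfalso. apply H. exists z. split; auto.
Qed.

Definition mid a b : U -> Prop := fun z => A z /\ lt a z /\ lt z b /\ ~ E a z /\ ~ E z b.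

(** The interval consists of the remainder of the class of [a], the classes strictly between, and
    the beginning of the class of [b]. *)
Lemma coded_iv_mid a b : A a -> A b -> lt a b -> ~ E a b -> ((exists z, mid a b z) -> coded (mid a b)) -> coded (iv a b).
Proof.
  intros Aa Ab L HN HM.
  assert (G : forall T, coded T -> (forall z, T z <-> iv a b z /\ ~ E z b) -> coded (iv a b)).
  { intros T HT HTs. destruct (classic (exists z, lower b z)) as [H|H].
    - apply (coded_cat _ T (lower b)); auto.
      + now apply coded_lower.
      + intros u v Hu [Hv Lv]. apply HTs in Hu. destruct Hu as [[Au [L1 L2]] Nu].
        apply (E_sep u b); auto. now apply E_refl.
      + intros z. rewrite HTs. split.
        * intros Hz. destruct (classic (E z b)) as [Ez|Ez]; [right|left; auto].
          split; [now apply E_sym|apply Hz].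
        * intros [[Hz _]|[Ez Lz]]; auto. split; [apply Ez|]. split; auto.
          right. apply (E_sep a b); auto. now apply E_refl.
    - replace (iv a b) with T; auto. apply pred_ext. intros z. rewrite HTs. split; [tauto|].
      intros Hz. split; auto. intros Ez. apply H. exists z. split; [now apply E_sym|apply Hz]. }
  assert (HU : forall z, upper a z -> iv a b z /\ ~ E z b).
  { intros z [Ez Lz]. assert (Nz : ~ E z b) by (intros Q; apply HN; eapply E_trans; eauto).
    split; auto. split; [apply Ez|]. split; auto. apply (E_sep a b); auto. now apply E_refl. }
  destruct (classic (exists z, mid a b z)) as [H|H].
  - apply (G (fun z => upper a z \/ mid a b z)).
    + apply (coded_cat _ (upper a) (mid a b)); auto; [now apply coded_upper| |tauto].
      intros u v [Eu Lu] [Av [L1 [L2 [N1 N2]]]]. apply (E_sep a v); auto. now apply E_refl.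
    + intros z. split.
      * intros [Hz|Hz]; auto. destruct Hz as [Az [L1 [L2 [N1 N2]]]]. split; auto. split; auto. split; auto. right; auto.
      * intros [[Az [L1 L2]] Nz]. destruct (classic (E a z)) as [Ez|Ez]; [left; split; auto|right].
        destruct L1 as [<-|L1]; [exfalso; apply Ez; now apply E_refl|]. split; auto.
  - apply (G (upper a)); [now apply coded_upper|]. intros z. split; auto.
    intros [[Az [L1 L2]] Nz]. split; auto. apply NNPP; intros Ez. apply H. exists z.
    destruct L1 as [<-|L1]; [exfalso; apply Ez; now apply E_refl|]. split; auto.
Qed.

Definition gap a b : Prop := A a /\ A b /\ lt a b /\ ~ E a b.

(** With no class in between, [coded_iv_mid] would code every interval from [a] to [b]. *)
Lemma gap_dense a b : gap a b -> exists z, mid a b z.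
Proof.
  intros [Aa [Ab [L HN]]]. apply NNPP; intros H. apply HN. split; auto. split; auto. split.
  2:{ intros p q _ _ L1 L2 L3. exfalso. apply (lt_asym a b L). eapply le_lt; [exact L1|]. eapply lt_le; eauto. }
  intros p q Ap Aq L1 L2 L3.
  destruct (classic (E p q)) as [Epq|Npq]; [apply (E_iv p q); auto; left; auto|].
  apply coded_iv_mid; auto. intros [z [Az [M1 [M2 [M3 M4]]]]]. exfalso. apply H. exists z.
  assert (La : lt a z) by (eapply le_lt; eauto). assert (Lb : lt z b) by (eapply lt_le; eauto).
  split; auto. split; auto. split; auto. split.
  - intros Q. apply M3. destruct L1 as [<-|L1]; auto. eapply E_conv'; eauto.
  - intros Q. apply M4. destruct L3 as [->|L3]; auto. eapply E_conv; eauto.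
Qed.

Lemma mid_mono a b p q z : le a p -> le q b -> A p -> A q -> mid p q z -> mid a b z.
Proof.
  intros L1 L2 Ap Aq [Az [M1 [M2 [M3 M4]]]].
  assert (La : lt a z) by (eapply le_lt; eauto). assert (Lb : lt z b) by (eapply lt_le; eauto).
  split; auto. split; auto. split; auto. split.
  - intros Q. apply M3. destruct L1 as [<-|L1]; auto. eapply E_conv'; eauto.
  - intros Q. apply M4. destruct L2 as [->|L2]; auto. eapply E_conv; eauto.
Qed.

(** As codes are better-quasi-ordered, a gap can be shrunk until every code of a class inside it is
    dominated inside each of its subgaps. The classes inside then form a shuffle, so all intervals
    of this gap are coded and its ends are equivalent after all. *)
Lemma no_gap a b : ~ gap a b.
Proof.
  intros Hab.
  assert (Ht : forall x, exists t, A x -> Dn c t (E x) /\ Up c t (E x)).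
  { intros x. destruct (classic (A x)) as [Ax|Ax]; [|exists (cS (clab c x)); tauto].
    destruct (coded_class x Ax) as [t H]. eauto. }
  destruct (choice_fun _ Ht) as [t Hts].
  assert (Hmin : exists p q, gap p q /\ forall p' q', gap p' q' -> le p p' -> le q' q ->
      forall z, mid p q z -> exists z', mid p' q' z' /\ cle (t z) (t z')).
  { apply NNPP; intros HN.
    destruct (dep_choice (fun _ g => gap (fst g) (snd g))
      (fun _ g g' => le (fst g) (fst g') /\ le (snd g') (snd g) /\ exists z, mid (fst g) (snd g) z /\
          forall z', mid (fst g') (snd g') z' -> ~ cle (t z) (t z')) (a, b) Hab) as [s [_ [S1 S2]]].
    { intros _ [p q] Hpq. cbn in *. apply NNPP; intros H. apply HN. exists p, q. split; auto.
      intros p' q' Hpq' L1 L2 z Hz. apply NNPP; intros H'. apply H. exists (p', q'). cbn. split; auto.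
      split; auto. split; auto. exists z. split; auto. intros z' Hz' Q. apply H'. eauto. }
    assert (S3 : forall n, exists z, mid (fst (s n)) (snd (s n)) z /\
        forall z', mid (fst (s (S n))) (snd (s (S n))) z' -> ~ cle (t z) (t z')) by (intros n; apply S2).
    destruct (choice_fun _ S3) as [z Hz].
    destruct (bqo_seq cle (fun n => t (z n)) cle_bqo) as [i [j [L Hle]]].
    apply (proj2 (Hz i) (z j)); auto.
    assert (G : forall n m, n <= m -> le (fst (s n)) (fst (s m)) /\ le (snd (s m)) (snd (s n))).
    { intros n m Lm. induction Lm as [|m Lm [I1 I2]]; [split; left; auto|].
      destruct (S2 m) as [Q1 [Q2 _]]. split; eapply le_tr; eauto. }
    destruct (G (S i) j L) as [G1 G2].
    eapply mid_mono; [exact G1|exact G2|apply S1|apply S1|apply Hz]. }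
  clear a b Hab. destruct Hmin as [a [b [Hab Hmin]]].
  assert (Hmid : forall p q, gap p q -> le a p -> le q b -> coded (mid p q)).
  { intros p q Hpq L1 L2. destruct (gap_dense p q Hpq) as [z0 Hz0].
    destruct Hpq as [Ap [Aq [Lpq Npq]]].
    (* [e] will list the elements of [mid p q] by index, with [z0] for the indices not taken. *)
    assert (He : forall n, exists z, mid p q z /\ ((exists z', mid p q z' /\ idx z' = n) -> idx z = n)).
    { intros n. destruct (classic (exists z', mid p q z' /\ idx z' = n)) as [[z [H1 H2]]|H]; [exists z; auto|].
      exists z0; tauto. }
    destruct (choice_fun _ He) as [e Hes].
    assert (Hei : forall z, mid p q z -> e (idx z) = z).
    { intros z Hz. apply idx_inj. apply (Hes (idx z)). eauto. }
    exists (cI Eta (fun n => t (e n))). split.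
    - apply (Dn_e c _ _ E idx).
      + intros x Hx. apply E_refl. apply Hx.
      + intros x y z Hxy. split; intros H; [eapply E_trans; [apply E_sym; exact Hxy|exact H]|eapply E_trans; eauto].
      + intros x y Hx Hy N L. now apply E_sep.
      + intros x Hx. rewrite (Hei x Hx). apply Hts. apply Hx.
    - pose (J T := exists p' q', gap p' q' /\ le p p' /\ le q' q /\ T = mid p' q').
      assert (HJ : forall Ti : (U -> Prop) * nat, exists LMN : (U -> Prop) * (U -> Prop) * (U -> Prop), J (fst Ti) ->
         let L := fst (fst LMN) in let M := snd (fst LMN) in let N := snd LMN in
         (J L /\ J N /\ incl L (fst Ti) /\ incl M (fst Ti) /\ incl N (fst Ti) /\
            blt c L M /\ blt c M N /\ blt c L N) /\ Up c (t (e (snd Ti))) M).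
      { intros [T i]. cbn [fst snd]. destruct (classic (J T)) as [HT|HT]; [|exists (T, T, T); tauto].
        destruct HT as [p' [q' [Hg [M1 [M2 ->]]]]].
        destruct (Hmin p' q' Hg) with (z := e i) as [z [Hz Hle]]; [eapply le_tr; eauto|eapply le_tr; eauto| |].
        { eapply mid_mono; [exact L1|exact L2|auto|auto|apply Hes]. }
        exists (mid p' z, E z, mid z q'). intros _. cbn [fst snd].
        destruct Hg as [Ap' [Aq' [Lg Ng]]]. destruct Hz as [Az [Z1 [Z2 [Z3 Z4]]]].
        split; [|eapply Up_cle; [apply Hts; auto|exact Hle]].
        split; [exists p', z; split; [split; auto|]; split; [auto|]; split; [right; eapply lt_le; eauto|auto]|].
        split; [exists z, q'; split; [split; auto|]; split; [right; eapply le_lt; eauto|]; split; auto|].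
        split; [intros w Hw; eapply mid_mono; [| | | |exact Hw]; auto; [left; auto|right; auto]|].
        split.
        { intros w Hw. split; [apply Hw|]. split; [apply (E_sep p' z); auto; now apply E_refl|].
          split; [apply (E_sep z q'); auto; now apply E_refl|]. split.
          - intros Q. apply Z3. eapply E_trans; [exact Q|]. now apply E_sym.
          - intros Q. apply Z4. eapply E_trans; eauto. }
        split; [intros w Hw; eapply mid_mono; [| | | |exact Hw]; auto; [right; auto|left; auto]|].
        split; [intros u v [Au [U1 [U2 [U3 U4]]]] Hv; apply (E_sep u z); auto; now apply E_refl|].
        split; [intros u v Hu [Av [V1 [V2 [V3 V4]]]]; apply (E_sep z v); auto; now apply E_refl|].
        intros u v [Au [U1 [U2 _]]] [Av [V1 _]]. eapply clt_trans; eauto. }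
      destruct (choice_fun _ HJ) as [g Hg]. cbv zeta in Hg.
      apply (Up_e c _ _ J (mid p q) (fun T i => fst (fst (g (T, i)))) (fun T i => snd (fst (g (T, i))))
               (fun T i => snd (g (T, i)))).
      + exists p, q. split; [split; auto|]. split; [left; auto|]. split; [left; auto|auto].
      + intros x; auto.
      + intros T i HT. apply (Hg (T, i) HT).
      + intros T i HT. apply (Hg (T, i) HT). }
  destruct Hab as [Aa [Ab [Lab Nab]]]. apply Nab. split; auto. split; auto. split.
  2:{ intros p q _ _ L1 L2 L3. exfalso. apply (lt_asym a b Lab). eapply le_lt; [exact L1|]. eapply lt_le; eauto. }
  intros p q Ap Aq L1 L2 L3.
  destruct (classic (E p q)) as [Epq|Npq]; [apply (E_iv p q); auto; left; auto|].
  apply coded_iv_mid; auto. intros _. apply Hmid; auto. split; auto.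
Qed.

Theorem chain_coded : (exists x, A x) -> coded A.
Proof.
  intros [x Ax]. replace A with (E x); [now apply coded_class|]. apply pred_ext. intros y. split; [intros H; apply H|].
  intros Ay. apply NNPP; intros H. destruct (clt_tot c x y) as [->|[L|L]].
  - apply H. now apply E_refl.
  - apply (no_gap x y). split; auto.
  - apply (no_gap y x). split; auto. split; auto. split; auto. intros Q. apply H. now apply E_sym.
Qed.

End Laver.

(** * Embeddings of induced subgraphs *)

Definition gemb {V W : Type} (a : V -> V -> bool) (S : V -> Prop) (b : W -> W -> bool) (T : W -> Prop) : Prop :=
  exists f : V -> W, (forall x, S x -> T (f x)) /\
    (forall x y, S x -> S y -> f x = f y -> x = y) /\
    (forall x y, S x -> S y -> b (f x) (f y) = a x y).

Lemma gemb_trans {V W X} (a : V -> V -> bool) S (b : W -> W -> bool) T (c : X -> X -> bool) R :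
  gemb a S b T -> gemb b T c R -> gemb a S c R.
Proof.
  intros [f [F1 [F2 F3]]] [g [G1 [G2 G3]]]. exists (fun x => g (f x)). split; [auto|]. split.
  - intros x y Hx Hy H. apply F2; auto.
  - intros x y Hx Hy. rewrite G3, F3; auto.
Qed.

Lemma gemb_incl {V} (a : V -> V -> bool) S T : incl S T -> gemb a S a T.
Proof. intros H. exists (fun x => x). auto. Qed.

Lemma gemb_refl {V} (a : V -> V -> bool) S : gemb a S a S.
Proof. apply gemb_incl. intros x; auto. Qed.

(** * Good sets: finite lexicographic sums of cliques and independent sets *)

Inductive good {V : Type} (a : V -> V -> bool) : (V -> Prop) -> Prop :=
| good_hom S o : (forall x y, S x -> S y -> x <> y -> a x y = o) -> good a S
| good_union S S1 S2 o : good a S1 -> good a S2 -> (forall x y, S1 x -> S2 y -> a x y = o) ->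
    (forall x, S x -> S1 x \/ S2 x) -> good a S.

Lemma good_emb {V W} (a : V -> V -> bool) S (b : W -> W -> bool) T : gemb a S b T -> good b T -> good a S.
Proof.
  intros [f [F1 [F2 F3]]] H. revert S F1 F2 F3.
  induction H as [T o H|T T1 T2 o _ IH1 _ IH2 Hc HT]; intros S F1 F2 F3.
  - apply (good_hom a S o). intros x y Hx Hy N. rewrite <- F3; auto.
  - apply (good_union a S (fun x => S x /\ T1 (f x)) (fun x => S x /\ T2 (f x)) o).
    + apply IH1; intros x; [tauto| |]; intros y [Hx _] [Hy _]; auto.
    + apply IH2; intros x; [tauto| |]; intros y [Hx _] [Hy _]; auto.
    + intros x y [Hx Hx'] [Hy Hy']. rewrite <- F3; auto.
    + intros x Hx. destruct (HT (f x) (F1 x Hx)); auto.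
Qed.

Lemma good_incl {V} (a : V -> V -> bool) S T : incl S T -> good a T -> good a S.
Proof. intros H. apply good_emb, gemb_incl, H. Qed.

(** As for chains, [gDn a t S] bounds [S] from above by [t], and [gUp a t S] realises [t] inside
    [S]. The atoms [Kinf] and [Iinf] bound finite homogeneous sets too, but are realised by infinite
    ones only. *)
Inductive gDn {V : Type} (a : V -> V -> bool) : gterm -> (V -> Prop) -> Prop :=
| gDn_dot S : (forall x y, S x -> S y -> x = y) -> gDn a (gA Dot) S
| gDn_hom S (o : bool) : (forall x y, S x -> S y -> x <> y -> a x y = o) -> gDn a (gA (if o then Kinf else Iinf)) S
| gDn_bin o s t S S1 S2 : gDn a s S1 -> gDn a t S2 -> (forall x y, S1 x -> S2 y -> a x y = o) ->
    (forall x, S x -> S1 x \/ S2 x) -> gDn a (gB o s t) S.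

Inductive gUp {V : Type} (a : V -> V -> bool) : gterm -> (V -> Prop) -> Prop :=
| gUp_dot S x : S x -> gUp a (gA Dot) S
| gUp_hom S (o : bool) (e : nat -> V) : (forall n, S (e n)) -> (forall n m, e n = e m -> n = m) ->
    (forall n m, n <> m -> a (e n) (e m) = o) -> gUp a (gA (if o then Kinf else Iinf)) S
| gUp_bin o s t S S1 S2 : gUp a s S1 -> gUp a t S2 -> (forall x y, S1 x -> S2 y -> a x y = o) ->
    (forall x, S1 x -> S2 x -> False) -> incl S1 S -> incl S2 S -> gUp a (gB o s t) S.

Lemma gUp_incl {V} (a : V -> V -> bool) t S T : gUp a t S -> incl S T -> gUp a t T.
Proof.
  intros H HI. destruct H as [S x Hx|S o e H1 H2 H3|o s t S S1 S2 H1 H2 H3 H4 I1 I2].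
  - apply (gUp_dot a T x); auto.
  - apply (gUp_hom a T o e); auto.
  - apply (gUp_bin a o s t T S1 S2); auto; intros x Hx; auto.
Qed.

Lemma gUp_gle {V} (a : V -> V -> bool) u S : gUp a u S -> forall t, gle t u -> gUp a t S.
Proof.
  induction 1 as [S x Hx|S o e H1 H2 H3|o s t S S1 S2 H1 IH1 H2 IH2 H3 H4 I1 I2]; intros v Hv.
  - inversion Hv; subst. now apply (gUp_dot a S x).
  - inversion Hv; subst. now apply (gUp_hom a S o e).
  - inversion Hv; subst.
    + apply (gUp_bin a o s0 t0 S S1 S2); auto.
    + apply (gUp_incl a v S1 S); auto.
    + apply (gUp_incl a v S2 S); auto.
Qed.

Section Countable.
Variables (V : Type) (idx : V -> nat).
Hypothesis idx_inj : forall x y, idx x = idx y -> x = y.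
Variable a : V -> V -> bool.
Hypothesis a_sym : forall x y, a x y = a y x.
Hypothesis a_irr : forall x, a x x = false.

Lemma gDn_gUp t S {W} (b : W -> W -> bool) T : (forall x y, b x y = b y x) -> (forall x, b x x = false) ->
  gDn a t S -> gUp b t T -> gemb a S b T.
Proof.
  intros b_sym b_irr H. revert T. induction H as [S H|S o H|o s t S S1 S2 _ IH1 _ IH2 Hc HS]; intros T HT.
  - inversion HT as [T' y Hy| |]; subst.
    + exists (fun _ => y). split; [auto|]. split; [intros; auto|].
      intros x z Hx Hz. rewrite (H x z Hx Hz), a_irr, b_irr. auto.
    + destruct o; discriminate.
  - inversion HT as [|T' o' e H1 H2 H3|]; subst; [destruct o; discriminate|].
    assert (o = o') by (destruct o, o'; congruence). subst o'.
    (* Countability enters here: the index selects the image in an infinite homogeneous set. *)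
    exists (fun x => e (idx x)). split; [auto|]. split; [intros; auto|].
    intros x y Hx Hy. destruct (classic (x = y)) as [->|N]; [now rewrite a_irr, b_irr|].
    rewrite H, H3; auto.
  - inversion HT as [| |o' s' t' T' T1 T2 H1 H2 H3 H4 I1 I2]; subst.
    destruct (IH1 T1 H1) as [f [F1 [F2 F3]]]. destruct (IH2 T2 H2) as [g [G1 [G2 G3]]].
    exists (fun x => if excluded_middle_informative (S1 x) then f x else g x).
    assert (HS2 : forall x, S x -> ~ S1 x -> S2 x) by (intros x Hx N; destruct (HS x Hx); tauto).
    split; [|split].
    + intros x Hx. destruct excluded_middle_informative; auto.
    + intros x y Hx Hy. destruct (excluded_middle_informative (S1 x)), (excluded_middle_informative (S1 y)); auto;
        intros E; exfalso.
      * apply (H4 (f x)); auto. rewrite E; auto.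
      * apply (H4 (f y)); auto. rewrite <- E; auto.
    + intros x y Hx Hy. destruct (excluded_middle_informative (S1 x)), (excluded_middle_informative (S1 y)); auto.
      * rewrite H3, Hc; auto.
      * rewrite b_sym, a_sym, H3, Hc; auto.
Qed.

Lemma bounded_or_sequence (S : V -> Prop) :
  (exists e : nat -> V, (forall n, S (e n)) /\ forall n m, n < m -> idx (e n) < idx (e m)) \/
  (exists n, forall x, S x -> idx x < n).
Proof.
  destruct (classic (exists n, forall x, S x -> idx x < n)) as [H|H]; [right; auto|left].
  assert (K : forall n, exists x, S x /\ n <= idx x).
  { intros n. apply NNPP; intros Q. apply H. exists n. intros x Hx.
    destruct (le_lt_dec n (idx x)); auto. exfalso; eauto. }
  destruct (K 0) as [x0 [H0 _]].
  destruct (dep_choice (fun _ x => S x) (fun _ x y => idx x < idx y) x0 H0) as [e [_ [E1 E2]]].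
  { intros _ x Hx. destruct (K (Datatypes.S (idx x))) as [y [Hy L]]. eauto. }
  exists e. split; auto. intros n m L. induction L as [|m L IH]; auto. specialize (E2 m). lia.
Qed.

Definition gcoded (S : V -> Prop) : Prop := exists t, gDn a t S /\ gUp a t S.

(** A finite homogeneous set realises no infinite atom; it is coded as a sum of [Dot]s, one for each
    vertex. *)
Lemma gcoded_finite o n : forall S : V -> Prop, (exists x, S x) -> (forall x, S x -> idx x < n) ->
  (forall x y, S x -> S y -> x <> y -> a x y = o) -> gcoded S.
Proof.
  induction n as [|n IH]; intros S [x0 Hx0] HS Ho; [specialize (HS x0 Hx0); lia|].
  destruct (classic (exists v, S v /\ idx v = n)) as [[v [Hv Ev]]|HN].
  - destruct (classic (exists x, S x /\ x <> v)) as [Hne|Hemp].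
    + destruct (IH (fun x => S x /\ x <> v) Hne) as [t [T1 T2]].
      * intros x [Hx N]. specialize (HS x Hx). assert (idx x <> idx v) by (intros Q; apply N, idx_inj, Q). lia.
      * intros x y [Hx _] [Hy _]. auto.
      * exists (gB o (gA Dot) t). split.
        -- apply (gDn_bin a o _ _ S (eq v) (fun x => S x /\ x <> v)); auto.
           ++ apply gDn_dot. intros x y <- <-; auto.
           ++ intros x y <- [Hy N]. apply Ho; auto.
           ++ intros x Hx. destruct (classic (v = x)); auto.
        -- apply (gUp_bin a o _ _ S (eq v) (fun x => S x /\ x <> v)); auto.
           ++ now apply (gUp_dot a _ v).
           ++ intros x y <- [Hy N]. apply Ho; auto.
           ++ intros x <- [_ N]. auto.
           ++ intros x <-; auto.
           ++ intros x [Hx _]; auto.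
    + exists (gA Dot). split; [|now apply (gUp_dot a S v)].
      apply gDn_dot. intros x y Hx Hy. transitivity v; [|symmetry]; apply NNPP; intros N; apply Hemp; eauto.
  - apply (IH S); eauto. intros x Hx. specialize (HS x Hx). assert (idx x <> n) by (intros Q; eauto). lia.
Qed.

Lemma good_gcoded T : good a T -> forall S, incl S T -> (exists x, S x) -> gcoded S.
Proof.
  induction 1 as [T o H|T T1 T2 o _ IH1 _ IH2 Hc HT]; intros S HS Hne.
  - destruct (bounded_or_sequence S) as [[e [E1 E2]]|[n Hn]].
    + exists (gA (if o then Kinf else Iinf)). split; [apply gDn_hom; auto|].
      assert (E3 : forall n m, e n = e m -> n = m).
      { intros n m E. destruct (lt_eq_lt_dec n m) as [[L|L]|L]; auto; specialize (E2 _ _ L); rewrite E in E2; lia. }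
      apply (gUp_hom a S o e); auto.
    + apply (gcoded_finite o n); auto.
  - set (S1 := fun x => S x /\ T1 x). set (S2 := fun x => S x /\ ~ T1 x).
    assert (I1 : incl S1 T1) by (intros x [_ Hx]; auto).
    assert (I2 : incl S2 T2) by (intros x [Hx N]; destruct (HT x (HS x Hx)); tauto).
    destruct (classic (exists x, S1 x)) as [N1|N1].
    + destruct (classic (exists x, S2 x)) as [N2|N2].
      * destruct (IH1 S1 I1 N1) as [t1 [D1 U1]]. destruct (IH2 S2 I2 N2) as [t2 [D2 U2]].
        exists (gB o t1 t2). split.
        -- apply (gDn_bin a o t1 t2 S S1 S2); auto. intros x Hx. unfold S1, S2. destruct (classic (T1 x)); auto.
        -- apply (gUp_bin a o t1 t2 S S1 S2); auto.
           ++ intros x [_ A1] [_ A2]; auto.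
           ++ intros x [A1 _]; auto.
           ++ intros x [A1 _]; auto.
      * apply IH1; auto. intros x Hx. apply NNPP; intros N. apply N2. exists x; split; auto.
    + apply IH2; auto. intros x Hx. apply I2. split; auto. intros N. apply N1. exists x; split; auto.
Qed.

End Countable.

(** * The chain of strong modules containing a vertex *)

(** In the decomposition tree, [z] branches off from [x] above the place where [y] does, at a node
    of the opposite label. If the two nodes have equal labels, a node of the opposite label lies
    between them; this is the role of [w] in [mlt]. *)
Definition prec {V : Type} (a : V -> V -> bool) (x y z : V) : Prop := a x y <> a x z /\ a y z = a x z.

(* [mlt a S x y z]: the least strong module of [S] containing [x] and [y] does not contain [z]. *)
Definition mlt {V : Type} (a : V -> V -> bool) (S : V -> Prop) (x y z : V) : Prop :=
  prec a x y z \/ exists w, S w /\ prec a x y w /\ prec a x w z.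

Definition p4free {V : Type} (a : V -> V -> bool) (S : V -> Prop) : Prop :=
  forall p q r s, S p -> S q -> S r -> S s ->
    ~ (a p q = true /\ a q r = true /\ a r s = true /\ a p r = false /\ a q s = false /\ a p s = false).

(** The strong modules of [S], the empty set and singletons included: together with two elements
    such a set contains their least strong module. *)
Definition closed {V : Type} (a : V -> V -> bool) (S D : V -> Prop) : Prop :=
  incl D S /\ forall x y z, D x -> D y -> x <> y -> S z -> ~ mlt a S x y z -> D z.

Definition mm {V : Type} (a : V -> V -> bool) (S : V -> Prop) (x y : V) : V -> Prop := fun z => S z /\ ~ mlt a S x y z.

(** For [x] different from [y], the largest strong module containing [y] but not [x]: a child of the
    node at which [x] and [y] part. *)
Definition child {V : Type} (a : V -> V -> bool) (S : V -> Prop) (x y : V) : V -> Prop := fun z => S z /\ (z = y \/ mlt a S y z x).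

Section Modules.
Variables (V : Type) (a : V -> V -> bool) (S : V -> Prop).
Hypothesis a_sym : forall x y, a x y = a y x.
Hypothesis P4 : p4free a S.

Local Notation prec := (prec a).
Local Notation lt := (mlt a S).

Lemma bool_neq (b c : bool) : b <> c -> b = negb c.
Proof. destruct b, c; cbn; congruence. Qed.

Lemma prec_total x y z : a x y <> a x z -> prec x y z \/ prec x z y.
Proof.
  intros N. destruct (bool_dec (a y z) (a x z)) as [E|E]; [left; split; auto|right].
  split; [auto|]. rewrite (a_sym z y). destruct (a y z), (a x z), (a x y); congruence.
Qed.

Lemma prec_asym x y z : prec x y z -> ~ prec x z y.
Proof. intros [N E] [_ E']. apply N. rewrite <- E, <- E', (a_sym y z). auto. Qed.

Lemma prec_x x y : ~ prec x y x.
Proof. intros [N E]. apply N. rewrite a_sym. exact E. Qed.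

(** The adjacency to [x] alternates around the cycle, and however [y1], [y2] and [z1], [z2] are
    joined, an induced path on four vertices appears. *)
Lemma no_cycle_true x y1 z1 y2 z2 : S x -> S y1 -> S z1 -> S y2 -> S z2 -> a x y1 = true ->
  prec x y1 z1 -> prec x z1 y2 -> prec x y2 z2 -> prec x z2 y1 -> False.
Proof.
  intros Sx S1 S2 S3 S4 E [N1 E1] [N2 E2] [N3 E3] [N4 E4].
  rewrite E in *. apply bool_neq in N1. apply bool_neq in N2. apply bool_neq in N3.
  assert (X1 : a x z1 = false) by (destruct (a x z1); cbn in *; congruence).
  assert (X2 : a x y2 = true) by (destruct (a x y2); rewrite X1 in *; cbn in *; congruence).
  assert (X3 : a x z2 = false) by (destruct (a x z2); rewrite X2 in *; cbn in *; congruence).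
  rewrite X1, X2, X3 in *.
  destruct (a y1 y2) eqn:F1; [destruct (a z1 z2) eqn:F2|].
  - apply (P4 x y2 z1 z2); auto. rewrite (a_sym y2 z1). auto 7.
  - apply (P4 z1 y2 y1 z2); auto. rewrite (a_sym y2 y1), (a_sym y1 z2), (a_sym z1 y1). auto 7.
  - apply (P4 z1 y2 x y1); auto. rewrite (a_sym y2 x), (a_sym z1 x), (a_sym y2 y1), (a_sym z1 y1). auto 7.
Qed.

Lemma no_cycle x y1 z1 y2 z2 : S x -> S y1 -> S z1 -> S y2 -> S z2 ->
  prec x y1 z1 -> prec x z1 y2 -> prec x y2 z2 -> prec x z2 y1 -> False.
Proof.
  intros Sx S1 S2 S3 S4 H1 H2 H3 H4. destruct (a x y1) eqn:E; [eapply (no_cycle_true x y1 z1 y2 z2); eauto|].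
  (* The same cycle started one step later, where the adjacency to [x] is [true]. *)
  eapply (no_cycle_true x z1 y2 z2 y1); eauto.
  destruct H1 as [N _]. destruct (a x z1); congruence.
Qed.

Lemma prec2_adj x y w z : S x -> S y -> S w -> S z -> prec x y w -> prec x w z -> a y z = a x z.
Proof.
  intros Sx Sy Sw Sz [N1 E1] [N2 E2]. apply NNPP; intros N.
  assert (Exy : a x y = a x z) by (destruct (a x y), (a x w), (a x z); congruence).
  destruct (a x z) eqn:Z.
  - assert (W : a x w = false) by (destruct (a x w); congruence).
    assert (Y : a y z = false) by (destruct (a y z); congruence).
    apply (P4 w z x y); auto. rewrite (a_sym z x), (a_sym w x), (a_sym z y), (a_sym w y), E1. auto 7.
  - assert (W : a x w = true) by (destruct (a x w); congruence).
    assert (Y : a y z = true) by (destruct (a y z); congruence).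
    apply (P4 x w y z); auto. rewrite (a_sym w y), E1. auto 7.
Qed.

Lemma mlt_adj x y z : S x -> S y -> S z -> lt x y z -> a y z = a x z.
Proof. intros Sx Sy Sz [[_ H]|[w [Sw [H1 H2]]]]; auto. eapply prec2_adj; eauto. Qed.

Lemma mlt_irr x y : ~ lt x y y.
Proof. intros [[N _]|[w [_ [H1 H2]]]]; [auto|]. eapply prec_asym; eauto. Qed.

Lemma mlt_x x y : ~ lt x y x.
Proof. intros [H|[w [_ [_ H]]]]; eapply prec_x; eauto. Qed.

Lemma prec3 x y w z t : S x -> S y -> S w -> S z -> S t -> prec x y w -> prec x w z -> prec x z t -> prec x y t.
Proof.
  intros Sx Sy Sw Sz St H1 H2 H3. destruct (prec_total x y t) as [H|H]; auto.
  - destruct H1 as [N1 _], H2 as [N2 _], H3 as [N3 _]. destruct (a x y), (a x w), (a x z), (a x t); congruence.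
  - exfalso. eapply (no_cycle x y w z t); eauto.
Qed.

Lemma mlt_trans x y z t : S x -> S y -> S z -> S t -> lt x y z -> lt x z t -> lt x y t.
Proof.
  intros Sx Sy Sz St [H1|[w [Sw [H1 H2]]]] [H3|[w' [Sw' [H3 H4]]]].
  - right. eauto.
  - left. eapply (prec3 x y z w' t); eauto.
  - left. eapply (prec3 x y w z t); eauto.
  - right. exists w'. split; auto. split; auto. eapply (prec3 x y w z w'); eauto.
Qed.

Lemma mlt_asym x y z : S x -> S y -> S z -> lt x y z -> ~ lt x z y.
Proof. intros Sx Sy Sz H1 H2. apply (mlt_irr x y). eapply (mlt_trans x y z y); eauto. Qed.

(** Together with [mlt_irr] and [mlt_trans] this makes [mlt a S x] a strict weak order, whose levels
    are those of the chain of strong modules around [x]. *)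
Lemma mlt_cotrans x y z t : S x -> S y -> S z -> S t -> lt x y t -> lt x y z \/ lt x z t.
Proof.
  intros Sx Sy Sz St [H|[w [Sw [H1 H2]]]].
  - destruct (bool_dec (a x z) (a x t)) as [E|E].
    + destruct (prec_total x y z) as [K|K]; [destruct H; congruence|left; left; auto|].
      right; right. exists y. auto.
    + destruct (prec_total x z t E) as [K|K]; [right; left; auto|]. left; right. exists t. auto.
  - destruct (bool_dec (a x z) (a x w)) as [E|E].
    + destruct (prec_total x z t) as [K|K]; [destruct H2; congruence|right; left; auto|].
      left; left. eapply (prec3 x y w t z); eauto.
    + destruct (prec_total x z w E) as [K|K]; [right|left]; right; exists w; auto.
Qed.

Lemma mlt_eq_adj x y z : ~ lt x y z -> ~ lt x z y -> a x y = a x z.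
Proof.
  intros N1 N2. apply NNPP; intros N. destruct (prec_total x y z N); [apply N1|apply N2]; left; auto.
Qed.

(** This is what makes the sets [mm] strong modules. The outer vertex [w] sees [u] and [v] alike; if
    [u] and [v] are joined to each other in the same way too, an intermediate witness is needed, and
    [x], [y] or the witness for [w] serves. *)
Lemma mlt_key x y u v w : S x -> S y -> S u -> S v -> S w -> u <> v ->
  ~ lt x y u -> ~ lt x y v -> lt x y w -> lt u v w.
Proof.
  intros Sx Sy Su Sv Sw Nuv Hu Hv Hw.
  assert (Un : forall s t, S s -> S t -> ~ lt x y s -> lt x y t -> a s t = a x t).
  { intros s t Ss St Hs Ht. destruct (mlt_cotrans x y s t) as [K|K]; auto; [contradiction|].
    apply mlt_adj; auto. }
  assert (Eu : a u w = a x w) by auto. assert (Ev : a v w = a x w) by auto.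
  destruct (bool_dec (a u v) (a x w)) as [E|E].
  2:{ left. split; congruence. }
  destruct Hw as [Hw|[w1 [Sw1 [H1 H2]]]].
  - assert (Hlow : forall s, S s -> ~ lt x y s -> a x s = a x w -> prec x s y).
    { intros s Ss Hs Es. destruct (prec_total x s y) as [K|K]; auto; [destruct Hw; congruence|].
      exfalso; apply Hs; left; auto. }
    assert (G : exists w', S w' /\ a u w' = negb (a x w) /\ a v w' = negb (a x w) /\ a w' w = a x w).
    { assert (Ey : a x y = negb (a x w)) by (apply bool_neq, Hw).
      assert (Gy : a u y = negb (a x w) -> a v y = negb (a x w) ->
         exists w', S w' /\ a u w' = negb (a x w) /\ a v w' = negb (a x w) /\ a w' w = a x w).
      { intros Q1 Q2. exists y. split; auto. split; auto. split; auto. apply Hw. }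
      destruct (bool_dec (a x u) (a x w)) as [Xu|Xu]; destruct (bool_dec (a x v) (a x w)) as [Xv|Xv].
      - destruct (Hlow u Su Hu Xu) as [_ Q1]. destruct (Hlow v Sv Hv Xv) as [_ Q2]. apply Gy; congruence.
      - pose proof (Hlow u Su Hu Xu) as K. apply Gy; [destruct K; congruence|].
        destruct (prec_total x u v) as [L|L]; [congruence|exfalso; destruct L; congruence|].
        rewrite <- Ey. eapply (prec2_adj x v u y); eauto.
      - pose proof (Hlow v Sv Hv Xv) as K. apply Gy; [|destruct K; congruence].
        destruct (prec_total x v u) as [L|L]; [congruence|exfalso; destruct L as [_ L]; rewrite a_sym in L; congruence|].
        rewrite <- Ey. eapply (prec2_adj x u v y); eauto.
      - exists x. split; auto. rewrite (a_sym u x), (a_sym v x). split; [now apply bool_neq|].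
        split; [now apply bool_neq|auto]. }
    destruct G as [w' [Sw' [Q1 [Q2 Q3]]]]. right. exists w'. split; auto. split; split.
    + rewrite E, Q1. destruct (a x w); discriminate.
    + congruence.
    + rewrite Q1, Eu. destruct (a x w); discriminate.
    + congruence.
  - assert (L1 : lt x y w1) by (left; auto).
    assert (E1 : a u w1 = a x w1) by auto. assert (E2 : a v w1 = a x w1) by auto.
    right. exists w1. split; auto. destruct H1 as [N1 _], H2 as [N2 M2]. split; split; congruence.
Qed.

Lemma mm_in_l x y : S x -> mm a S x y x.
Proof. intros H. split; auto. apply mlt_x. Qed.

Lemma mm_in_r x y : S y -> mm a S x y y.
Proof. intros H. split; auto. apply mlt_irr. Qed.

Lemma mm_closed x y : S x -> S y -> closed a S (mm a S x y).
Proof.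
  intros Sx Sy. split; [intros z [H _]; auto|]. intros u v z [Su Hu] [Sv Hv] N Sz Hz. split; auto.
  intros H. apply Hz. eapply (mlt_key x y u v z); eauto.
Qed.

Lemma closed_out D u v w : closed a S D -> D u -> D v -> u <> v -> S w -> ~ D w -> lt u v w.
Proof. intros [_ H] Du Dv N Sw Nw. apply NNPP; intros Q. apply Nw. eapply H; eauto. Qed.

Lemma closed_adj D u v w : closed a S D -> D u -> D v -> S w -> ~ D w -> a u w = a v w.
Proof.
  intros HD Du Dv Sw Nw. destruct (classic (u = v)) as [->|N]; auto. symmetry.
  apply mlt_adj; auto; try (apply HD; auto). eapply closed_out; eauto.
Qed.

Lemma mm_least D x y : closed a S D -> D x -> D y -> x <> y -> incl (mm a S x y) D.
Proof. intros [_ H] Dx Dy N z [Sz Hz]. exact (H x y z Dx Dy N Sz Hz). Qed.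

Lemma mm_sym x y : S x -> S y -> x <> y -> mm a S x y = mm a S y x.
Proof.
  intros Sx Sy N. apply pred_ext. intros z. split.
  - apply mm_least; auto using mm_closed, mm_in_l, mm_in_r.
  - apply mm_least; auto using mm_closed, mm_in_l, mm_in_r.
Qed.

Lemma closed_nested D1 D2 z : closed a S D1 -> closed a S D2 -> D1 z -> D2 z -> incl D1 D2 \/ incl D2 D1.
Proof.
  intros H1 H2 Z1 Z2. apply NNPP; intros N.
  assert (G : forall P Q : V -> Prop, ~ incl P Q -> exists u, P u /\ ~ Q u).
  { intros P Q H. apply NNPP; intros K. apply H. intros x Px. apply NNPP; intros Qx. eauto. }
  destruct (G D1 D2) as [u [U1 U2]]; [tauto|]. destruct (G D2 D1) as [v [V1 V2]]; [tauto|].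
  assert (Su : S u) by (apply H1; auto). assert (Sv : S v) by (apply H2; auto). assert (Sz : S z) by (apply H1; auto).
  apply (mlt_asym z u v); auto.
  - apply (closed_out D1); auto. intros ->; auto.
  - apply (closed_out D2); auto. intros ->; auto.
Qed.

Lemma child_self x y : S y -> child a S x y y.
Proof. intros H; split; auto. Qed.

Lemma child_not x y : x <> y -> ~ child a S x y x.
Proof. intros N [_ [H|H]]; [auto|]. eapply mlt_irr; eauto. Qed.

Lemma child_max D x y : closed a S D -> D y -> S x -> ~ D x -> incl D (child a S x y).
Proof.
  intros HD Dy Sx Nx z Dz. split; [apply HD; auto|]. destruct (classic (z = y)) as [->|N]; auto.
  right. apply (closed_out D); auto.
Qed.

Lemma child_closed x y : S x -> S y -> closed a S (child a S x y).
Proof.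
  intros Sx Sy. split; [intros z [H _]; auto|].
  assert (G : forall v z, S v -> S z -> v <> y -> lt y v x -> ~ lt y v z -> child a S x y z).
  { intros v z Sv Sz N H1 H2. split; auto. right.
    destruct (mlt_cotrans y v z x) as [K|K]; auto. contradiction. }
  intros u v z [Su Hu] [Sv Hv] N Sz Hz.
  destruct (classic (u = y)) as [->|Nu].
  - destruct Hv as [->|Hv]; [congruence|]. apply (G v); auto.
  - destruct Hu as [->|Hu]; [congruence|]. destruct (classic (v = y)) as [->|Nv].
    + apply (G u); auto. assert (K : mm a S y u z); [|apply K].
      rewrite <- mm_sym by auto. split; auto.
    + destruct Hv as [->|Hv]; [congruence|].
      destruct (classic (lt y u v)) as [L|L].
      * apply (G v); auto. assert (K : mm a S y v z); [|apply K].
        apply (proj2 (mm_closed y v Sy Sv) u v z); auto using mm_in_r. split; auto. now apply mlt_asym.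
      * apply (G u); auto. assert (K : mm a S y u z); [|apply K].
        apply (proj2 (mm_closed y u Sy Su) u v z); auto using mm_in_r. split; auto.
Qed.

Lemma child_eq x y z : S x -> S y -> x <> y -> child a S x y z -> child a S x z = child a S x y.
Proof.
  intros Sx Sy N Hz. assert (Sz : S z) by apply Hz.
  assert (Nz : x <> z) by (intros ->; eapply (child_not z y); eauto).
  assert (K : incl (child a S x y) (child a S x z)).
  { apply child_max; auto using child_closed, child_not. }
  apply pred_ext. intros w. split; [|apply K]. revert w.
  apply child_max; auto using child_closed, child_not. apply K. now apply child_self.
Qed.

Lemma child_sub_mm x y : S x -> S y -> x <> y -> incl (child a S x y) (mm a S x y).
Proof.
  intros Sx Sy N z [Sz Hz]. rewrite mm_sym by auto. split; auto. destruct Hz as [->|Hz]; [apply mlt_x|].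
  now apply mlt_asym.
Qed.

(** [u] can be replaced by [x] inside the module [mm a S x r], and then [v] by [r'] inside its
    child. *)
Lemma child_adj_below x r r' u v : S x -> S r -> S r' -> x <> r -> x <> r' -> lt x r r' ->
  child a S x r u -> child a S x r' v -> a u v = a x r'.
Proof.
  intros Sx Sr Sr' N N' L Hu Hv. assert (Sv : S v) by apply Hv.
  assert (Hm := child_sub_mm x r Sx Sr N u Hu).
  assert (Nv : ~ mm a S x r v).
  { intros Mv. assert (Nvx : v <> x) by (intros ->; eapply (child_not x r'); eauto).
    assert (L1 : lt v x r').
    { apply (mlt_key x r v x r'); auto; [apply Mv|apply mlt_x]. }
    assert (L2 : ~ lt v x r'); [|auto].
    destruct (classic (v = r')) as [->|Nr]; [exfalso; apply Mv; auto|].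
    apply mlt_asym; auto. apply (closed_out (child a S x r')); auto using child_closed, child_self, child_not. }
  rewrite (closed_adj (mm a S x r) u x v); auto using mm_closed, mm_in_l.
  rewrite (a_sym x v), (a_sym x r').
  apply (closed_adj (child a S x r')); auto using child_closed, child_self, child_not.
Qed.

(** Different children of one node are joined by the label of the node: any other adjacency between
    [r] and [r'] would put [r'] into the child of [r]. *)
Lemma child_adj_same x r r' u v : S x -> S r -> S r' -> x <> r -> x <> r' -> ~ lt x r r' -> ~ lt x r' r ->
  ~ child a S x r r' -> child a S x r u -> child a S x r' v -> a u v = a x r'.
Proof.
  intros Sx Sr Sr' N N' L1 L2 Nc Hu Hv.
  assert (Su : S u) by apply Hu. assert (Sv : S v) by apply Hv.
  assert (E : a x r = a x r') by (apply mlt_eq_adj; auto).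
  assert (Erv : ~ child a S x r' r).
  { intros K. apply Nc. rewrite (child_eq x r' r) by auto. now apply child_self. }
  assert (Nv : ~ child a S x r v).
  { intros K. apply Nc. rewrite <- (child_eq x r v) by auto. rewrite (child_eq x r' v) by auto. now apply child_self. }
  rewrite (closed_adj (child a S x r) u r v); auto using child_closed, child_self.
  rewrite (a_sym r v), (closed_adj (child a S x r') v r' r); auto using child_closed, child_self.
  apply NNPP; intros Q. apply Nc. split; auto. right. left. split.
  - rewrite (a_sym r r'), (a_sym r x). congruence.
  - rewrite (a_sym r' x), (a_sym r x). auto.
Qed.

End Modules.

(** * The labelled chain of a cograph seen from a vertex *)

Section Skeleton.
Variables (V : Type) (idx : V -> nat).
Hypothesis idx_inj : forall x y, idx x = idx y -> x = y.
Variable a : V -> V -> bool.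
Hypothesis a_sym : forall x y, a x y = a y x.
Hypothesis a_irr : forall x, a x x = false.
Local Notation all := (fun _ : V => True).
Hypothesis P4 : p4free a all.
Local Notation lt := (mlt a all).
Local Notation chd := (child a all).
Local Notation closed := (closed a all).
Local Notation good := (good a).

Lemma star_not_coded t K : gDn a t K -> ~ gle (gA Star) t.
Proof.
  induction 1 as [S H|S o H|o s t S S1 S2 _ IH1 _ IH2 _ _]; intros Q; inversion Q; subst; auto.
  - destruct o; discriminate.
Qed.

Lemma code_exists (K : V -> Prop) : exists t,
  (good K -> (exists x, K x) -> gDn a t K /\ gUp a t K) /\ (~ good K -> t = gA Star).
Proof.
  destruct (classic (good K)) as [H|H]; [|exists (gA Star); tauto].
  destruct (classic (exists x, K x)) as [Hx|Hx]; [|exists (gA Star); tauto].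
  destruct (good_gcoded V idx idx_inj a K H K) as [t Ht]; auto; [intros x; auto|].
  exists t. tauto.
Qed.

Definition code (K : V -> Prop) : gterm := proj1_sig (constructive_indefinite_description _ (code_exists K)).

Lemma code_spec K : (good K -> (exists x, K x) -> gDn a (code K) K /\ gUp a (code K) K) /\ (~ good K -> code K = gA Star).
Proof. exact (proj2_sig (constructive_indefinite_description _ (code_exists K))). Qed.

Lemma code_le K K' : (exists x, K x) -> (exists x, K' x) -> gle (code K) (code K') ->
  (good K /\ good K' /\ gemb a K a K') \/ (~ good K /\ ~ good K').
Proof.
  intros HK HK' H. destruct (code_spec K) as [C1 C2]. destruct (code_spec K') as [C1' C2'].
  destruct (classic (good K)) as [G|G]; destruct (classic (good K')) as [G'|G'].
  - left. split; auto. split; auto. destruct (C1 G HK) as [D _]. destruct (C1' G' HK') as [_ U].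
    eapply (gDn_gUp V idx idx_inj a a_sym a_irr (code K) K a K'); auto. eapply gUp_gle; eauto.
  - exfalso. rewrite (C2' G') in H. destruct (C1 G HK) as [D _].
    inversion H; subst. eapply star_not_coded; [exact D|]. rewrite <- H1. constructor.
  - exfalso. rewrite (C2 G) in H. destruct (C1' G' HK') as [D _]. eapply star_not_coded; eauto.
  - right; auto.
Qed.

(** A linear order refining the levels around [x], with [x] itself first. Ties between children of
    one node are broken by [idx]; this is harmless because such children are all joined by the label
    of their node. *)
Definition slt (x y z : V) : Prop :=
  (y = x /\ z <> x) \/ (y <> x /\ z <> x /\ (lt x y z \/ (~ lt x z y /\ idx y < idx z))).

Lemma slt_irr x y : ~ slt x y y.
Proof.
  intros [[H1 H2]|[_ [_ [H|[_ H]]]]]; [auto| |lia]. eapply mlt_irr; eauto.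
Qed.

Lemma slt_trans x y z t : slt x y z -> slt x z t -> slt x y t.
Proof.
  assert (Ct : forall p q r, lt x p r -> lt x p q \/ lt x q r) by (intros; apply mlt_cotrans; auto).
  intros [[-> Nz]|[Ny [Nz H]]] [[-> Nt]|[Nz' [Nt H']]]; try congruence; [left; auto|].
  right. split; auto. split; auto. destruct H as [H|[H Li]]; destruct H' as [H'|[H' Li']].
  - left. eapply (mlt_trans V a all a_sym P4 x y z t); auto.
  - left. destruct (Ct y t z H); tauto.
  - left. destruct (Ct z y t H'); tauto.
  - right. split; [|lia]. intros Q. destruct (Ct t z y Q); tauto.
Qed.

Lemma slt_tot x y z : y = z \/ slt x y z \/ slt x z y.
Proof.
  destruct (classic (y = z)) as [E|N]; auto. right.
  destruct (classic (y = x)) as [->|Ny]; [left; left; auto|].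
  destruct (classic (z = x)) as [->|Nz]; [right; left; auto|].
  destruct (classic (lt x y z)) as [L|L]; [left; right; auto|].
  destruct (classic (lt x z y)) as [L'|L']; [right; right; auto|].
  destruct (lt_eq_lt_dec (idx y) (idx z)) as [[Li|Li]|Li].
  - left; right; auto 6.
  - exfalso; apply N, idx_inj, Li.
  - right; right; auto 6.
Qed.

Definition view (x : V) : chain V :=
  Chain V (slt x) (fun y => (a x y, code (chd x y))) (slt_irr x) (slt_trans x) (slt_tot x).

(** One vertex is kept for each child; otherwise a child would occur in the chain once for each of
    its vertices. *)
Definition isrep (x r : V) : Prop := r <> x /\ forall z, chd x r z -> idx r <= idx z.

Definition skel (x : V) (D : V -> Prop) : V -> Prop := fun r => D r /\ isrep x r.

Lemma chd_self x y : chd x y y.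
Proof. now apply child_self. Qed.

Lemma chd_inh x y : exists z, chd x y z.
Proof. exists y. apply chd_self. Qed.

Lemma chd_closed x y : closed (chd x y).
Proof. now apply child_closed. Qed.

Lemma chd_not x y : y <> x -> ~ chd x y x.
Proof. intros N. apply child_not; auto. Qed.

Lemma chd_eq x y z : y <> x -> chd x y z -> chd x z = chd x y.
Proof. intros N H. apply child_eq; auto. Qed.

Lemma chd_neq x y z : y <> x -> chd x y z -> z <> x.
Proof. intros N H ->. eapply chd_not; eauto. Qed.

Lemma chd_sub D x y : closed D -> D x -> D y -> y <> x -> incl (chd x y) D.
Proof.
  intros HD Dx Dy N z Hz. apply (mm_least V a all D x y); auto. apply child_sub_mm; auto.
Qed.

Lemma rep_exists x y : y <> x -> exists r, isrep x r /\ chd x r y.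
Proof.
  intros N. destruct (least_element idx (chd x y) (chd_inh x y)) as [r [Hr Hl]].
  assert (Nr := chd_neq x y r N Hr). assert (E := chd_eq x y r N Hr). exists r. split.
  - split; auto. rewrite E. exact Hl.
  - rewrite E. apply chd_self.
Qed.

Lemma rep_unique x r r' u : isrep x r -> isrep x r' -> chd x r u -> chd x r' u -> r = r'.
Proof.
  intros [N H] [N' H'] Hu Hu'.
  assert (E : chd x r = chd x r') by (rewrite <- (chd_eq x r u), <- (chd_eq x r' u) by auto; auto).
  apply idx_inj, Nat.le_antisymm; [apply H; rewrite E|apply H'; rewrite <- E]; apply chd_self.
Qed.

(** Adjacency between two children depends only on the label of the later one. Hence an embedding of
    labelled chains preserves all edges between different children. *)
Lemma skel_adj x r r' u v : isrep x r -> isrep x r' -> slt x r r' -> chd x r u -> chd x r' v -> a u v = a x r'.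
Proof.
  intros Hr Hr' L Hu Hv. assert (N := proj1 Hr). assert (N' := proj1 Hr').
  assert (Nc : ~ chd x r r').
  { intros K. assert (r = r') by (eapply (rep_unique x r r' r'); eauto using chd_self). subst. eapply slt_irr; eauto. }
  destruct L as [[-> _]|[_ [_ [L|[L Li]]]]]; [congruence| |].
  - apply (child_adj_below V a all) with (r := r); auto.
  - destruct (classic (lt x r r')) as [L'|L'].
    + apply (child_adj_below V a all) with (r := r); auto.
    + apply (child_adj_same V a all) with (r := r); auto.
Qed.

Lemma chd_adj_x x r u : r <> x -> chd x r u -> a x u = a x r.
Proof.
  intros N Hu. rewrite (a_sym x u), (a_sym x r).
  apply (closed_adj V a all) with (D := chd x r); auto using chd_closed, chd_self, chd_not.
Qed.

Lemma skel_inh x D : closed D -> D x -> (exists y, D y /\ y <> x) -> exists r, skel x D r.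
Proof.
  intros HD Dx [y [Dy N]]. destruct (rep_exists x y N) as [r [Hr Hc]]. exists r. split; auto.
  apply (chd_sub D x y); auto. rewrite (chd_eq x r y); auto using chd_self. apply Hr.
Qed.

Lemma skel_of D x u : closed D -> D x -> D u -> u <> x -> exists r, skel x D r /\ chd x r u.
Proof.
  intros HD Dx Du N. destruct (rep_exists x u N) as [r [Hr Hc]]. exists r. split; auto. split; auto.
  apply (chd_sub D x u); auto. rewrite (chd_eq x r u); auto using chd_self. apply Hr.
Qed.

Definition bad (D : V -> Prop) : Prop := closed D /\ ~ good D.

Definition sle (x : V) (D : V -> Prop) (x' : V) (D' : V -> Prop) : Prop :=
  cemb 1 (view x) (skel x D) (view x') (skel x' D').

Lemma cemb1_trans {U1 U2 U3} (c1 : chain U1) S1 (c2 : chain U2) S2 (c3 : chain U3) S3 :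
  cemb 1 c1 S1 c2 S2 -> cemb 1 c2 S2 c3 S3 -> cemb 1 c1 S1 c3 S3.
Proof.
  intros [f F] [g G]. exists (fun x i => g (f x i) i). intros x Hx i Li.
  destruct (F x Hx i Li) as [A1 [A2 [A3 A4]]]. destruct (G _ A1 i Li) as [B1 [B2 [B3 B4]]].
  split; [auto|]. split; [eapply lle_trans; eauto|]. split; [intros; lia|].
  intros y Hy L j Lj. destruct (F y Hy j Lj) as [C1 _]. apply B4; auto.
Qed.

Lemma bad_other D x : bad D -> D x -> exists y, D y /\ y <> x.
Proof.
  intros [_ G] Dx. apply NNPP; intros H. apply G. apply (good_hom a D true). intros y z Dy Dz N.
  exfalso. apply N. transitivity x; [|symmetry]; apply NNPP; intros Q; apply H; eauto.
Qed.

Lemma bad_skel D x : bad D -> D x -> exists r, skel x D r.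
Proof. intros HD Dx. apply skel_inh; auto; [apply HD|]. now apply bad_other. Qed.

(** * Embedding strong modules that are mutually dense *)

(** A task is a pair of bad modules. For a vertex [x] the hypothesis supplies [x'] and an embedding
    of the chains around them, which settles the edges between different children. Good children are
    mapped by their codes; bad children fall on bad children and become new tasks. *)
Lemma dense_embeds D1 D2 : bad D1 -> bad D2 ->
  (forall D D', bad D -> bad D' -> incl D D1 -> incl D' D2 ->
     forall x, D x -> exists x', D' x' /\ sle x D x' D') -> gemb a D1 a D2.
Proof.
  intros B1 B2 H.
  pose (rho u v w w' := a w w' = a u v /\ (w = w' -> u = v)).
  pose (R K K' := bad K /\ bad K' /\ incl K D1 /\ incl K' D2).
  destruct (refinement V V V idx idx_inj rho R D1 D2) as [f [F1 F2]].
  - intros K K' [BK [BK' [I1 I2]]] x Kx.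
    destruct (H K K' BK BK' I1 I2 x Kx) as [x' [Kx' [f0 F0]]].
    set (f := fun r => f0 r 0).
    assert (Fs : forall r, skel x K r -> skel x' K' (f r)) by (intros r Hr; apply (F0 r Hr 0); lia).
    assert (Fl : forall r, skel x K r -> a x' (f r) = a x r).
    { intros r Hr. destruct (F0 r Hr 0) as [_ [[E _] _]]; [lia|]. symmetry. exact E. }
    assert (Fc : forall r, skel x K r -> gle (code (chd x r)) (code (chd x' (f r)))).
    { intros r Hr. destruct (F0 r Hr 0) as [_ [[_ E] _]]; [lia|]. exact E. }
    assert (Fo : forall r r', skel x K r -> skel x K r' -> slt x r r' -> slt x' (f r) (f r')).
    { intros r r' Hr Hr' L. destruct (F0 r Hr 0) as [_ [_ [_ Q]]]; [lia|]. apply Q; auto. }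
    assert (HKc : closed K) by apply BK. assert (HKc' : closed K') by apply BK'.
    assert (Hrep : forall u, exists r, K u -> u <> x -> skel x K r /\ chd x r u).
    { intros u. destruct (classic (K u /\ u <> x)) as [[Ku N]|Q]; [|exists x; tauto].
      destruct (skel_of K x u HKc Kx Ku N) as [r Hr]. eauto. }
    destruct (choice_fun _ Hrep) as [rp Hrp].
    assert (Hg : forall r, exists g : V -> V, skel x K r -> good (chd x r) ->
       (forall u, chd x r u -> chd x' (f r) (g u)) /\
       (forall u v, chd x r u -> chd x r v -> g u = g v -> u = v) /\
       (forall u v, chd x r u -> chd x r v -> a (g u) (g v) = a u v)).
    { intros r. destruct (classic (skel x K r /\ good (chd x r))) as [[Hr G]|Q]; [|exists (fun z => z); tauto].
      destruct (code_le _ _ (chd_inh x r) (chd_inh x' (f r)) (Fc r Hr)) as [[_ [_ [g Hg]]]|[Q _]]; [|contradiction].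
      exists g; auto. }
    destruct (choice_fun _ Hg) as [g Hgs].
    pose (eqx u := if excluded_middle_informative (u = x) then true else false).
    pose (st := Step V V V (fun u => if eqx u then x' else g (rp u) u)
                  (fun u => u = x \/ good (chd x (rp u))) rp (fun r => chd x' (f r))).
    assert (Vx : s_val V V V st x = x').
    { cbn. unfold eqx. destruct excluded_middle_informative; congruence. }
    assert (Vn : forall u, u <> x -> s_val V V V st u = g (rp u) u).
    { intros u N. cbn. unfold eqx. destruct excluded_middle_informative; congruence. }
    assert (Vg : forall u, K u -> u <> x -> good (chd x (rp u)) -> chd x' (f (rp u)) (s_val V V V st u)).
    { intros u Ku N G. rewrite Vn by auto. destruct (Hrp u Ku N) as [H1 H2]. apply (Hgs (rp u)); auto. }
    assert (Sub' : forall r w, skel x K r -> chd x' (f r) w -> K' w).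
    { intros r w Hr Hw. destruct (Fs r Hr) as [Q1 [Q2 _]]. eapply (chd_sub K' x' (f r)); eauto. }
    assert (Cross : forall u v w w', K u -> K v -> u <> x -> v <> x -> rp u <> rp v ->
       chd x' (f (rp u)) w -> chd x' (f (rp v)) w' -> rho u v w w').
    { intros u v w w' Ku Kv Nu Nv Nr Hw Hw'.
      destruct (Hrp u Ku Nu) as [Su Cu]. destruct (Hrp v Kv Nv) as [Sv Cv].
      assert (G : forall r r' p q p' q', skel x K r -> skel x K r' -> slt x r r' -> chd x r p -> chd x r' q ->
        chd x' (f r) p' -> chd x' (f r') q' -> a p' q' = a p q /\ p' <> q').
      { intros r r' p q p' q' Hr Hr' L Hp Hq Hp' Hq'. destruct (Fs r Hr) as [_ Q1]. destruct (Fs r' Hr') as [_ Q2].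
        split.
        - rewrite (skel_adj x r r' p q); auto; [|apply Hr|apply Hr'].
          rewrite (skel_adj x' (f r) (f r') p' q'); auto.
        - intros ->. assert (E : f r = f r') by (eapply (rep_unique x' (f r) (f r')); eauto).
          apply (slt_irr x' (f r')). rewrite <- E at 1. auto. }
      destruct (slt_tot x (rp u) (rp v)) as [E|[L|L]]; [congruence| |].
      - destruct (G _ _ u v w w' Su Sv L Cu Cv Hw Hw') as [G1 G2]. split; auto. intros; contradiction.
      - destruct (G _ _ v u w' w Sv Su L Cv Cu Hw' Hw) as [G1 G2]. split.
        + rewrite (a_sym w w'), (a_sym u v). auto.
        + intros ->; congruence. }
    assert (CrossX : forall v w, K v -> v <> x -> chd x' (f (rp v)) w -> rho x v x' w /\ rho v x w x').
    { intros v w Kv Nv Hw. destruct (Hrp v Kv Nv) as [Sv Cv]. destruct (Fs _ Sv) as [Q1 [Q2 Q3]].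
      assert (E : a x' w = a x v).
      { rewrite (chd_adj_x x' (f (rp v)) w), (chd_adj_x x (rp v) v); auto. apply Sv. }
      assert (N : w <> x') by (eapply chd_neq; eauto).
      split; split; congruence. }
    exists st. split.
    + left; auto.
    + intros v Kv [->|G]; [now rewrite Vx|]. destruct (classic (v = x)) as [->|N]; [now rewrite Vx|].
      destruct (Hrp v Kv N) as [Sv Cv]. eapply Sub'; eauto.
    + intros v Kv Nd w Hw. cbn in *. assert (N : v <> x) by tauto. destruct (Hrp v Kv N) as [Sv _]. eauto.
    + intros v Kv Nd. cbn in Nd. assert (N : v <> x) by tauto. destruct (Hrp v Kv N) as [Sv Cv].
      assert (Rx : rp v <> x) by apply Sv.
      assert (E : pend V V V K st v = chd x (rp v)).
      { apply pred_ext. intros u. unfold pend. cbn. split.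
        - intros [Ku [Nu E]]. rewrite <- E. apply Hrp; auto.
        - intros Hu. assert (Ku : K u) by (eapply (chd_sub K x (rp v)); eauto; apply Sv).
          assert (Nux : u <> x) by (eapply chd_neq; eauto). destruct (Hrp u Ku Nux) as [Su Cu].
          assert (Er : rp u = rp v) by (eapply (rep_unique x (rp u) (rp v) u); eauto; [apply Su|apply Sv]).
          rewrite Er. tauto. }
      rewrite E. cbn. destruct (Fs _ Sv) as [Q1 [Q2 Q3]].
      destruct (code_le _ _ (chd_inh x (rp v)) (chd_inh x' (f (rp v))) (Fc _ Sv)) as [[G _]|[G1 G2]]; [tauto|].
      split; [split; auto using chd_closed|]. split; [split; auto using chd_closed|]. split.
      * intros u Hu. apply I1. eapply (chd_sub K x (rp v)); eauto. apply Sv.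
      * intros u Hu. apply I2. eauto.
    + intros u v Ku Kv Du Dv. cbn [s_done st] in Du, Dv.
      destruct (classic (u = x)) as [->|Nu]; destruct (classic (v = x)) as [->|Nv].
      * split; auto. rewrite Vx, !a_irr. auto.
      * rewrite Vx. apply CrossX; auto. apply Vg; tauto.
      * rewrite Vx. apply CrossX; auto. apply Vg; tauto.
      * assert (Gu : good (chd x (rp u))) by tauto. assert (Gv : good (chd x (rp v))) by tauto.
        destruct (classic (rp u = rp v)) as [E|E]; [|apply Cross; auto].
        destruct (Hrp u Ku Nu) as [Su Cu]. destruct (Hrp v Kv Nv) as [Sv Cv].
        rewrite !Vn by auto. destruct (Hgs (rp v) Sv Gv) as [G1 [G2 G3]]. rewrite <- E in Cv.
        rewrite E in Cu, Cv |- *. split; [apply G3; auto|]. intros Q. apply G2; auto.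
    + intros u v w Ku Kv Du Dv Hw. cbn [s_done s_tgt s_cls st] in Du, Dv, Hw.
      assert (Nv : v <> x) by tauto. destruct (classic (u = x)) as [->|Nu]; [rewrite Vx; now apply CrossX|].
      assert (Gu : good (chd x (rp u))) by tauto.
      assert (E : rp u <> rp v) by (intros E; rewrite E in Gu; tauto).
      split; apply Cross; auto.
    + intros u v w w' Ku Kv Du Dv E Hw Hw'. cbn [s_done s_tgt s_cls st] in *. apply Cross; tauto.
  - split; auto. split; auto. split; intros z; auto.
  - apply NNPP; intros Q. apply B1. apply (good_hom a D1 true). intros y z Dy. exfalso; eauto.
  - exists f. split; auto. split; intros x y Hx Hy; apply F2; auto.
Qed.

(** * A minimal bad strong module *)

Lemma sle_array (x : nat -> nat -> V) (D : nat -> nat -> V -> Prop) :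
  (forall i j, bad (D i j)) -> (forall i j, D i j (x i j)) ->
  exists i j k, i < j /\ j < k /\ sle (x i j) (D i j) (x j k) (D j k).
Proof.
  intros HD Hx.
  assert (Ht : forall p : nat * nat, exists t, Dn (view (x (fst p) (snd p))) t (skel (x (fst p) (snd p)) (D (fst p) (snd p))) /\
      Up (view (x (fst p) (snd p))) t (skel (x (fst p) (snd p)) (D (fst p) (snd p)))).
  { intros [i j]. cbn. apply chain_coded with (idx := idx); auto. apply bad_skel; auto. }
  destruct (choice_fun _ Ht) as [t Hts].
  destruct (bqo_2 cle (fun i j => t (i, j)) cle_bqo) as [i [j [k [L1 [L2 Hle]]]]].
  exists i, j, k. split; auto. split; auto. destruct (Hts (i, j)) as [D1 _]. destruct (Hts (j, k)) as [_ U1].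
  destruct (chain_absorb idx idx_inj _ _ _ 1 (le_n 1) D1) as [N [LN [EN HN]]]. cbn [fst snd] in *.
  specialize (EN eq_refl). subst N. apply (HN V _ _ (fun _ => skel (x j k) (D j k))).
  - intros n _. split; [intros z; auto|]. eapply Up_cle; eauto.
  - intros; lia.
Qed.

(** Passing to a smaller bad module loses nothing, up to embeddings of chains. A descending sequence
    of failures would contradict the better-quasi-order, so every bad module contains a stable
    one. *)
Definition stable (D : V -> Prop) : Prop := bad D /\
  forall D', bad D' -> incl D' D -> forall x, D x -> exists x', D' x' /\ sle x D x' D'.

Lemma skel_mono x D D' : incl D D' -> incl (skel x D) (skel x D').
Proof. intros H r [H1 H2]. split; auto. Qed.

Lemma sle_incl x D D1 x' D' D1' : incl D1 D -> incl D' D1' -> sle x D x' D' -> sle x D1 x' D1'.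
Proof. intros H1 H2. apply cemb_incl; apply skel_mono; auto. Qed.

Lemma stable_exists D : bad D -> exists C, stable C /\ incl C D.
Proof.
  intros HD. apply NNPP; intros HN.
  destruct (dep_choice (fun _ C => bad C /\ incl C D)
    (fun _ C C' => incl C' C /\ exists x, C x /\ forall x', C' x' -> ~ sle x C x' C') D) as [s [_ [S1 S2]]].
  - split; auto. intros z; auto.
  - intros _ C [HC HCD]. apply NNPP; intros Q. apply HN. exists C. split; auto. split; auto.
    intros D' HD' HI x Hx. apply NNPP; intros Q'. apply Q. exists D'.
    split; [split; auto; intros z Hz; auto|]. split; auto. exists x. split; auto.
    intros x' Hx' Hs. apply Q'. eauto.
  - assert (S3 : forall n, exists x, s n x /\ forall x', s (S n) x' -> ~ sle x (s n) x' (s (S n))) by (intros n; apply S2).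
    destruct (choice_fun _ S3) as [x Hx].
    assert (Mono : forall n m, n <= m -> incl (s m) (s n)).
    { intros n m L. induction L as [|m L IH]; intros z Hz; auto. apply IH. apply S2. auto. }
    destruct (sle_array (fun i _ => x i) (fun i _ => s i)) as [i [j [k [L1 [L2 Hs]]]]].
    + intros; apply S1.
    + intros; apply Hx.
    + apply (proj2 (Hx i) (x j)); [apply (Mono (S i) j L1), Hx|].
      eapply sle_incl; [| |exact Hs]; [intros z; auto|apply Mono; auto].
Qed.

(** Otherwise there is a strictly descending sequence of stable modules [s]. By [dense_embeds], the
    failure of [s i] to embed into [s j] has a witness [x] in a bad part of [s i] whose chain embeds
    into no chain of some bad part of [s j]. The array over pairs carries the witness of [(i, j)] to
    that of [(j, k)], which lies in [s j], and stability of [s j] moves it into the forbidden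
    part. *)
Theorem minimal_bad_module D : bad D ->
  exists C, bad C /\ forall C', bad C' -> gemb a C' a C -> gemb a C a C'.
Proof.
  intros HD. destruct (stable_exists D HD) as [C0 [HC0 _]]. apply NNPP; intros HN.
  destruct (dep_choice (fun _ C => stable C) (fun _ C C' => gemb a C' a C /\ ~ gemb a C a C') C0 HC0)
    as [s [_ [S1 S2]]].
  { intros _ C HC. apply NNPP; intros Q. apply HN. exists C. split; [apply HC|].
    intros C' HC' He. apply NNPP; intros He'. apply Q. destruct (stable_exists C' HC') as [C2 [HC2 I2]].
    exists C2. split; auto. split.
    - eapply gemb_trans; [apply gemb_incl; exact I2|exact He].
    - intros K. apply He'. eapply gemb_trans; [exact K|apply gemb_incl; exact I2]. }
  assert (Le : forall i j, i <= j -> gemb a (s j) a (s i)).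
  { intros i j L. induction L as [|j L IH]; [apply gemb_refl|]. eapply gemb_trans; [apply S2|exact IH]. }
  destruct (choice_fun (fun p q => fst p < snd p ->
      bad (fst (fst q)) /\ bad (snd (fst q)) /\ incl (fst (fst q)) (s (fst p)) /\ incl (snd (fst q)) (s (snd p)) /\
      fst (fst q) (snd q) /\ forall x', snd (fst q) x' -> ~ sle (snd q) (fst (fst q)) x' (snd (fst q))))
    as [g Hg].
  { intros [i j]. cbn [fst snd]. destruct (S1 0) as [B0 _].
    destruct (classic (exists x, s 0 x)) as [[x0 Hx0]|Q].
    2:{ exfalso. apply (proj2 B0). apply (good_hom a (s 0) true). intros y z Dy. exfalso; eauto. }
    destruct (le_lt_dec j i) as [L|L]; [exists ((s 0, s 0), x0); lia|].
    apply NNPP; intros H. apply (proj2 (S2 i)). eapply gemb_trans; [|apply (Le (S i) j L)].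
    apply dense_embeds; [apply S1|apply S1|]. intros D1 D2 B1 B2 I1 I2 x Hx. apply NNPP; intros H'.
    apply H. exists ((D1, D2), x). cbn. intros _. repeat split; auto; try apply B1; try apply B2.
    intros x' Hx' Hs. apply H'. eauto. }
  destruct (S1 0) as [B0 _].
  destruct (classic (exists x, s 0 x)) as [[x0 Hx0]|Q].
  2:{ exfalso. apply (proj2 B0). apply (good_hom a (s 0) true). intros y z Dy. exfalso; eauto. }
  (* Pairs with [j <= i] get a dummy entry; the comparison obtained concerns increasing pairs. *)
  destruct (sle_array (fun i j => if i <? j then snd (g (i, j)) else x0)
              (fun i j => if i <? j then fst (fst (g (i, j))) else s 0)) as [i [j [k [L1 [L2 Hs]]]]].
  - intros i j. destruct (Nat.ltb_spec i j); [apply (Hg (i, j)); auto|auto].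
  - intros i j. destruct (Nat.ltb_spec i j); [apply (Hg (i, j)); auto|auto].
  - destruct (Nat.ltb_spec i j); [|lia]. destruct (Nat.ltb_spec j k); [|lia].
    destruct (Hg (i, j) L1) as [B1 [B2 [I1 [I2 [Hx Hn]]]]]. destruct (Hg (j, k) L2) as [_ [_ [I3 [_ [Hx' _]]]]].
    cbn [fst snd] in *.
    destruct (S1 j) as [_ St]. destruct (St _ B2 I2 _ (I3 _ Hx')) as [x' [Px' Hs']].
    apply (Hn x' Px'). eapply cemb1_trans; [|exact Hs'].
    eapply sle_incl; [| |exact Hs]; [intros z; auto|exact I3].
Qed.

End Skeleton.

(** * Good graphs have one sibling *)

Inductive sb_core {V W : Type} (f : V -> W) (g : W -> V) : W -> Prop :=
| sb_base p : (forall v, f v <> p) -> sb_core f g p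
| sb_step p : sb_core f g p -> sb_core f g (f (g p)).

(** The last clause is what the twin argument uses: at each point [h] agrees with [g] or inverts
    [f]. *)
Lemma schroeder_bernstein {V W : Type} (f : V -> W) (g : W -> V) :
  (forall x y, f x = f y -> x = y) -> (forall x y, g x = g y -> x = y) ->
  exists (h : W -> V) (k : V -> W), (forall p, k (h p) = p) /\ (forall v, h (k v) = v) /\
    forall p, h p = g p \/ f (h p) = p.
Proof.
  intros Hf Hg.
  assert (Hh : forall p, exists v, (sb_core f g p -> v = g p) /\ (~ sb_core f g p -> f v = p)).
  { intros p. destruct (classic (sb_core f g p)) as [C|C]; [exists (g p); tauto|].
    destruct (classic (exists v, f v = p)) as [[v Hv]|H]; [exists v; tauto|].
    exfalso. apply C. apply sb_base. intros v Hv. eauto. }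
  destruct (choice_fun _ Hh) as [h H].
  assert (Inj : forall p q, h p = h q -> p = q).
  { assert (K : forall p q, sb_core f g p -> ~ sb_core f g q -> h p <> h q).
    { intros p q Cp Cq E. apply Cq. rewrite <- (proj2 (H q) Cq), <- E, (proj1 (H p) Cp). now apply sb_step. }
    intros p q E. destruct (classic (sb_core f g p)) as [Cp|Cp]; destruct (classic (sb_core f g q)) as [Cq|Cq].
    - apply Hg. now rewrite <- (proj1 (H p) Cp), <- (proj1 (H q) Cq).
    - exfalso. eapply K; eauto.
    - exfalso. eapply (K q p); eauto.
    - now rewrite <- (proj2 (H p) Cp), <- (proj2 (H q) Cq), E. }
  assert (Sur : forall v, exists p, h p = v).
  { intros v. destruct (classic (sb_core f g (f v))) as [C|C].
    - inversion C as [p Hp|p Cp E]; subst; [exfalso; eapply Hp; eauto|].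
      apply Hf in E. exists p. rewrite <- E. now apply H.
    - exists (f v). apply Hf. now apply H. }
  destruct (choice_fun _ Sur) as [k Hk]. exists h, k. split; [intros p; apply Inj; apply Hk|]. split; [exact Hk|].
  intros p. destruct (classic (sb_core f g p)) as [C|C]; [left|right]; now apply H.
Qed.

Lemma good_coloring {V} (a : V -> V -> bool) S : (forall x y, a x y = a y x) -> good a S ->
  exists (k : nat) (c : V -> nat) (M : nat -> nat -> bool), (forall x, S x -> c x < k) /\
    forall x y, S x -> S y -> x <> y -> a x y = M (c x) (c y).
Proof.
  intros a_sym. induction 1 as [S o H|S S1 S2 o _ [k1 [c1 [M1 [A1 B1]]]] _ [k2 [c2 [M2 [A2 B2]]]] Hc HS].
  - exists 1, (fun _ => 0), (fun _ _ => o). split; auto.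
  - exists (k1 + k2), (fun x => if excluded_middle_informative (S1 x) then c1 x else k1 + c2 x),
      (fun i j => if i <? k1 then (if j <? k1 then M1 i j else o) else (if j <? k1 then o else M2 (i - k1) (j - k1))).
    assert (HS2 : forall x, S x -> ~ S1 x -> S2 x) by (intros x Hx N; destruct (HS x Hx); tauto).
    split.
    + intros x Hx. destruct excluded_middle_informative as [Q|Q]; [specialize (A1 x Q); lia|].
      specialize (A2 x (HS2 x Hx Q)). lia.
    + intros x y Hx Hy N.
      destruct (excluded_middle_informative (S1 x)) as [Qx|Qx]; destruct (excluded_middle_informative (S1 y)) as [Qy|Qy].
      * pose proof (A1 x Qx). pose proof (A1 y Qy).
        destruct (Nat.ltb_spec (c1 x) k1); [|lia]. destruct (Nat.ltb_spec (c1 y) k1); [|lia]. auto.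
      * pose proof (A1 x Qx). destruct (Nat.ltb_spec (c1 x) k1); [|lia].
        destruct (Nat.ltb_spec (k1 + c2 y) k1); [lia|]. auto.
      * pose proof (A1 y Qy). destruct (Nat.ltb_spec (c1 y) k1); [|lia].
        destruct (Nat.ltb_spec (k1 + c2 x) k1); [lia|]. rewrite a_sym. auto.
      * destruct (Nat.ltb_spec (k1 + c2 x) k1); [lia|]. destruct (Nat.ltb_spec (k1 + c2 y) k1); [lia|].
        replace (k1 + c2 x - k1) with (c2 x) by lia. replace (k1 + c2 y - k1) with (c2 y) by lia. auto.
Qed.

Definition twin {V} (a : V -> V -> bool) (x y : V) : Prop := forall w, w <> x -> w <> y -> a x w = a y w.

Section Twins.
Variables (V : Type) (a : V -> V -> bool).
Hypothesis a_sym : forall x y, a x y = a y x.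
Hypothesis a_irr : forall x, a x x = false.

Lemma twin_refl x : twin a x x.
Proof. intros w _ _; auto. Qed.

Lemma twin_sym x y : twin a x y -> twin a y x.
Proof. intros H w N1 N2. symmetry. auto. Qed.

Lemma twin_trans x y z : twin a x y -> twin a y z -> twin a x z.
Proof.
  intros H1 H2 w N1 N2. destruct (classic (w = y)) as [->|N]; [|rewrite H1, H2; auto].
  destruct (classic (x = z)) as [->|Nxz]; auto.
  rewrite (a_sym x y), (a_sym z y). rewrite (H2 x) by auto. rewrite (a_sym z x), (H1 z) by auto. auto.
Qed.

Lemma twin_adj u v u' v' : twin a u u' -> twin a v v' -> u <> v -> u' <> v' -> a u v = a u' v'.
Proof.
  intros H1 H2 N N'. destruct (classic (v = u')) as [->|N1].
  - destruct (classic (u = v')) as [->|N2]; [apply a_sym|].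
    rewrite (a_sym u u'), (H2 u), (a_sym v' u), (H1 v') by auto. auto.
  - rewrite (H1 v), (a_sym u' v), (H2 u'), (a_sym v' u') by auto. auto.
Qed.

Lemma good_finitely_many_twins : good a (fun _ => True) -> exists l : list V, forall v, exists u, In u l /\ twin a v u.
Proof.
  intros G. destruct (good_coloring a _ a_sym G) as [k [c [M [H1 H2]]]].
  assert (K : exists l : list V, forall v, c v < k -> exists u, In u l /\ c u = c v).
  { clear H1. induction k as [|k [l IH]]; [exists nil; intros; lia|].
    destruct (classic (exists v, c v = k)) as [[v0 E0]|N].
    - exists (v0 :: l)%list. intros v Lv. destruct (Nat.eq_dec (c v) k) as [E|E].
      + exists v0. split; [left; auto|congruence].
      + destruct (IH v) as [u [Hu Eu]]; [lia|]. exists u; split; [right; auto|auto].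
    - exists l. intros v Lv. apply IH. assert (c v <> k) by eauto. lia. }
  destruct K as [l Hl]. exists l. intros v. destruct (Hl v (H1 v I)) as [u [Hu Eu]]. exists u. split; auto.
  intros w N1 N2. rewrite (H2 v w), (H2 u w), Eu; auto.
Qed.

Lemma twin_pigeon (l : list V) (p : nat -> V) : (forall n, exists u, In u l /\ twin a (p n) u) ->
  exists k, inc k /\ forall i j, twin a (p (k i)) (p (k j)).
Proof.
  revert p. induction l as [|r l IH]; intros p H; [destruct (H 0) as [u [[] _]]|].
  destruct (pigeon (fun n => twin a (p n) r)) as [k [Hk [K|K]]].
  - exists k. split; auto. intros i j. eapply twin_trans; [apply K|]. apply twin_sym, K.
  - destruct (IH (fun n => p (k n))) as [k' [Hk' K']].
    + intros n. destruct (H (k n)) as [u [[<-|Hu] T]]; [exfalso; eapply K; eauto|eauto].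
    + exists (fun i => k (k' i)). split; auto. now apply inc_comp.
Qed.

Lemma twin_pigeon_list (l m : list V) (p : V -> nat -> V) : (forall v n, exists u, In u l /\ twin a (p v n) u) ->
  exists k, inc k /\ forall v, In v m -> forall i j, twin a (p v (k i)) (p v (k j)).
Proof.
  intros H. induction m as [|v m [k [Hk K]]]; [exists (fun i => i); split; [apply inc_id|intros v []]|].
  destruct (twin_pigeon l (fun n => p v (k n))) as [k' [Hk' K']]; [intros n; apply H|].
  exists (fun i => k (k' i)). split; [now apply inc_comp|].
  intros w [<-|Hw] i j; auto.
Qed.

Variables (W : Type) (b : W -> W -> bool).
Hypothesis b_irr : forall x, b x x = false.

(** The self-embedding [e] reflects twins and there are finitely many twin classes, so by the
    pigeonhole principle some power of [e] sends every vertex to a twin of itself. With [F] chosen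
    so that [g] after [F] is this power, the bijection from [F] and [g] differs from [g] only inside
    twin classes, and such changes preserve adjacency. *)
Lemma one_sibling_good (f : V -> W) (g : W -> V) : good a (fun _ => True) ->
  (forall x y, f x = f y -> x = y) -> (forall x y, b (f x) (f y) = a x y) ->
  (forall x y, g x = g y -> x = y) -> (forall x y, a (g x) (g y) = b x y) ->
  exists (h : W -> V) (k : V -> W), (forall p, k (h p) = p) /\ (forall v, h (k v) = v) /\
    forall p q, a (h p) (h q) = b p q.
Proof.
  intros G Hf1 Hf2 Hg1 Hg2. destruct (good_finitely_many_twins G) as [l Hl].
  pose (e v := g (f v)).
  assert (Refl1 : forall u v, twin a (e u) (e v) -> twin a u v).
  { intros u v H w N1 N2. unfold e in H. rewrite <- (Hf2 u w), <- (Hf2 v w), <- (Hg2 (f u)), <- (Hg2 (f v)).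
    apply H; intros E; apply Hg1, Hf1 in E; auto. }
  pose (it n v := Nat.iter n e v).
  assert (Refl : forall n u v, twin a (it n u) (it n v) -> twin a u v).
  { induction n as [|n IH]; intros u v H; [exact H|]. apply IH, Refl1, H. }
  destruct (twin_pigeon_list l l (fun v n => it n v)) as [k [Hk K]]; [intros v n; apply Hl|].
  assert (L : k 0 < k 1) by apply Hk.
  (* The iterates [k 0] and [k 1] agree up to twins on all representatives; reflection of twins
     cancels the first [k 0] steps. *)
  set (r := k 1 - k 0). assert (Lr : 1 <= r) by (unfold r; lia).
  assert (Kr : forall u, In u l -> twin a u (it r u)).
  { intros u Hu. apply (Refl (k 0)). unfold it. rewrite <- Nat.iter_add.
    replace (k 0 + r) with (k 1) by (unfold r; lia). apply K; auto. }
  assert (Kall : forall v, twin a (it r v) v).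
  { intros v. destruct (Hl (it r v)) as [u [Hu T]]. pose proof (Kr u Hu) as T'.
    assert (T2 : twin a v u) by (apply (Refl r); eapply twin_trans; eauto).
    eapply twin_trans; [exact T|]. now apply twin_sym. }
  pose (F v := f (it (r - 1) v)).
  assert (HF : forall v, g (F v) = it r v).
  { intros v. unfold F. replace r with (S (r - 1)) at 2 by lia. reflexivity. }
  assert (HFi : forall x y, F x = F y -> x = y).
  { assert (Hi : forall n x y, it n x = it n y -> x = y).
    { induction n as [|n IH]; intros x y E; [exact E|]. apply IH. apply Hf1, Hg1. exact E. }
    intros x y E. apply (Hi r). now rewrite <- !HF, E. }
  destruct (schroeder_bernstein F g HFi Hg1) as [h [k' [H1 [H2 H3]]]].
  exists h, k'. split; auto. split; auto.
  assert (T : forall p, twin a (h p) (g p)).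
  { intros p. destruct (H3 p) as [->|E]; [apply twin_refl|]. rewrite <- E at 2. rewrite HF. apply twin_sym, Kall. }
  intros p q. destruct (classic (p = q)) as [->|N]; [now rewrite a_irr, b_irr|].
  rewrite <- Hg2. apply twin_adj; [apply T|apply T| |].
  - intros E. apply N. rewrite <- (H1 p), <- (H1 q), E. auto.
  - intros E. apply N, Hg1, E.
Qed.

End Twins.

(** * Isomorphism invariants *)

Definition giso {V W : Type} (a : V -> V -> bool) (S : V -> Prop) (b : W -> W -> bool) (T : W -> Prop) : Prop :=
  exists (f : V -> W) (g : W -> V), (forall x, S x -> T (f x)) /\ (forall y, T y -> S (g y)) /\
    (forall x, S x -> g (f x) = x) /\ (forall y, T y -> f (g y) = y) /\
    (forall x y, S x -> S y -> b (f x) (f y) = a x y).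

(* [top a S o]: [S] is a strong module whose root in the decomposition tree is labelled [o]. *)
Definition top {V : Type} (a : V -> V -> bool) (S : V -> Prop) (o : bool) : Prop :=
  exists x y, S x /\ S y /\ x <> y /\ a x y = o /\ forall w, S w -> ~ prec a x y w.

(** When [o] is the label of the root of [M], these are the vertices that form a child of the root
    by themselves. *)
Definition leaf {V : Type} (a : V -> V -> bool) (M : V -> Prop) (o : bool) (z : V) : Prop :=
  M z /\ forall u, M u -> u <> z -> a z u = o.

Definition card {V : Type} (P : V -> Prop) (m : nat) : Prop :=
  exists l : list V, NoDup l /\ length l = m /\ forall z, P z <-> In z l.

Definition root_inv {V : Type} (n : nat) (a : V -> V -> bool) (S : V -> Prop) : Prop :=
  (exists o, top a S o) /\ forall o, top a S o -> card (leaf a S o) n.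

(** A module without a root. Seen from some vertex, all finite leaf counts above a certain node are
    multiples of [n]; seen from any vertex, the count [n] itself occurs cofinally. *)
Definition limit_inv {V : Type} (n : nat) (a : V -> V -> bool) (S : V -> Prop) : Prop :=
  (forall o, ~ top a S o) /\
  (exists x y0, S x /\ S y0 /\ x <> y0 /\ forall y, S y -> mlt a S x y0 y ->
     forall m, card (leaf a (mm a S x y) (a x y)) m -> Nat.divide n m) /\
  (forall x y0, S x -> S y0 -> x <> y0 -> exists y, S y /\ mlt a S x y0 y /\ card (leaf a (mm a S x y) (a x y)) n).

Definition inv {V : Type} (n : nat) (a : V -> V -> bool) (S : V -> Prop) : Prop := root_inv n a S \/ limit_inv n a S.

Lemma card_unique {V} (P : V -> Prop) m n : card P m -> card P n -> m = n.
Proof.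
  intros [l [N1 [L1 H1]]] [l' [N2 [L2 H2]]]. subst. apply Nat.le_antisymm; apply NoDup_incl_length; auto; intros z Hz.
  - apply H2, H1, Hz.
  - apply H1, H2, Hz.
Qed.

(** In the limit case the divisibility known for [n] is applied at a node whose leaf count is
    [m]. *)
Lemma inv_exclusive {V} (a : V -> V -> bool) S n m : inv n a S -> inv m a S -> n <> m -> ~ Nat.divide n m -> False.
Proof.
  intros [[[o To] R]|[N [[x [y0 [Hx [Hy [Hne D]]]]] _]]] [[[o' To'] R']|[N' [_ E]]] Nm Nd.
  - apply Nm. eapply card_unique; [apply R; exact To|apply R'; exact To].
  - exact (N' o To).
  - exact (N o' To').
  - destruct (E x y0 Hx Hy Hne) as [y [Sy [L C]]]. apply Nd. eapply D; eauto.
Qed.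

Section IsoInvariance.
Variables (V W : Type) (a : V -> V -> bool) (S : V -> Prop) (b : W -> W -> bool) (T : W -> Prop).
Variables (f : V -> W) (g : W -> V).
Hypothesis f_in : forall x, S x -> T (f x).
Hypothesis g_in : forall y, T y -> S (g y).
Hypothesis gf : forall x, S x -> g (f x) = x.
Hypothesis fg : forall y, T y -> f (g y) = y.
Hypothesis f_adj : forall x y, S x -> S y -> b (f x) (f y) = a x y.

Lemma iso_inj x y : S x -> S y -> f x = f y -> x = y.
Proof. intros Hx Hy E. rewrite <- (gf x Hx), <- (gf y Hy), E. auto. Qed.

Lemma iso_prec x y z : S x -> S y -> S z -> (prec b (f x) (f y) (f z) <-> prec a x y z).
Proof. intros Hx Hy Hz. unfold prec. rewrite !f_adj by auto. tauto. Qed.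

Lemma iso_mlt x y z : S x -> S y -> S z -> (mlt b T (f x) (f y) (f z) <-> mlt a S x y z).
Proof.
  intros Hx Hy Hz. unfold mlt. rewrite iso_prec by auto. split; (intros [H|[w [Hw [H1 H2]]]]; [left; auto|right]).
  - exists (g w). rewrite <- (fg w Hw) in H1, H2. rewrite iso_prec in H1, H2 by auto. auto.
  - exists (f w). rewrite !iso_prec by auto. auto.
Qed.

Lemma iso_top o : top a S o -> top b T o.
Proof.
  intros [x [y [Hx [Hy [N [E H]]]]]]. exists (f x), (f y). split; auto. split; auto.
  split; [intros Q; apply N; now apply iso_inj|]. split; [now rewrite f_adj|].
  intros w Hw Q. rewrite <- (fg w Hw) in Q. rewrite iso_prec in Q by auto. exact (H (g w) (g_in w Hw) Q).
Qed.

Lemma iso_card (P : V -> Prop) (Q : W -> Prop) m : (forall x, P x -> S x) -> (forall y, Q y -> T y) ->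
  (forall x, S x -> (P x <-> Q (f x))) -> card P m -> card Q m.
Proof.
  intros HP HQ H [l [N [L Hl]]]. exists (map f l). split; [|split].
  - assert (K : forall l', NoDup l' -> (forall x, In x l' -> S x) -> NoDup (map f l')).
    { induction l' as [|x l' IH]; intros N' HS; cbn; constructor; inversion N'; subst.
      - intros Hin. apply in_map_iff in Hin. destruct Hin as [y [E Hy]].
        apply iso_inj in E; [|apply HS; right; auto|apply HS; left; auto]. subst. auto.
      - apply IH; auto. intros y Hy. apply HS. right; auto. }
    apply K; auto. intros x Hx. apply HP, Hl, Hx.
  - now rewrite length_map.
  - intros z. split.
    + intros Hz. assert (Tz := HQ z Hz). apply in_map_iff. exists (g z). split; auto. apply Hl, H; auto. now rewrite fg.
    + intros Hin. apply in_map_iff in Hin. destruct Hin as [x [<- Hx]]. apply Hl in Hx. apply H; auto.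
Qed.

Lemma iso_leaf (M : V -> Prop) (M' : W -> Prop) o x : (forall x, M x -> S x) -> (forall y, M' y -> T y) ->
  (forall x, S x -> (M x <-> M' (f x))) -> S x -> (leaf a M o x <-> leaf b M' o (f x)).
Proof.
  intros HM HM' H Hx. unfold leaf. rewrite (H x Hx). split; intros [H1 H2]; split; auto; intros u Hu N.
  - rewrite <- (fg u), f_adj by auto. apply H2; [apply H; auto; rewrite fg; auto|].
    intros E. apply N. rewrite <- E. symmetry. apply fg. auto.
  - rewrite <- f_adj by auto. apply H2; [apply H; auto|]. intros E. apply N. apply iso_inj; auto.
Qed.

Lemma iso_leafs_card x y m : S x -> S y ->
  (card (leaf a (mm a S x y) (a x y)) m <-> card (leaf b (mm b T (f x) (f y)) (b (f x) (f y))) m).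
Proof.
  intros Hx Hy. rewrite f_adj by auto.
  assert (HM : forall z, S z -> (mm a S x y z <-> mm b T (f x) (f y) (f z))).
  { intros z Hz. unfold mm. rewrite iso_mlt by auto. assert (T (f z)) by auto. tauto. }
  assert (HL : forall z, S z -> (leaf a (mm a S x y) (a x y) z <-> leaf b (mm b T (f x) (f y)) (a x y) (f z))).
  { intros z Hz. apply iso_leaf; auto; intros w Hw; apply Hw. }
  assert (S1 : forall z, leaf a (mm a S x y) (a x y) z -> S z) by (intros z Hz; apply Hz).
  assert (S2 : forall z, leaf b (mm b T (f x) (f y)) (a x y) z -> T z) by (intros z Hz; apply Hz).
  split; [now apply iso_card|].
  intros [l [N [L Hl]]]. exists (map g l). split; [|split].
  - assert (K : forall l', NoDup l' -> (forall z, In z l' -> T z) -> NoDup (map g l')).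
    { induction l' as [|z l' IH]; intros N' HS; cbn; constructor; inversion N'; subst.
      - intros Hin. apply in_map_iff in Hin. destruct Hin as [w [E Hw]].
        assert (w = z) by (rewrite <- (fg w), <- (fg z), E; auto; apply HS; [left|right]; auto). subst; auto.
      - apply IH; auto. intros w Hw. apply HS. right; auto. }
    apply K; auto. intros z Hz. apply S2, Hl, Hz.
  - now rewrite length_map.
  - intros z. split.
    + intros Hz. apply in_map_iff. exists (f z). split; [auto|]. apply Hl, HL; auto.
    + intros Hin. apply in_map_iff in Hin. destruct Hin as [w [<- Hw]]. apply Hl in Hw.
      assert (Tw := S2 w Hw). apply HL; auto. now rewrite fg.
Qed.

End IsoInvariance.

Lemma inv_iso {V W} (a : V -> V -> bool) S (b : W -> W -> bool) T n : giso a S b T -> inv n a S -> inv n b T.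
Proof.
  intros [f [g [F [G [GF [FG FA]]]]]].
  assert (GA : forall x y, T x -> T y -> a (g x) (g y) = b x y) by (intros x y Hx Hy; rewrite <- FA, !FG; auto).
  intros [[[o To] R]|[N [[x [y0 [Hx [Hy [Hne D]]]]] E]]].
  - left. split; [exists o; eapply (iso_top V W a S b T f g); eauto|].
    intros o' To'. assert (Ta : top a S o') by (eapply (iso_top W V b T a S g f); eauto).
    eapply (iso_card V W S T f g G GF FG); [| | |apply R; exact Ta]; try (intros z Hz; apply Hz).
    intros z Hz. eapply (iso_leaf V W a S b T f g); eauto. intros w Hw. split; auto.
  - right. split; [intros o To; apply (N o); eapply (iso_top W V b T a S g f); eauto|]. split.
    + exists (f x), (f y0). split; auto. split; auto. split.
      { intros Q. apply Hne. rewrite <- (GF x), <- (GF y0), Q; auto. }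
      intros y Ty L m Hm. rewrite <- (FG y Ty) in L, Hm.
      rewrite (iso_mlt V W a S b T f g) in L by auto.
      apply (iso_leafs_card V W a S b T f g) in Hm; auto. eapply (D (g y)); eauto.
    + intros p q Tp Tq Npq. destruct (E (g p) (g q)) as [y [Sy [L C]]]; auto.
      { intros Q. apply Npq. rewrite <- (FG p), <- (FG q), Q; auto. }
      exists (f y). split; auto. split.
      * rewrite <- (FG p), <- (FG q) by auto. apply (iso_mlt V W a S b T f g); auto.
      * apply (iso_leafs_card V W a S b T f g F G GF FG FA) in C; auto. now rewrite FG in C.
Qed.

(** * Substituting graphs for the classes of a canonical partition *)

Section Substitution.
Variables (V : Type) (idx : V -> nat).
Hypothesis idx_inj : forall x y, idx x = idx y -> x = y.
Variable a : V -> V -> bool.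
Hypothesis a_sym : forall x y, a x y = a y x.
Local Notation all := (fun _ : V => True).
Hypothesis P4 : p4free a all.
Variable C : V -> Prop.
Local Notation md := (mm a all).

Definition eqv (x y : V) : Prop := x = y \/ gemb a (md x y) a C.

Lemma eqv_sym x y : eqv x y -> eqv y x.
Proof.
  intros [->|H]; [left; auto|]. destruct (classic (x = y)) as [->|N]; [left; auto|].
  right. rewrite <- (mm_sym V a all a_sym P4 x y); auto.
Qed.

Lemma mod_closed x y : closed a all (md x y).
Proof. now apply mm_closed. Qed.

Lemma mod_l x y : md x y x.
Proof. now apply mm_in_l. Qed.

Lemma mod_r x y : md x y y.
Proof. now apply mm_in_r. Qed.

Lemma eqv_of_closed D x y : closed a all D -> D x -> D y -> gemb a D a C -> eqv x y.
Proof.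
  intros HD Dx Dy H. destruct (classic (x = y)) as [->|N]; [left; auto|]. right.
  eapply gemb_trans; [|exact H]. apply gemb_incl. apply mm_least; auto.
Qed.

Lemma eqv_trans x y z : eqv x y -> eqv y z -> eqv x z.
Proof.
  intros [->|H1]; [auto|]. intros [->|H2]; [right; auto|].
  destruct (closed_nested V a all a_sym P4 (md x y) (md y z) y) as [I|I]; auto using mod_closed, mod_l, mod_r.
  - apply (eqv_of_closed (md y z)); auto using mod_closed, mod_r. apply I, mod_l.
  - apply (eqv_of_closed (md x y)); auto using mod_closed, mod_l. apply I, mod_r.
Qed.

Lemma eqv_closed x : closed a all (eqv x).
Proof.
  split; [intros y _; exact Logic.I|]. intros u v z Hu Hv N _ Hz.
  eapply eqv_trans; [exact Hu|]. apply (eqv_of_closed (md u v)); auto using mod_closed, mod_l.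
  - split; auto.
  - assert (K : eqv u v) by (eapply eqv_trans; [apply eqv_sym; exact Hu|exact Hv]).
    destruct K as [K|K]; [contradiction|auto].
Qed.

Definition crep (c : V) : Prop := forall x, eqv c x -> idx c <= idx x.

Lemma crep_exists x : exists c, crep c /\ eqv c x.
Proof.
  destruct (least_element idx (eqv x)) as [c [Hc Hl]]; [exists x; left; auto|].
  exists c. split; [|now apply eqv_sym]. intros y Hy. apply Hl. eapply eqv_trans; eauto.
Qed.

Lemma crep_unique c c' : crep c -> crep c' -> eqv c c' -> c = c'.
Proof.
  intros H H' E. apply idx_inj, Nat.le_antisymm; [apply H; auto|apply H'; apply eqv_sym; auto].
Qed.

Lemma cross_adj c d x y : crep c -> crep d -> c <> d -> eqv c x -> eqv d y -> a x y = a c d.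
Proof.
  intros Hc Hd N Hx Hy.
  assert (Ny : ~ eqv c y) by (intros Q; apply N, crep_unique; auto; eapply eqv_trans; [exact Q|apply eqv_sym; auto]).
  assert (Nc : ~ eqv d c) by (intros Q; apply N, crep_unique; auto; apply eqv_sym; auto).
  rewrite (closed_adj V a all a_sym P4 (eqv c) x c y); auto using eqv_closed; [|left; auto].
  rewrite (a_sym c y), (a_sym c d). apply (closed_adj V a all a_sym P4 (eqv d)); auto using eqv_closed. left; auto.
Qed.

Variable W : Type.

Record piece := Piece { padj : W -> W -> bool; pset : W -> Prop }.

(* What a graph must satisfy in order to replace the class [P]: condition [pk_top] makes it a strong
   module of the new graph, and [pk_mm] a class of the new canonical partition. *)
Record piece_ok (P : V -> Prop) (k : piece) : Prop := PieceOk {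
  pk_to : gemb a P (padj k) (pset k);
  pk_from : gemb (padj k) (pset k) a P;
  pk_top : forall o, top (padj k) (pset k) o -> top a P o;
  pk_mm : forall p q, pset k p -> pset k q -> p <> q -> gemb (padj k) (mm (padj k) (pset k) p q) a C }.

Variable H : V -> piece.
Hypothesis H_ok : forall c, crep c -> piece_ok (eqv c) (H c).

Definition sadj (u v : V * W) : bool :=
  if excluded_middle_informative (fst u = fst v) then padj (H (fst u)) (snd u) (snd v) else a (fst u) (fst v).

Definition sset (u : V * W) : Prop := crep (fst u) /\ pset (H (fst u)) (snd u).

Lemma sadj_same c p q : sadj (c, p) (c, q) = padj (H c) p q.
Proof. unfold sadj. cbn. destruct excluded_middle_informative; congruence. Qed.

Lemma sadj_diff c d p q : c <> d -> sadj (c, p) (d, q) = a c d.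
Proof. intros N. unfold sadj. cbn. destruct excluded_middle_informative; congruence. Qed.

Lemma piece_inh c : crep c -> exists p, pset (H c) p.
Proof. intros Hc. destruct (pk_to _ _ (H_ok c Hc)) as [f [F _]]. exists (f c). apply F. left; auto. Qed.

Lemma class_map : exists (r : V -> V) (f : V -> W), (forall x, crep (r x) /\ eqv (r x) x) /\
  (forall x, pset (H (r x)) (f x)) /\
  (forall x y, r x = r y -> f x = f y -> x = y) /\
  (forall x y, sadj (r x, f x) (r y, f y) = a x y).
Proof.
  destruct (choice_fun _ crep_exists) as [r Hr].
  assert (Hf : forall c, exists f : V -> W, crep c -> (forall x, eqv c x -> pset (H c) (f x)) /\
     (forall x y, eqv c x -> eqv c y -> f x = f y -> x = y) /\
     (forall x y, eqv c x -> eqv c y -> padj (H c) (f x) (f y) = a x y)).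
  { intros c. destruct (classic (crep c)) as [Hc|Hc]; [destruct (pk_to _ _ (H_ok c Hc)) as [f Hf]; eauto|].
    destruct (Hr c) as [Hc' _]. destruct (piece_inh _ Hc') as [p _]. exists (fun _ => p). tauto. }
  destruct (choice_fun _ Hf) as [f Hfs]. exists r, (fun x => f (r x) x).
  split; [auto|]. split; [|split].
  - intros x. destruct (Hr x) as [R1 R2]. now apply (Hfs (r x) R1).
  - intros x y E1 E2. rewrite <- E1 in E2. destruct (Hr x) as [R1 R2]. destruct (Hr y) as [R3 R4].
    apply (Hfs (r x) R1); auto. now rewrite E1.
  - intros x y. destruct (Hr x) as [R1 R2]. destruct (Hr y) as [R3 R4].
    destruct (classic (r x = r y)) as [E|E].
    + rewrite <- E in *. rewrite sadj_same. apply (Hfs (r x) R1); auto.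
    + rewrite sadj_diff by auto. symmetry. apply cross_adj; auto.
Qed.

Lemma subst_to : gemb a all sadj sset.
Proof.
  destruct class_map as [r [f [R [F1 [F2 F3]]]]]. exists (fun x => (r x, f x)). split; [|split].
  - intros x _. split; cbn; [apply R|apply F1].
  - intros x y _ _ E. injection E as E1 E2. auto.
  - auto.
Qed.

Lemma subst_from : gemb sadj sset a all.
Proof.
  assert (Hg : forall c, exists g : W -> V, crep c -> (forall p, pset (H c) p -> eqv c (g p)) /\
     (forall p q, pset (H c) p -> pset (H c) q -> g p = g q -> p = q) /\
     (forall p q, pset (H c) p -> pset (H c) q -> a (g p) (g q) = padj (H c) p q)).
  { intros c. destruct (classic (crep c)) as [Hc|Hc]; [destruct (pk_from _ _ (H_ok c Hc)) as [g Hg]; eauto|].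
    exists (fun _ => c). tauto. }
  destruct (choice_fun _ Hg) as [g Hgs]. exists (fun u => g (fst u) (snd u)). split; [auto|]. split.
  - intros [c p] [d q] [Hc Hp] [Hd Hq]; cbn in *. intros E.
    destruct (classic (c = d)) as [<-|N]; [f_equal; apply (Hgs c Hc); auto|]. exfalso. apply N, crep_unique; auto.
    eapply eqv_trans; [apply (Hgs c Hc); exact Hp|]. rewrite E. apply eqv_sym. now apply (Hgs d Hd).
  - intros [c p] [d q] [Hc Hp] [Hd Hq]; cbn in *. destruct (classic (c = d)) as [<-|N].
    + rewrite sadj_same. apply (Hgs c Hc); auto.
    + rewrite sadj_diff by auto. apply cross_adj; auto; [now apply (Hgs c Hc)|now apply (Hgs d Hd)].
Qed.

(** The least strong module stays inside the fibre, where [pk_mm] bounds it. The delicate case is a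
    pair at the root of the piece whose label equals the adjacency to another class: [pk_top]
    carries this label to the root of the original class, and closedness of that class provides a
    third class as separator. *)
Lemma fiber_same c p q : sset (c, p) -> sset (c, q) -> p <> q -> gemb sadj (mm sadj sset (c, p) (c, q)) a C.
Proof.
  intros [Hc Hp] [_ Hq] N. cbn in *. pose proof (H_ok c Hc) as OK.
  destruct (pk_mm _ _ OK p q Hp Hq N) as [f [F1 [F2 F3]]].
  assert (K : forall z, mm sadj sset (c, p) (c, q) z -> fst z = c /\ mm (padj (H c)) (pset (H c)) p q (snd z)).
  { intros [k s] [[Hk Hs] Hm]. cbn in Hk, Hs |- *. destruct (classic (k = c)) as [->|Nk].
    - split; auto. split; auto. intros Q. apply Hm. destruct Q as [[Q1 Q2]|[w [Hw [[Q1 Q2] [Q3 Q4]]]]].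
      + left. split; rewrite !sadj_same; auto.
      + right. exists (c, w). split; [split; auto|]. split; split; rewrite !sadj_same; auto.
    - exfalso. apply Hm. destruct (bool_dec (padj (H c) p q) (a c k)) as [E|E].
      2:{ left. split; rewrite ?sadj_same, ?sadj_diff; auto. }
      destruct (classic (exists w, pset (H c) w /\ prec (padj (H c)) p q w)) as [[w [Hw [W1 W2]]]|NT].
      { right. exists (c, w). split; [split; auto|].
        split; split; rewrite ?sadj_same, ?(sadj_diff c k) by auto; auto; congruence. }
      assert (T0 : top (padj (H c)) (pset (H c)) (a c k)).
      { exists p, q. split; auto. split; auto. split; auto. split; auto. intros w Hw Q. eauto. }
      destruct (pk_top _ _ OK _ T0) as [x [y [Hx [Hy [Nxy [Exy Ht]]]]]].
      assert (Nck : ~ eqv c k) by (intros Q; apply Nk; symmetry; apply crep_unique; auto).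
      assert (Exk : a x k = a c k) by (apply cross_adj; auto; left; auto).
      destruct (closed_out V a all (eqv c) x y k (eqv_closed c) Hx Hy Nxy Logic.I Nck) as [[Q _]|[w [_ [W1 W2]]]]; [congruence|].
      assert (Nw : ~ eqv c w) by (intros Q; exact (Ht w Q W1)).
      destruct (crep_exists w) as [l [Hl El]].
      assert (Ncl : c <> l) by (intros <-; auto).
      assert (Exw : a x w = a c l) by (apply cross_adj; auto).
      assert (Nlk : l <> k).
      { intros ->. destruct W2 as [W2 _]. apply W2. rewrite Exw, Exk. auto. }
      assert (Ewk : a w k = a l k) by (apply cross_adj; auto; left; auto).
      destruct W1 as [W1 _], W2 as [W2 W3].
      destruct (piece_inh l Hl) as [t Ht']. right. exists (l, t). split; [split; auto|].
      split; split; rewrite ?sadj_same, ?sadj_diff by auto; congruence. }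
  exists (fun z => f (snd z)). split; [|split].
  - intros z Hz. apply F1. now apply K.
  - intros [k s] [k' s'] Hz Hz' E. destruct (K _ Hz) as [E1 M1]. destruct (K _ Hz') as [E2 M2]. cbn in *.
    subst. f_equal. now apply F2.
  - intros [k s] [k' s'] Hz Hz'. destruct (K _ Hz) as [E1 M1]. destruct (K _ Hz') as [E2 M2]. cbn in *.
    subst. rewrite sadj_same. now apply F3.
Qed.

(** A strong module meeting both fibres contains the image of [md c k] under [class_map]. If it
    embedded into [C], the representatives [c] and [k] would be equivalent. *)
Lemma fiber_diff c k p q : sset (c, p) -> sset (k, q) -> c <> k -> ~ gemb sadj (mm sadj sset (c, p) (k, q)) a C.
Proof.
  intros [Hc Hp] [Hk Hq] N G. cbn in *. apply N, crep_unique; auto. right.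
  eapply gemb_trans; [|exact G]. destruct class_map as [r [f [R [F1 [F2 F3]]]]].
  exists (fun x => (r x, f x)). split; [|split; [intros x y _ _ E; injection E; auto|auto]].
  intros w Mw. destruct (R w) as [Rl El]. split; [split; cbn; auto|].
  set (l := r w) in *. generalize (f w). intros s.
  assert (Nl : ~ mlt a all c k l).
  { assert (Ml : md c k l); [|apply Ml].
    destruct (closed_nested V a all a_sym P4 (eqv l) (md c k) w) as [I|I]; auto using eqv_closed, mod_closed.
    - apply I. left; auto.
    - exfalso. apply N, crep_unique; auto. eapply eqv_trans; [apply eqv_sym|]; apply I; auto using mod_l, mod_r. }
  assert (KP : forall t s', prec sadj (c, p) (k, q) (t, s') -> t <> c /\ t <> k /\ prec a c k t).
  { intros t s' [Q1 Q2]. destruct (classic (t = c)) as [->|Ntc].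
    - exfalso. rewrite (sadj_diff c k), (sadj_diff k c) in * by auto. apply Q1. rewrite <- Q2. apply a_sym.
    - destruct (classic (t = k)) as [->|Ntk].
      + exfalso. apply Q1. rewrite !(sadj_diff c k) by auto. auto.
      + rewrite !sadj_diff in * by auto. split; auto. split; auto. split; auto. }
  intros [Q|[[t s'] [_ [Q1 Q2]]]].
  - destruct (KP _ _ Q) as [_ [_ Q']]. apply Nl. left; auto.
  - destruct (KP _ _ Q1) as [Ntc [Ntk [K1 K2]]]. destruct Q2 as [Q2 Q3].
    rewrite (sadj_diff c t) in Q2 by auto.
    destruct (classic (l = t)) as [E|Nlt]; [rewrite E, (sadj_diff c t) in Q2 by auto; auto|].
    destruct (classic (l = c)) as [E|Nlc].
    { rewrite E in *. rewrite (sadj_diff t c) in Q3 by auto. apply Q2. rewrite <- Q3. apply a_sym. }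
    rewrite (sadj_diff c l), (sadj_diff t l) in * by auto.
    destruct (classic (l = k)) as [E|Nlk]; [rewrite E in *; rewrite (a_sym t k) in Q3; congruence|].
    apply Nl. right. exists t. split; auto. split; split; auto.
Qed.

End Substitution.

(** Two vertices lie in one fibre exactly if they are equal or their least strong module embeds into
    [C]; an isomorphism preserves this, so it matches fibres with fibres. *)
Lemma subst_iso_fibers {V} (idx : V -> nat) (a : V -> V -> bool) (C : V -> Prop) {W}
  (idx_inj : forall x y, idx x = idx y -> x = y) (a_sym : forall x y, a x y = a y x)
  (P4 : p4free a (fun _ => True)) (H H' : V -> piece W) :
  (forall c, crep V idx a C c -> piece_ok V a C W (eqv V a C c) (H c)) ->
  (forall c, crep V idx a C c -> piece_ok V a C W (eqv V a C c) (H' c)) ->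
  giso (sadj V a W H) (sset V idx a C W H) (sadj V a W H') (sset V idx a C W H') ->
  forall c, crep V idx a C c -> exists d, crep V idx a C d /\
    giso (padj W (H c)) (pset W (H c)) (padj W (H' d)) (pset W (H' d)).
Proof.
  intros OK OK' [f [g [F [G [GF [FG FA]]]]]] c Hc.
  set (s := sadj V a W H) in *. set (s' := sadj V a W H') in *.
  set (T := sset V idx a C W H) in *. set (T' := sset V idx a C W H') in *.
  assert (GA : forall x y, T' x -> T' y -> s (g x) (g y) = s' x y) by (intros x y Hx Hy; rewrite <- FA, !FG; auto).
  assert (M : forall u v, T u -> T v -> gemb s (mm s T u v) a C -> gemb s' (mm s' T' (f u) (f v)) a C).
  { intros u v Hu Hv K. eapply gemb_trans; [|exact K]. exists g. split; [|split].
    - intros z [Tz Mz]. split; auto. intros Q. apply Mz. rewrite <- (FG z Tz).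
      apply (iso_mlt _ _ s T s' T' f g F G FG FA); auto.
    - intros x y [Hx _] [Hy _] E. rewrite <- (FG x), <- (FG y), E; auto.
    - intros x y [Hx _] [Hy _]. auto. }
  assert (M' : forall u v, T' u -> T' v -> gemb s' (mm s' T' u v) a C -> gemb s (mm s T (g u) (g v)) a C).
  { intros u v Hu Hv K. eapply gemb_trans; [|exact K]. exists f. split; [|split].
    - intros z [Tz Mz]. split; auto. intros Q. apply Mz. rewrite <- (GF z Tz).
      apply (iso_mlt _ _ s' T' s T g f G F GF GA); auto.
    - intros x y [Hx _] [Hy _] E. rewrite <- (GF x), <- (GF y), E; auto.
    - intros x y [Hx _] [Hy _]. auto. }
  assert (Same : forall u v, T u -> T v -> fst u = fst v -> fst (f u) = fst (f v)).
  { intros [d p] [d' q] Hu Hv E. cbn in E. subst d'. destruct (classic (p = q)) as [->|N]; auto.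
    apply NNPP; intros Q. pose proof (F _ Hu) as Fu. pose proof (F _ Hv) as Fv.
    pose proof (M _ _ Hu Hv (fiber_same V idx idx_inj a a_sym P4 C W H OK d p q Hu Hv N)) as K.
    destruct (f (d, p)) as [e1 p1]. destruct (f (d, q)) as [e2 q1]. cbn in Q.
    exact (fiber_diff V idx idx_inj a a_sym P4 C W H' OK' e1 e2 p1 q1 Fu Fv Q K). }
  assert (Same' : forall u v, T' u -> T' v -> fst u = fst v -> fst (g u) = fst (g v)).
  { intros [d p] [d' q] Hu Hv E. cbn in E. subst d'. destruct (classic (p = q)) as [->|N]; auto.
    apply NNPP; intros Q. pose proof (G _ Hu) as Fu. pose proof (G _ Hv) as Fv.
    pose proof (M' _ _ Hu Hv (fiber_same V idx idx_inj a a_sym P4 C W H' OK' d p q Hu Hv N)) as K.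
    destruct (g (d, p)) as [e1 p1]. destruct (g (d, q)) as [e2 q1]. cbn in Q.
    exact (fiber_diff V idx idx_inj a a_sym P4 C W H OK e1 e2 p1 q1 Fu Fv Q K). }
  destruct (piece_inh V idx idx_inj a C W H OK c Hc) as [p0 Hp0].
  assert (T0 : T (c, p0)) by (split; auto).
  set (d := fst (f (c, p0))). assert (Hd : crep V idx a C d) by (apply (F _ T0)).
  assert (Fd : forall p, pset W (H c) p -> f (c, p) = (d, snd (f (c, p)))).
  { intros p Hp. rewrite (surjective_pairing (f (c, p))) at 1. f_equal. apply Same; auto. split; auto. }
  assert (Gc : forall q, pset W (H' d) q -> g (d, q) = (c, snd (g (d, q)))).
  { intros q Hq. rewrite (surjective_pairing (g (d, q))) at 1. f_equal.
    transitivity (fst (g (f (c, p0)))); [|now rewrite GF]. apply Same'; auto. split; auto. }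
  assert (Tc : forall p, pset W (H c) p -> T (c, p)) by (intros p Hp; split; auto).
  assert (Td : forall q, pset W (H' d) q -> T' (d, q)) by (intros q Hq; split; auto).
  exists d. split; auto. exists (fun p => snd (f (c, p))), (fun q => snd (g (d, q))).
  assert (Fi : forall p, pset W (H c) p -> pset W (H' d) (snd (f (c, p)))).
  { intros p Hp. destruct (F _ (Tc p Hp)) as [_ Q]. rewrite (Fd p Hp) in Q at 1. exact Q. }
  assert (Gi : forall q, pset W (H' d) q -> pset W (H c) (snd (g (d, q)))).
  { intros q Hq. destruct (G _ (Td q Hq)) as [_ Q]. rewrite (Gc q Hq) in Q at 1. exact Q. }
  split; [exact Fi|]. split; [exact Gi|]. split; [|split].
  - intros p Hp. rewrite <- (Fd p Hp), GF; auto.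
  - intros q Hq. rewrite <- (Gc q Hq), FG; auto.
  - intros p q Hp Hq. rewrite <- (sadj_same V a W H'), <- (sadj_same V a W H).
    rewrite <- (Fd p Hp), <- (Fd q Hq). apply FA; auto.
Qed.

(* Vertices of the replacing graphs: unchanged vertices [wB], the [i]-th copy [wC v i] of a repeated
   vertex [v], and the [j]-th new leaf [wS k j] of the [k]-th inserted block. *)
Inductive wt (V : Type) := wB (v : V) | wC (v : V) (i : nat) | wS (k j : nat).
Arguments wB {V}. Arguments wC {V}. Arguments wS {V}.

Lemma enum_infinite {V} (idx : V -> nat) (idx_inj : forall x y, idx x = idx y -> x = y) (S : V -> Prop) :
  (forall n, exists x, S x /\ n <= idx x) ->
  exists e : nat -> V, (forall n, S (e n)) /\ (forall n m, e n = e m -> n = m) /\ forall x, S x -> exists n, e n = x.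
Proof.
  intros H.
  assert (Hl : forall n, exists x, (S x /\ n <= idx x) /\ forall y, S y /\ n <= idx y -> idx x <= idx y).
  { intros n. apply (least_element idx (fun x => S x /\ n <= idx x)). apply H. }
  destruct (choice_fun _ Hl) as [nx Hn].
  pose (e := fix e n := match n with 0 => nx 0 | Datatypes.S n => nx (Datatypes.S (idx (e n))) end).
  assert (E1 : forall n, S (e n)) by (intros [|n]; apply Hn).
  assert (E2 : inc (fun n => idx (e n))) by (intros n; cbn; apply Hn).
  exists e. split; [exact E1|]. split.
  - intros n m E. apply (inc_inj _ E2). now rewrite E.
  - intros x Sx. assert (G : forall n, (exists k, e k = x) \/ idx (e n) < idx x).
    { induction n as [|n [IH|IH]]; auto.
      - pose proof (proj2 (Hn 0) x (conj Sx (Nat.le_0_l _))) as L.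
        destruct (Nat.eq_dec (idx (nx 0)) (idx x)) as [E|E]; [left; exists 0; now apply idx_inj|right; cbn; lia].
      - pose proof (proj2 (Hn (Datatypes.S (idx (e n)))) x (conj Sx IH)) as L.
        destruct (Nat.eq_dec (idx (e (Datatypes.S n))) (idx x)) as [E|E];
          [left; exists (Datatypes.S n); now apply idx_inj|right; cbn in *; lia]. }
    destruct (G (idx x)) as [K|K]; auto. pose proof (inc_ge _ E2 (idx x)). cbn in *. lia.
Qed.

(** * Replacing a class whose root is a node *)

Section Rooted.
Variables (V : Type) (idx : V -> nat).
Hypothesis idx_inj : forall x y, idx x = idx y -> x = y.
Variable a : V -> V -> bool.
Hypothesis a_sym : forall x y, a x y = a y x.
Hypothesis a_irr : forall x, a x x = false.
Local Notation all := (fun _ : V => True).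
Hypothesis P4 : p4free a all.
Local Notation lt := (mlt a all).
Local Notation chd := (child a all).
Variable C : V -> Prop.
Hypothesis C_bad : bad V a C.
Hypothesis C_min : forall C', bad V a C' -> gemb a C' a C -> gemb a C a C'.

Variables (P : V -> Prop) (x y : V).
Hypothesis P_closed : closed a all P.
Hypothesis Px : P x.
Hypothesis Py : P y.
Hypothesis Nxy : x <> y.
Hypothesis P_root : forall z, P z -> ~ lt x y z.
Hypothesis P_le : gemb a P a C.
Hypothesis P_ge : gemb a C a P.

Let o := a x y.

(** The class is stripped of the leaves at its root, so that afterwards only the [n] added ones are
    there. *)
Definition core : V -> Prop := fun z => P z /\ ~ leaf a P o z.

Definition radj (p q : wt V) : bool :=
  match p, q with
  | wB u, wB v => a u v
  | wB _, wS _ _ => o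
  | wS _ _, wB _ => o
  | wS k j, wS k' j' => if Nat.eqb k k' then (if Nat.eqb j j' then false else o) else o
  | _, _ => false
  end.

Definition fset (n : nat) (Q : V -> Prop) (p : wt V) : Prop :=
  match p with wB u => Q u | wS k j => k = 0 /\ j < n | _ => False end.

Lemma root_pair_sub u v : P u -> P v -> u <> v -> incl (chd u v) P.
Proof. intros Pu Pv N. apply (chd_sub V a a_sym P4); auto. Qed.

(** A child with a second vertex [k'] contains a vertex that is not joined to [k] by the root label
    [o]. *)
Lemma child_not_leaf u v k k' : P u -> P v -> u <> v -> a u v = o -> chd u v k -> chd u v k' -> k' <> k -> ~ leaf a P o k.
Proof.
  intros Pu Pv N E Hk Hk' Nk [_ L].
  assert (Nuk : k <> u) by (eapply chd_neq; eauto).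
  assert (Ek : a k u = o) by (rewrite a_sym, (chd_adj_x V a a_sym P4 u v k); auto).
  assert (Sub := root_pair_sub u v Pu Pv N).
  assert (Pk' : P k') by auto.
  assert (Ec : chd u k = chd u v) by (apply (chd_eq V a a_sym P4); auto).
  rewrite <- Ec in Hk'. destruct Hk' as [_ [->|[[Q _]|[w [_ [Q1 Q2]]]]]]; [auto| |].
  - apply Q. rewrite Ek. auto.
  - assert (Nw : w <> k) by (intros ->; eapply (prec_x V a a_sym); eauto).
    assert (Pw : P w) by (apply Sub; rewrite <- Ec; split; auto; right; left; auto).
    destruct Q2 as [Q2 _]. apply Q2. rewrite Ek. auto.
Qed.

Section Cases.
Variable n : nat.

(** The bad child [K] embeds into [C], so [C] embeds into [K] by minimality, and thus [P] embeds
    into [K] by some [e]. Since [u] is joined to all of [K] by [o], its iterates under [e] are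
    joined by [o] to one another and to all deeper images of [P]; they serve as the [n] leaves. *)
Lemma absorb_bad u v : P u -> P v -> u <> v -> a u v = o -> ~ good a (chd u v) -> gemb radj (fset n P) a core.
Proof.
  intros Pu Pv N E G.
  set (K := chd u v) in *.
  assert (BK : bad V a K) by (split; [apply (chd_closed V a a_sym P4)|exact G]).
  assert (Sub : incl K P) by (apply root_pair_sub; auto).
  assert (Kc : incl K core).
  { intros k Hk. split; auto. destruct (bad_other V a K k BK Hk) as [k' [Hk' Nk]].
    eapply (child_not_leaf u v k k'); eauto. }
  assert (PK : gemb a P a K).
  { eapply gemb_trans; [exact P_le|]. apply C_min; auto. eapply gemb_trans; [apply gemb_incl; exact Sub|exact P_le]. }
  destruct PK as [e [E1 [E2 E3]]].
  assert (Nu : ~ K u) by (apply (chd_not V a); auto).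
  assert (Eu : forall k, K k -> a u k = o).
  { intros k Hk. rewrite <- E. apply (chd_adj_x V a a_sym P4); auto. }
  pose (it m z := Nat.iter m e z).
  assert (I1 : forall m z, P z -> P (it m z)).
  { induction m as [|m IH]; intros z Pz; [exact Pz|]. apply Sub, E1, IH, Pz. }
  assert (I2 : forall m z, P z -> K (it (S m) z)) by (intros m z Pz; apply E1, I1, Pz).
  assert (I3 : forall m z w, P z -> P w -> it m z = it m w -> z = w).
  { induction m as [|m IH]; intros z w Pz Pw Q; [exact Q|]. apply IH; [exact Pz|exact Pw|]. apply E2; auto. }
  assert (I4 : forall m z w, P z -> P w -> a (it m z) (it m w) = a z w).
  { induction m as [|m IH]; intros z w Pz Pw; [reflexivity|].
    change (a (e (it m z)) (e (it m w)) = a z w). rewrite E3; auto. }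
  assert (I5 : forall m k z, it (m + k) z = it m (it k z)) by (intros; apply Nat.iter_add).
  assert (J1 : forall m k z, P z -> m < k -> a (it m u) (it k z) = o /\ it m u <> it k z).
  { intros m k z Pz L. replace k with (m + S (k - m - 1)) by lia. rewrite I5. split.
    - rewrite I4; auto.
    - intros Q. apply I3 in Q; auto. apply Nu. rewrite Q. auto. }
  exists (fun p => match p with wB z => it (S n) z | wC z _ => z | wS _ j => it (S j) u end).
  split; [|split].
  - intros [z|z i|k j]; cbn [fset]; [intros Pz; apply Kc, I2, Pz|tauto|]. intros _. apply Kc, I2, Pu.
  - intros [z|z i|k j] [z'|z' i'|k' j']; cbn [fset]; try tauto.
    + intros Pz Pz' Q. f_equal. eapply (I3 (S n)); eauto.
    + intros Pz [-> L] Q. exfalso. eapply (proj2 (J1 (S j') (S n) z Pz ltac:(lia))); eauto.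
    + intros [-> L] Pz Q. exfalso. eapply (proj2 (J1 (S j) (S n) z' Pz ltac:(lia))); eauto.
    + intros [-> L] [-> L'] Q. f_equal. destruct (lt_eq_lt_dec j j') as [[Lj|Lj]|Lj]; auto; exfalso.
      * eapply (proj2 (J1 (S j) (S j') u Pu ltac:(lia))); eauto.
      * eapply (proj2 (J1 (S j') (S j) u Pu ltac:(lia))); eauto.
  - intros [z|z i|k j] [z'|z' i'|k' j']; cbn [fset radj]; try tauto.
    + intros Pz Pz'. apply I4; auto.
    + intros Pz [-> L]. rewrite a_sym. apply (J1 (S j') (S n) z); auto; lia.
    + intros [-> L] Pz. apply (J1 (S j) (S n) z'); auto; lia.
    + intros [-> L] [-> L']. cbn [Nat.eqb]. destruct (Nat.eqb_spec j j') as [->|Nj]; [apply a_irr|].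
      destruct (lt_eq_lt_dec j j') as [[Lj|Lj]|Lj]; [apply (J1 (S j) (S j') u); auto; lia|lia|].
      rewrite a_sym. apply (J1 (S j') (S j) u); auto; lia.
Qed.

Lemma sum_embeds {W I J} (b : W -> W -> bool) (F : W -> Prop) (Q : J -> V -> Prop) (R : V -> Prop)
  (kap : W -> I) (s : I -> J) :
  (forall u v, F u -> F v -> kap u <> kap v -> b u v = o) ->
  (forall i j u v, i <> j -> Q i u -> Q j v -> a u v = o /\ u <> v) ->
  (forall i, incl (Q i) R) -> (forall i j, s i = s j -> i = j) ->
  (forall i, (exists u, F u /\ kap u = i) -> gemb b (fun u => F u /\ kap u = i) a (Q (s i))) ->
  (exists v : V, True) -> gemb b F a R.
Proof.
  intros H1 H2 H3 H4 H5 [v0 _].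
  assert (Hf : forall i, exists f : W -> V, (forall u, F u -> kap u = i -> Q (s i) (f u)) /\
     (forall u v, F u -> F v -> kap u = i -> kap v = i -> f u = f v -> u = v) /\
     (forall u v, F u -> F v -> kap u = i -> kap v = i -> a (f u) (f v) = b u v)).
  { intros i. destruct (classic (exists u, F u /\ kap u = i)) as [Hi|Hi].
    - destruct (H5 i Hi) as [f [F1 [F2 F3]]]. exists f. split; [|split]; intros; auto.
    - exists (fun _ => v0). split; [|split]; intros; exfalso; eauto. }
  destruct (choice_fun _ Hf) as [f Hfs].
  exists (fun u => f (kap u) u).
  assert (G : forall u, F u -> Q (s (kap u)) (f (kap u) u)) by (intros u Fu; now apply Hfs).
  split; [|split].
  - intros u Fu. eapply H3; eauto.
  - intros u v Fu Fv E. destruct (classic (kap u = kap v)) as [Ek|Nk].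
    + rewrite <- Ek in E. apply (Hfs (kap u)); auto.
    + exfalso. eapply (proj2 (H2 (s (kap u)) (s (kap v)) _ _ ltac:(intros K; apply Nk, H4, K) (G u Fu) (G v Fv))); eauto.
  - intros u v Fu Fv. destruct (classic (kap u = kap v)) as [Ek|Nk].
    + rewrite <- Ek. apply (Hfs (kap u)); auto.
    + rewrite H1 by auto. apply (H2 (s (kap u)) (s (kap v))); auto.
Qed.

Lemma top_pair r : P r -> r <> x -> ~ lt x r y -> a x r = o.
Proof. intros Pr N L. unfold o. apply (mlt_eq_adj V a all a_sym); auto. Qed.

(** All one-vertex children together are homogeneous, so only the finitely many larger children have
    to be added one at a time. [K] will be the child containing [x]. *)
Lemma top_good (tops : V -> Prop) (K : V -> Prop) :
  (forall r, tops r -> isrep V idx a x r /\ a x r = o) ->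
  (forall r u, tops r -> K u -> forall v, chd x r v -> a u v = o) ->
  good a K -> (forall r, tops r -> good a (chd x r)) ->
  (exists m, forall r, tops r -> (exists u, chd x r u /\ u <> r) -> idx r < m) ->
  good a (fun u => K u \/ exists r, tops r /\ chd x r u).
Proof.
  intros H1 H2 GK GT [m Hm].
  assert (Cross : forall r r' u v, tops r -> tops r' -> r <> r' -> chd x r u -> chd x r' v -> a u v = o).
  { intros r r' u v T T' N Hu Hv. destruct (H1 r T) as [R E]. destruct (H1 r' T') as [R' E'].
    destruct (slt_tot V idx idx_inj a x r r') as [Q|[L|L]]; [contradiction| |].
    - rewrite (skel_adj V idx idx_inj a a_sym P4 x r r' u v); auto.
    - rewrite a_sym, (skel_adj V idx idx_inj a a_sym P4 x r' r v u); auto. }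
  pose (Q k := fun u => K u \/ (exists r, tops r /\ u = r /\ forall v, chd x r v -> v = r) \/
                 exists r, tops r /\ idx r < k /\ chd x r u).
  assert (GQ : forall k, good a (Q k)).
  { induction k as [|k IH].
    - apply (good_union a _ K (fun u => exists r, tops r /\ u = r /\ forall v, chd x r v -> v = r) o); auto.
      + apply (good_hom a _ o). intros u v [r [T [-> _]]] [r' [T' [-> _]]] N. apply (Cross r r'); auto using chd_self.
      + intros u v Ku [r [T [-> _]]]. apply (H2 r); auto using chd_self.
      + intros u [Ku|[Hu|[r [_ [L _]]]]]; [auto|auto|lia].
    - destruct (classic (exists r, tops r /\ idx r = k)) as [[r [T E]]|N].
      + destruct (classic (forall v, chd x r v -> v = r)) as [Tr|Tr].
        * apply (good_incl a _ (Q k)); auto. intros u [Ku|[Hu|[r' [T' [L Hu]]]]]; [left; auto|right; left; auto|].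
          destruct (Nat.eq_dec (idx r') k) as [E'|E']; [|right; right; exists r'; split; auto; split; [lia|auto]].
          assert (r' = r) by (apply idx_inj; lia). subst r'. right; left. exists r. auto.
        * apply (good_union a _ (fun u => Q k u /\ ~ chd x r u) (chd x r) o).
          -- apply (good_incl a _ (Q k)); auto. intros u [Hu _]; auto.
          -- auto.
          -- intros u v [[Ku|[[r' [T' [-> Tr']]]|[r' [T' [L Hu]]]]] Nu] Hv.
             ++ apply (H2 r); auto.
             ++ apply (Cross r' r); auto using chd_self. intros ->. apply Nu, chd_self.
             ++ apply (Cross r' r); auto. intros ->. auto.
          -- intros u Hu. destruct (classic (chd x r u)) as [Hc|Hc]; [auto|left]. split; auto.
             destruct Hu as [Ku|[Hu|[r' [T' [L Hu]]]]]; [left; auto|right; left; auto|].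
             right; right. exists r'. split; auto. split; auto.
             assert (idx r' <> k) by (intros E'; apply Hc; replace r with r'; auto; apply idx_inj; lia). lia.
      + apply (good_incl a _ (Q k)); auto. intros u [Ku|[Hu|[r' [T' [L Hu]]]]]; [left; auto|right; left; auto|].
        right; right. exists r'. split; auto. split; auto. assert (idx r' <> k) by (intros E; eauto). lia. }
  apply (good_incl a _ (Q m)); auto. intros u [Ku|[r [T Hu]]]; [left; auto|].
  destruct (classic (exists v, chd x r v /\ v <> r)) as [Hv|Hv].
  - right; right. exists r. auto.
  - right; left. exists r. split; auto. split; [apply NNPP; intros N; apply Hv; eauto|].
    intros v Hv'. apply NNPP; intros N. apply Hv; eauto.
Qed.

(** As [P] is not good although all its children are, infinitely many children have more than one
    vertex. By recurrence all but finitely many of these embed into infinitely many others, so they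
    can be moved apart, and the summands set free absorb the old leaves and the new ones. *)
Lemma absorb_good : (forall u v, P u -> P v -> u <> v -> a u v = o -> good a (chd u v)) -> gemb radj (fset n P) a core.
Proof.
  intros HG.
  (* The child of the root containing [x]; the top level of the chain around [x] lists only the
     others. *)
  set (K := chd y x).
  pose (tops r := skel V idx a x P r /\ ~ lt x r y).
  assert (To : forall r, tops r -> a x r = o) by (intros r [[Pr [N _]] L]; now apply top_pair).
  assert (Tn : forall r, tops r -> r <> x) by (intros r [[_ [N _]] _]; auto).
  assert (TP : forall r, tops r -> P r) by (intros r [[H _] _]; auto).
  assert (Kc : closed a all K) by (apply (chd_closed V a a_sym P4)).
  assert (Kx : K x) by apply chd_self.
  assert (Ky : ~ K y) by (apply (chd_not V a); auto).
  assert (NK : forall r v, tops r -> chd x r v -> ~ K v).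
  { intros r v T Hv Kv. destruct T as [[Pr [N _]] L]. apply L.
    assert (Nv : v <> x) by (eapply chd_neq; eauto).
    assert (Kr : K r); [|destruct Kr as [_ [->|Q]]; [congruence|exact Q]].
    destruct (closed_nested V a all a_sym P4 K (chd x r) v) as [I|I]; auto using chd_closed.
    - exfalso. apply (chd_not V a a_sym x r); auto.
    - apply I, chd_self. }
  assert (KT : forall r u v, tops r -> K u -> chd x r v -> a u v = o).
  { intros r u v T Ku Hv. rewrite (closed_adj V a all a_sym P4 K u x v); eauto.
    rewrite (chd_adj_x V a a_sym P4 x r v); auto. }
  assert (Cov : forall z, P z -> K z \/ exists r, tops r /\ chd x r z).
  { intros z Pz. destruct (classic (K z)) as [Kz|Nz]; [auto|right].
    assert (Nzx : z <> x) by (intros ->; auto).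
    destruct (skel_of V idx a a_sym P4 P x z P_closed Px Pz Nzx) as [r [Sr Hr]]. exists r. split; auto.
    split; auto. intros L. apply Nz.
    assert (Kr : K r) by (split; auto). assert (Nr : r <> x) by apply Sr.
    apply (mm_least V a all K x r); auto. apply child_sub_mm; auto. }
  assert (TT : forall r r' u v, tops r -> tops r' -> r <> r' -> chd x r u -> chd x r' v -> a u v = o).
  { intros r r' u v T T' N Hu Hv.
    destruct (slt_tot V idx idx_inj a x r r') as [Q|[L|L]]; [contradiction| |].
    - rewrite (skel_adj V idx idx_inj a a_sym P4 x r r' u v); auto; [apply T|apply T'].
    - rewrite a_sym, (skel_adj V idx idx_inj a a_sym P4 x r' r v u); auto; [apply T'|apply T]. }
  assert (Disj : forall r r' u, tops r -> tops r' -> chd x r u -> chd x r' u -> r = r').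
  { intros r r' u T T'. apply (rep_unique V idx idx_inj a a_sym P4 x r r' u); [apply T|apply T']. }
  pose (big r := tops r /\ exists u, chd x r u /\ u <> r).
  assert (Binf : forall m, exists r, big r /\ m <= idx r).
  { intros m. apply NNPP; intros H. apply (proj2 C_bad).
    apply (good_emb a C a P); auto. apply (good_incl a P (fun u => K u \/ exists r, tops r /\ chd x r u)).
    { intros z Pz. now apply Cov. }
    apply top_good.
    - intros r T. split; [apply T|auto].
    - intros r u T Ku v Hv. exact (KT r u v T Ku Hv).
    - apply HG; auto.
    - intros r T. apply HG; auto. apply not_eq_sym; auto.
    - exists m. intros r T Hr. destruct (le_lt_dec m (idx r)) as [L|L]; auto. exfalso. apply H. exists r.
      split; [split; auto|auto]. }
  destruct (enum_infinite idx idx_inj big Binf) as [e [E1 [E2 E3]]].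
  assert (Ec : forall k, incl (chd x (e k)) core).
  { intros k u Hu. destruct (E1 k) as [T [v [Hv Nv]]]. split; [eapply (root_pair_sub x (e k)); eauto; apply not_eq_sym; auto|].
    assert (exists w, chd x (e k) w /\ w <> u) as [w [Hw Nw]].
    { destruct (classic (u = e k)) as [->|N]; [eauto|]. exists (e k). split; [apply chd_self|auto]. }
    eapply (child_not_leaf x (e k) u w); eauto; apply not_eq_sym; auto. }
  destruct (bqo_recurrent gle (fun k => code V idx idx_inj a (chd x (e k))) gle_bqo) as [K0 HK0].
  assert (Hem : forall p : nat * nat, exists l, snd p <= l /\ gemb a (chd x (e (K0 + fst p))) a (chd x (e l))).
  { intros [k m]. cbn. destruct (HK0 (K0 + k)) with (m := m) as [l [L Hl]]; [lia|]. exists l. split; auto.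
    destruct (code_le V idx idx_inj a a_sym a_irr _ _ (chd_inh V a x _) (chd_inh V a x _) Hl) as [[_ [_ Q]]|[Q _]]; auto.
    exfalso. apply Q. destruct (E1 (K0 + k)) as [T _]. apply HG; auto. apply not_eq_sym; auto. }
  destruct (choice_fun _ Hem) as [g Hg].
  (* Slot [m] is large enough for child number [K0 + m / 2]: the even slots take the children from
     [K0] on, the odd ones are set aside for leaves. *)
  pose (jj := fix jj m := match m with 0 => g (0, K0) | S m => g (Nat.div2 (S m), S (jj m)) end).
  assert (J1 : forall m, gemb a (chd x (e (K0 + Nat.div2 m))) a (chd x (e (jj m)))).
  { intros [|m]; [apply (Hg (0, K0))|apply (Hg (Nat.div2 (S m), S (jj m)))]. }
  assert (J2 : inc jj).
  { intros m. destruct (Hg (Nat.div2 (S m), S (jj m))) as [L _]. cbn [snd] in L. exact L. }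
  assert (J3 : forall m, K0 <= jj m).
  { intros m. apply Nat.le_trans with (jj 0); [apply (Hg (0, K0))|]. apply inc_le; auto; lia. }
  assert (Hk : forall z, exists k, P z -> ~ leaf a P o z -> ~ K z -> chd x (e k) z).
  { intros z. destruct (classic (P z /\ ~ leaf a P o z /\ ~ K z)) as [[Pz [Lz Nz]]|H]; [|exists 0; tauto].
    destruct (Cov z Pz) as [Kz|[r [T Hr]]]; [contradiction|].
    assert (Br : big r).
    { split; auto. apply NNPP; intros H. assert (z = r) by (apply NNPP; intros N; apply H; eauto). subst z.
      apply Lz. split; auto. intros u Pu N. destruct (Cov u Pu) as [Ku|[r' [T' Hr']]].
      - rewrite a_sym. eapply KT; eauto.
      - destruct (classic (r' = r)) as [->|N']; [exfalso; apply H; eauto|]. apply (TT r r'); auto. }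
    destruct (E3 r Br) as [k <-]. exists k. auto. }
  destruct (choice_fun _ Hk) as [kk Hkk].
  (* Old leaves get even numbers and new leaves odd numbers. *)
  pose (kap (p : wt V) := match p with
    | wB z => if excluded_middle_informative (leaf a P o z) then inr (2 * idx z)
              else if excluded_middle_informative (K z) then inl None else inl (Some (kk z))
    | wC z _ => inl None
    | wS _ j => inr (2 * j + 1) end : option nat + nat).
  pose (s (i : option nat + nat) := match i with
    | inl None => None
    | inl (Some k) => Some (if k <? K0 then k else jj (2 * (k - K0)))
    | inr m => Some (jj (2 * m + 1)) end).
  pose (Q (j : option nat) := match j with None => fun z => K z /\ core z | Some k => chd x (e k) end).
  assert (Hcls : forall z, P z ->
     (leaf a P o z /\ kap (wB z) = inr (2 * idx z)) \/
     (~ leaf a P o z /\ K z /\ kap (wB z) = inl None) \/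
     (~ leaf a P o z /\ ~ K z /\ kap (wB z) = inl (Some (kk z)) /\ chd x (e (kk z)) z)).
  { intros z Pz. cbn. destruct (excluded_middle_informative (leaf a P o z)) as [Lz|Lz]; [left; auto|right].
    destruct (excluded_middle_informative (K z)) as [Kz|Kz]; [left; auto|right]. auto. }
  apply (sum_embeds radj (fset n P) Q core kap s).
  - intros [u|u i|k j] [v|v i'|k' j'] Fu Fv N; cbn [fset] in Fu, Fv; try tauto; cbn [radj]; auto.
    + destruct (Hcls u Fu) as [[Lu Eu]|[[Lu [Ku Eu]]|[Lu [Ku [Eu Cu]]]]].
      * apply Lu; auto. intros ->. auto.
      * destruct (Hcls v Fv) as [[Lv Ev]|[[Lv [Kv Ev]]|[Lv [Kv [Ev Cv]]]]].
        -- rewrite a_sym. apply Lv; auto. intros ->. auto.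
        -- congruence.
        -- eapply (KT (e (kk v))); eauto. apply E1.
      * destruct (Hcls v Fv) as [[Lv Ev]|[[Lv [Kv Ev]]|[Lv [Kv [Ev Cv]]]]].
        -- rewrite a_sym. apply Lv; auto. intros ->. auto.
        -- rewrite a_sym. eapply (KT (e (kk u))); eauto. apply E1.
        -- apply (TT (e (kk u)) (e (kk v))); try apply E1; auto. intros E. apply E2 in E. congruence.
    + destruct Fu as [-> _], Fv as [-> _]. cbn. destruct (Nat.eqb_spec j j') as [->|]; congruence.
  - assert (G : forall k z w, K z -> chd x (e k) w -> a z w = o /\ z <> w).
    { intros k z w Kz Hw. destruct (E1 k) as [T _]. split; [eapply KT; eauto|]. intros ->. eapply NK; eauto. }
    intros [i|] [j|] u v N Hu Hv; cbn in Hu, Hv.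
    + destruct (E1 i) as [Ti _]. destruct (E1 j) as [Tj _].
      assert (Ne : e i <> e j) by (intros E; apply E2 in E; congruence).
      split; [apply (TT (e i) (e j)); auto|]. intros ->. apply Ne. eapply Disj; eauto.
    + destruct (G i v u) as [G1 G2]; [apply Hv|auto|]. rewrite a_sym. auto.
    + destruct (G j u v) as [G1 G2]; [apply Hu|auto|]. auto.
    + congruence.
  - intros [i|]; cbn; [apply Ec|]. intros z [_ Hz]; auto.
  - intros [[i|]|i] [[j|]|j]; cbn [s]; intros E; try discriminate; auto; injection E as E.
    + f_equal. f_equal. destruct (Nat.ltb_spec i K0), (Nat.ltb_spec j K0); auto.
      * match type of E with context [jj ?m] => pose proof (J3 m) end; lia.
      * match type of E with context [jj ?m] => pose proof (J3 m) end; lia.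
      * apply (inc_inj jj J2) in E. lia.
    + exfalso. destruct (Nat.ltb_spec i K0); [match type of E with context [jj ?m] => pose proof (J3 m) end; lia|]. apply (inc_inj jj J2) in E. lia.
    + exfalso. destruct (Nat.ltb_spec j K0); [match type of E with context [jj ?m] => pose proof (J3 m) end; lia|]. apply (inc_inj jj J2) in E. lia.
    + f_equal. apply (inc_inj jj J2) in E. lia.
  - intros i _.
    assert (Kl : forall z m, kap (wB z) = inr m -> leaf a P o z /\ m = 2 * idx z).
    { intros z m. cbn. destruct (excluded_middle_informative (leaf a P o z)); [intros E; injection E; auto|].
      destruct (excluded_middle_informative (K z)); discriminate. }
    assert (Kn : forall z j, P z -> kap (wB z) = inl j -> match j with None => K z /\ core z | Some k => chd x (e k) z end).
    { intros z j Pz E. destruct (Hcls z Pz) as [[_ E']|[[Lz [Kz E']]|[Lz [Kz [E' Cz]]]]]; rewrite E in E'; try discriminate;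
        injection E' as ->; [split; [auto|split; auto]|auto]. }
    destruct i as [j|m].
    + apply (gemb_trans _ _ a (match j with None => fun z => K z /\ core z | Some k => chd x (e k) end)).
      * exists (fun p => match p with wB z => z | _ => x end). split; [|split].
        -- intros [z|z i|k l] [F E]; cbn in F; [|tauto|cbn in E; discriminate].
           specialize (Kn z j F E). destruct j; auto.
        -- intros [z|z i|k l] [z'|z' i'|k' l'] [F E] [F' E'] Eq; cbn in F, F'; try tauto; try (cbn in E, E'; discriminate).
           congruence.
        -- intros [z|z i|k l] [z'|z' i'|k' l'] [F E] [F' E']; cbn in F, F'; try tauto; try (cbn in E, E'; discriminate).
      * destruct j as [k|]; [|apply gemb_refl].
        change (gemb a (chd x (e k)) a (chd x (e (if k <? K0 then k else jj (2 * (k - K0)))))).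
        destruct (Nat.ltb_spec k K0) as [L|L]; [apply gemb_refl|].
        pose proof (J1 (2 * (k - K0))) as Q'. rewrite Nat.div2_double in Q'. now replace (K0 + (k - K0)) with k in Q' by lia.
    + exists (fun _ => e (jj (2 * m + 1))).
      assert (One : forall p q, fset n P p -> fset n P q -> kap p = inr m -> kap q = inr m -> p = q).
      { intros [z|z i|k l] [z'|z' i'|k' l'] F F' E E'; cbn in F, F'; try tauto.
        - apply Kl in E, E'. f_equal. apply idx_inj. lia.
        - apply Kl in E. cbn in E'. injection E' as E'. lia.
        - apply Kl in E'. cbn in E. injection E as E. lia.
        - cbn in E, E'. injection E as E. injection E' as E'. destruct F as [-> _], F' as [-> _]. f_equal. lia. }
      split; [intros p _; apply chd_self|]. split; [intros p q [F E] [F' E'] _; auto|].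
      intros p q [F E] [F' E']. rewrite (One p q F F' E E'), a_irr. symmetry.
      destruct q as [z|z i|k l]; cbn; auto. now rewrite !Nat.eqb_refl.
  - exists x; auto.
Qed.

End Cases.

Lemma rooted_piece n : 1 <= n -> exists k, piece_ok V a C (wt V) P k /\ inv n (padj _ k) (pset _ k).
Proof.
  intros Hn.
  assert (Habs : gemb radj (fset n P) a core).
  { destruct (classic (exists u v, P u /\ P v /\ u <> v /\ a u v = o /\ ~ good a (chd u v)))
      as [[u [v [Pu [Pv [N [E G]]]]]]|H].
    - now apply (absorb_bad n u v).
    - apply absorb_good. intros u v Pu Pv N E. apply NNPP; intros G. apply H. exists u, v. auto. }
  assert (HPc : gemb a P a core).
  { eapply gemb_trans; [|exact Habs]. exists wB. split; [auto|]. split; [|auto]. intros u v _ _ E. now injection E. }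
  assert (HcT : gemb a core radj (fset n core)).
  { exists wB. split; [auto|]. split; [|auto]. intros u v _ _ E. now injection E. }
  assert (HTP : gemb radj (fset n core) a P).
  { eapply gemb_trans; [apply gemb_incl|eapply gemb_trans; [exact Habs|apply gemb_incl]].
    - intros [u|u i|k j]; cbn; auto. intros [H _]; auto.
    - intros u [H _]; auto. }
  assert (Hc0 : exists u, core u) by (destruct HPc as [f [F _]]; exists (f x); auto).
  assert (Hop : forall q, top radj (fset n core) q -> q = o).
  { intros q [p1 [p2 [T1 [T2 [N [E H]]]]]]. apply NNPP; intros Q.
    (* A new leaf is joined to everything by [o], so it separates any pair with the other
       adjacency. *)
    apply (H (wS 0 0)); [cbn; lia|]. destruct p1 as [u|u i|k j], p2 as [v|v i'|k' j']; cbn in *; try tauto; try congruence.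
    - split; cbn; congruence.
    - destruct T1 as [-> _], T2 as [-> _]. cbn in E. destruct (Nat.eqb_spec j j'); congruence. }
  exists (Piece _ radj (fset n core)). split; [split; cbn [padj pset]|left; split; cbn [padj pset]].
  - eapply gemb_trans; eauto.
  - exact HTP.
  - intros q Tq. rewrite (Hop q Tq). exists x, y. split; auto. split; auto. split; auto. split; [reflexivity|].
    intros w Pw Q. apply (P_root w Pw). left; auto.
  - intros p q Hp Hq N. eapply gemb_trans; [apply gemb_incl; intros z [Hz _]; exact Hz|]. eapply gemb_trans; eauto.
  - destruct Hc0 as [u Hu]. exists o, (wS 0 0), (wB u). cbn. split; [lia|]. split; auto. split; [discriminate|].
    split; auto. intros [w|w i|k j] Hw [Q1 Q2]; cbn in *; tauto.
  - intros q Tq. rewrite (Hop q Tq). exists (map (wS 0) (seq 0 n)). split; [|split].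
    + apply FinFun.Injective_map_NoDup; [intros i j E; now injection E|apply seq_NoDup].
    + now rewrite length_map, length_seq.
    + intros p. rewrite in_map_iff. split.
      * intros [Hp Hl]. destruct p as [u|u i|k j]; cbn in Hp; [|tauto|].
        -- exfalso. destruct Hp as [Pu Nl]. apply Nl. split; auto. intros v Pv Nv. apply NNPP; intros Q.
           assert (Cv : core v).
           { split; auto. intros [_ K]. apply Q. rewrite a_sym. apply K; auto. }
           apply Q. apply (Hl (wB v) Cv). intros E. injection E; auto.
        -- destruct Hp as [-> L]. exists j. split; auto. apply in_seq. lia.
      * intros [j [<- Hj]]. apply in_seq in Hj. split; [cbn; lia|].
        intros [v|v i|k' j'] Hu N; cbn in *; auto; [tauto|]. destruct Hu as [-> _]. cbn.
        destruct (Nat.eqb_spec j j'); congruence.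
Qed.

End Rooted.

Lemma p4free_emb {V W} (a : V -> V -> bool) S (b : W -> W -> bool) T : gemb b T a S -> p4free a S -> p4free b T.
Proof.
  intros [f [F1 [F2 F3]]] H p q r s Hp Hq Hr Hs. rewrite <- !F3 by auto. apply H; auto.
Qed.

Lemma mlt_emb {V W} (a : V -> V -> bool) (S : V -> Prop) (b : W -> W -> bool) (T : W -> Prop) (f : W -> V) p q r :
  (forall x, T x -> S (f x)) -> (forall x y, T x -> T y -> a (f x) (f y) = b x y) ->
  T p -> T q -> T r -> mlt b T p q r -> mlt a S (f p) (f q) (f r).
Proof.
  intros F1 F3 Hp Hq Hr [[H1 H2]|[w [Hw [[H1 H2] [H3 H4]]]]].
  - left. split; rewrite !F3; auto.
  - right. exists (f w). split; auto. split; split; rewrite !F3; auto.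
Qed.

(** [mem z i] is the [i]-th member of the block of [z], and [off z] the position of [z] in it. The
    elements at position [0] count the blocks. *)
Lemma blocks_divide {T} (n : nat) (off : T -> nat) (mem : T -> nat -> T) (l : list T) : NoDup l ->
  (forall z, In z l -> off z < n /\ mem z (off z) = z /\ forall i, i < n ->
     In (mem z i) l /\ off (mem z i) = i /\ forall j, mem (mem z i) j = mem z j) ->
  Nat.divide n (length l).
Proof.
  intros Nl H. set (K := filter (fun z => off z =? 0) l).
  assert (HK : forall z, In z K <-> In z l /\ off z = 0) by (intros z; unfold K; rewrite filter_In, Nat.eqb_eq; tauto).
  assert (NK : NoDup K) by now apply NoDup_filter.
  set (L := map (fun p => mem (fst p) (snd p)) (list_prod K (seq 0 n))).
  assert (HL : forall z, In z L <-> In z l).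
  { intros z. unfold L. rewrite in_map_iff. split.
    - intros [[w i] [<- Hp]]. apply in_prod_iff in Hp. destruct Hp as [Hw Hi]. apply in_seq in Hi. apply HK in Hw.
      exact (proj1 (proj2 (proj2 (H w (proj1 Hw))) i ltac:(lia))).
    - intros Hz. destruct (H z Hz) as [L1 [E1 H1]]. exists (mem z 0, off z). cbn. destruct (H1 0) as [M1 [M2 M3]]; [lia|].
      split; [congruence|]. apply in_prod_iff. split; [now apply HK|]. apply in_seq. lia. }
  assert (NL : NoDup L).
  { assert (Np : forall K' : list T, NoDup K' -> NoDup (list_prod K' (seq 0 n))).
    { induction K' as [|w K' IH]; intros N'; cbn; [constructor|]. inversion N'; subst. apply NoDup_app.
      - apply Injective_map_NoDup; [intros i j E; congruence|apply seq_NoDup].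
      - auto.
      - intros [w' i] Hi Hj. apply in_map_iff in Hi. destruct Hi as [i' [E _]]. apply in_prod_iff in Hj. destruct Hj.
        congruence. }
    apply Injective_map_NoDup_in; [|auto]. intros [w i] [w' i'] Hp Hp'. cbn. apply in_prod_iff in Hp, Hp'.
    destruct Hp as [Hw Hi], Hp' as [Hw' Hi']. apply in_seq in Hi, Hi'. apply HK in Hw, Hw'.
    destruct Hw as [Hw O], Hw' as [Hw' O']. intros E.
    destruct (H w Hw) as [_ [Q1 Q2]]. destruct (H w' Hw') as [_ [Q1' Q2']].
    destruct (Q2 i) as [_ [A1 A2]]; [lia|]. destruct (Q2' i') as [_ [A1' A2']]; [lia|].
    rewrite O in Q1. rewrite O' in Q1'. f_equal; [|congruence]. rewrite <- Q1, <- Q1', <- A2, <- A2'. congruence. }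
  exists (length K). transitivity (length L).
  - apply Nat.le_antisymm; apply NoDup_incl_length; auto; intros z; apply HL.
  - unfold L. now rewrite length_map, length_prod, length_seq.
Qed.

(** * Replacing a class that is an increasing union of smaller strong modules *)

Section Limit.
Variables (V : Type) (idx : V -> nat).
Hypothesis idx_inj : forall x y, idx x = idx y -> x = y.
Variable a : V -> V -> bool.
Hypothesis a_sym : forall x y, a x y = a y x.
Hypothesis a_irr : forall x, a x x = false.
Local Notation all := (fun _ : V => True).
Hypothesis P4 : p4free a all.
Local Notation lt := (mlt a all).
Local Notation chd := (child a all).
Variable C : V -> Prop.
Hypothesis C_min : forall C', bad V a C' -> gemb a C' a C -> gemb a C a C'.

Variables (P : V -> Prop) (x : V).
Hypothesis P_closed : closed a all P.
Hypothesis Px : P x.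
Hypothesis P_two : exists y, P y /\ y <> x.
Hypothesis P_limit : forall u v, P u -> P v -> u <> v -> exists z, P z /\ lt u v z.
Hypothesis P_small : forall u v, P u -> P v -> u <> v -> gemb a (mm a all u v) a C.

Local Notation vw := (view V idx idx_inj a a_sym P4 x).
Local Notation sk := (skel V idx a x P).

Lemma lt_cot u v w : lt x u w -> lt x u v \/ lt x v w.
Proof. apply mlt_cotrans; auto. Qed.

Lemma lt_tr u v w : lt x u v -> lt x v w -> lt x u w.
Proof. apply mlt_trans; auto. Qed.

Lemma lt_neq u v : lt x u v -> v <> x.
Proof. intros H ->. eapply mlt_x; eauto. Qed.

(** The label [Star] does not describe bad children, but minimality does: every child inside [P]
    embeds into [C], and [C] embeds into every bad one. *)
Lemma sk_label r r' : sk r -> sk r' -> lle (clab vw r) (clab vw r') -> gemb a (chd x r) a (chd x r').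
Proof.
  intros Hr Hr' [_ H]. cbn in H.
  destruct (code_le V idx idx_inj a a_sym a_irr _ _ (chd_inh V a x r) (chd_inh V a x r') H) as [[_ [_ G]]|[G G']]; auto.
  destruct Hr as [Pr [N _]], Hr' as [Pr' [N' _]].
  assert (Le : forall q, P q -> q <> x -> gemb a (chd x q) a C).
  { intros q Pq Nq. eapply gemb_trans; [|apply (P_small x q); auto]. apply gemb_incl. apply child_sub_mm; auto. }
  eapply gemb_trans; [apply Le; auto|]. apply C_min; auto. split; auto. now apply chd_closed.
Qed.

Lemma above2 u v : P u -> P v -> u <> x -> v <> x -> exists z, P z /\ lt x u z /\ lt x v z.
Proof.
  intros Pu Pv Nu Nv. destruct (P_limit x u) as [z1 [Pz1 L1]]; auto.
  destruct (P_limit x v) as [z2 [Pz2 L2]]; auto.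
  destruct (classic (lt x v z1)) as [L|L]; [eauto|].
  destruct (lt_cot v z1 z2 L2) as [Q|Q]; [contradiction|]. exists z2. split; auto. split; auto. eapply lt_tr; eauto.
Qed.

Lemma other_op z : P z -> z <> x -> exists p, P p /\ lt x z p /\ a x p <> a x z.
Proof.
  intros Pz N. destruct (P_limit x z) as [z1 [Pz1 L]]; auto.
  destruct L as [L|[w [_ [W1 W2]]]].
  - exists z1. split; auto. split; [left; auto|]. destruct L; auto.
  - exists w. split; [|split; [left; auto|destruct W1; auto]].
    apply (mm_least V a all P x z1); auto.
    + apply not_eq_sym. eapply lt_neq. right. exists w. eauto.
    + split; auto. apply mlt_asym; auto. left; auto.
Qed.

Definition seg (s : nat -> V) (k : nat) : V -> Prop := fun r => sk r /\ ~ lt x r (s k) /\ lt x r (s (S k)).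

Lemma chd_lt r u z : r <> x -> chd x r u -> (lt x u z <-> lt x r z).
Proof.
  assert (G : forall r u z, r <> x -> chd x r u -> lt x r z -> lt x u z).
  { intros r' u' z' N Hu L. destruct (lt_cot r' u' z' L) as [Q|Q]; auto. exfalso.
    apply (child_sub_mm V a all a_sym P4 x r' I I (not_eq_sym N) u' Hu); auto. }
  intros N Hu. split; intros L; [|exact (G r u z N Hu L)].
  assert (Nu : u <> x) by (eapply chd_neq; eauto).
  apply (G u r z); auto. rewrite (chd_eq V a a_sym P4 x r u); auto. apply chd_self.
Qed.

(** Each step passes a vertex whose label is opposite to that of [s k], so every segment shows both
    labels; it also overtakes the vertex of index [k], for cofinality. *)
Lemma sequence_exists : exists s : nat -> V,
  (forall k, P (s k) /\ s k <> x) /\ (forall k, lt x (s k) (s (S k))) /\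
  (forall z, P z -> z <> x -> exists k, lt x z (s k)) /\
  (forall k o, exists r, seg s k r /\ a x r = o).
Proof.
  destruct P_two as [y [Py Ny]].
  destruct (dep_choice (fun _ z => P z /\ z <> x)
    (fun k z z' => lt x z z' /\ (forall w, P w -> w <> x -> idx w = k -> lt x w z') /\
       exists p, P p /\ lt x z p /\ lt x p z' /\ a x p <> a x z) y) as [s [_ [S1 S2]]]; [auto| |].
  { intros k z [Pz Nz]. destruct (other_op z Pz Nz) as [p [Pp [Lp Ep]]].
    assert (Np : p <> x) by (eapply lt_neq; eauto).
    destruct (classic (exists w, P w /\ w <> x /\ idx w = k)) as [[w [Pw [Nw Ew]]]|HN].
    - destruct (above2 p w Pp Pw Np Nw) as [z' [Pz' [L1 L2]]]. exists z'.
      split; [split; auto; eapply lt_neq; eauto|]. split; [eapply lt_tr; eauto|]. split; [|eauto].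
      intros w' Pw' Nw' Ew'. assert (w' = w) by (apply idx_inj; congruence). subst; auto.
    - destruct (P_limit x p) as [z' [Pz' L]]; auto. exists z'.
      split; [split; auto; eapply lt_neq; eauto|]. split; [eapply lt_tr; eauto|]. split; [|eauto].
      intros w Pw Nw Ew. exfalso. eauto. }
  exists s. split; [exact S1|]. split; [intros k; exact (proj1 (S2 k))|]. split.
  { intros z Pz Nz. exists (S (idx z)). exact (proj1 (proj2 (S2 (idx z))) z Pz Nz eq_refl). }
  assert (G : forall k p, P p -> p <> x -> ~ lt x p (s k) -> lt x p (s (S k)) -> exists r, seg s k r /\ a x r = a x p).
  { intros k p Pp Np L1 L2. destruct (skel_of V idx a a_sym P4 P x p P_closed Px Pp Np) as [r [Hr Hc]].
    exists r. assert (Nr : r <> x) by apply Hr. split; [|symmetry; now apply (chd_adj_x V a a_sym P4)].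
    split; auto. rewrite <- !(chd_lt r p) by auto. auto. }
  intros k o. destruct (S1 k) as [Pk Nk]. destruct (S2 k) as [L [_ [p [Pp [L1 [L2 Ep]]]]]].
  destruct (bool_dec (a x (s k)) o) as [E|E].
  - destruct (G k (s k) Pk Nk) as [r [R1 R2]]; auto; [eapply mlt_irr; eauto|]. exists r. split; congruence.
  - destruct (G k p) as [r [R1 R2]]; auto; [eapply lt_neq; eauto|apply mlt_asym; auto|].
    exists r. split; auto. destruct (a x r), (a x p), (a x (s k)), o; congruence.
Qed.

Lemma seg_shift s K k : seg (fun i => s (K + i)) k = seg s (K + k).
Proof. unfold seg. now replace (K + S k) with (S (K + k)) by lia. Qed.

(* After discarding finitely many segments, [n] copies of any segment can be absorbed arbitrarily
   high up in the tail. *)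
Lemma good_sequence n : 1 <= n -> exists s : nat -> V,
  (forall k, P (s k) /\ s k <> x) /\ (forall k, lt x (s k) (s (S k))) /\
  (forall z, P z -> z <> x -> exists k, lt x z (s k)) /\
  (forall k o, exists r, seg s k r /\ a x r = o) /\
  (forall k m, exists m', m <= m' /\ cemb n vw (seg s k) vw (fun r => exists l, m <= l /\ l < m' /\ seg s l r)).
Proof.
  intros Hn. destruct sequence_exists as [s [S1 [S2 [S3 S4]]]].
  assert (Ht : forall k, exists t, Dn vw t (seg s k) /\ Up vw t (seg s k)).
  { intros k. apply (chain_coded V idx idx_inj). destruct (S4 k true) as [r [H _]]. eauto. }
  destruct (choice_fun _ Ht) as [t Hts].
  destruct (bqo_recurrent cle t cle_bqo) as [K HK].
  assert (Inc : forall i j, i <= j -> forall z, lt x z (s i) -> lt x z (s j)).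
  { intros i j L z Hz. induction L as [|j L IH]; auto. eapply lt_tr; eauto. }
  assert (Sb : forall l l', l < l' -> blt vw (seg s l) (seg s l')).
  { intros l l' L r r' [Hr [_ L1]] [Hr' [L2 _]]. right. split; [apply Hr|]. split; [apply Hr'|]. left.
    destruct (lt_cot r r' (s (S l)) L1) as [Q|Q]; auto. exfalso. apply L2. apply (Inc (S l) l'); auto. }
  exists (fun i => s (K + i)). split; [intros k; apply S1|]. split; [intros k; rewrite Nat.add_succ_r; apply S2|].
  split.
  { intros z Pz Nz. destruct (S3 z Pz Nz) as [k Hk]. exists k. apply (Inc k); auto. lia. }
  split; [intros k o; rewrite seg_shift; apply S4|].
  intros k m. rewrite seg_shift.
  destruct (chain_absorb idx idx_inj vw (t (K + k)) (seg s (K + k)) n Hn (proj1 (Hts (K + k)))) as [N [LN [_ HN]]].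
  assert (Hg : forall m, exists l, m <= l /\ cle (t (K + k)) (t (K + l))).
  { intros m0. destruct (HK (K + k)) with (m := K + m0) as [l [L Hl]]; [lia|]. exists (l - K). split; [lia|].
    now replace (K + (l - K)) with l by lia. }
  destruct (choice_fun _ Hg) as [g Hgs].
  pose (pos := fix pos j := match j with 0 => g m | S j => g (S (pos j)) end).
  assert (P1 : inc pos) by (intros j; apply (Hgs (S (pos j)))).
  assert (P2 : forall j, cle (t (K + k)) (t (K + pos j))) by (intros [|j]; [apply (Hgs m)|apply (Hgs (S (pos j)))]).
  assert (P3 : forall j, m <= pos j).
  { intros j. apply Nat.le_trans with (pos 0); [apply (Hgs m)|apply inc_le; auto; lia]. }
  exists (S (pos N)). split; [specialize (P3 N); lia|].
  apply (HN V vw _ (fun j => seg s (K + pos j))).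
  - intros j Lj. split; [|eapply Up_cle; [apply Hts|apply P2]].
    intros r Hr. exists (pos j). rewrite seg_shift. split; auto. split; auto.
    pose proof (inc_lt pos P1 j N Lj). lia.
  - intros j j' L L'. apply Sb. pose proof (inc_lt pos P1 j j' L). lia.
Qed.

Section Tail.
Variables (n : nat) (s : nat -> V).
Hypothesis n_pos : 1 <= n.
Hypothesis s_inc : forall k, lt x (s k) (s (S k)).
Hypothesis s_cof : forall z, P z -> z <> x -> exists k, lt x z (s k).
Hypothesis s_ops : forall k o, exists r, seg s k r /\ a x r = o.
Hypothesis s_abs : forall k m, exists m', m <= m' /\
  cemb n vw (seg s k) vw (fun r => exists l, m <= l /\ l < m' /\ seg s l r).

Definition tailv (z : V) : Prop := P z /\ z <> x /\ ~ lt x z (s 0).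

Lemma s_le i j z : i <= j -> lt x z (s i) -> lt x z (s j).
Proof. intros L Hz. induction L as [|j L IH]; auto. eapply lt_tr; eauto. Qed.

Lemma seg_lt l l' r r' : l < l' -> seg s l r -> seg s l' r' -> lt x r r'.
Proof.
  intros L [_ [_ L1]] [_ [L2 _]]. destruct (lt_cot r r' (s (S l)) L1) as [Q|Q]; auto.
  exfalso. apply L2. apply (s_le (S l)); auto.
Qed.

Lemma seg_slt l l' r r' : l < l' -> seg s l r -> seg s l' r' -> slt V idx a x r r'.
Proof.
  intros L H1 H2. right. split; [apply H1|]. split; [apply H2|]. left. eapply seg_lt; eauto.
Qed.

Lemma level_exists z : exists k, tailv z -> ~ lt x z (s k) /\ lt x z (s (S k)).
Proof.
  destruct (classic (tailv z)) as [[Pz [Nz Lz]]|H]; [|exists 0; tauto].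
  destruct (s_cof z Pz Nz) as [k Hk]. induction k as [|k IH]; [contradiction|].
  destruct (classic (lt x z (s k))) as [L|L]; [auto|]. exists k; auto.
Qed.

Definition sg (z : V) : nat := proj1_sig (constructive_indefinite_description _ (level_exists z)).

Lemma sg_spec z : tailv z -> ~ lt x z (s (sg z)) /\ lt x z (s (S (sg z))).
Proof. exact (proj2_sig (constructive_indefinite_description _ (level_exists z))). Qed.

Lemma rp_exists z : exists r, P z -> z <> x -> sk r /\ chd x r z.
Proof.
  destruct (classic (P z /\ z <> x)) as [[Pz Nz]|H]; [|exists x; tauto].
  destruct (skel_of V idx a a_sym P4 P x z P_closed Px Pz Nz) as [r Hr]. eauto.
Qed.

Definition rp (z : V) : V := proj1_sig (constructive_indefinite_description _ (rp_exists z)).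

Lemma rp_spec z : P z -> z <> x -> sk (rp z) /\ chd x (rp z) z.
Proof. exact (proj2_sig (constructive_indefinite_description _ (rp_exists z))). Qed.

Lemma rp_seg z : tailv z -> seg s (sg z) (rp z).
Proof.
  intros Hz. destruct (sg_spec z Hz) as [L1 L2]. destruct Hz as [Pz [Nz _]].
  destruct (rp_spec z Pz Nz) as [H1 H2]. assert (N : rp z <> x) by apply H1.
  split; auto. rewrite <- !(chd_lt (rp z) z) by auto. auto.
Qed.

Lemma rp_op z : tailv z -> a x z = a x (rp z).
Proof.
  intros [Pz [Nz _]]. destruct (rp_spec z Pz Nz) as [H1 H2]. apply (chd_adj_x V a a_sym P4); auto. apply H1.
Qed.

Lemma rp_chd u v : tailv u -> tailv v -> (chd x u v <-> rp u = rp v).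
Proof.
  intros [Pu [Nu _]] [Pv [Nv _]]. destruct (rp_spec u Pu Nu) as [H1 H2]. destruct (rp_spec v Pv Nv) as [H3 H4].
  assert (N : rp u <> x) by apply H1. rewrite (chd_eq V a a_sym P4 x (rp u) u) by auto. split.
  - intros H. apply (rep_unique V idx idx_inj a a_sym P4 x (rp u) (rp v) v); auto; [apply H1|apply H3].
  - intros ->. auto.
Qed.

Lemma sg_unique z k : tailv z -> seg s k (rp z) -> k = sg z.
Proof.
  intros Hz Hk. pose proof (rp_seg z Hz) as Hs. destruct (lt_eq_lt_dec k (sg z)) as [[L|L]|L]; auto; exfalso;
    pose proof (seg_slt _ _ _ _ L ltac:(eassumption) ltac:(eassumption)) as Q; eapply slt_irr; eauto.
Qed.

(** The operations in a block of [3 * n] leaves: [n] times [false], [n] times [true], [n] times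
    [false]. The outer thirds keep the middle one apart from nodes of the same label, so that
    exactly [n] leaves hang at its node. *)
Definition sop (j : nat) : bool := (n <=? j) && (j <? 2 * n).

Definition sc (u v : V) : bool := if excluded_middle_informative (chd x u v) then true else false.

(** The later vertex along the chain decides the adjacency by its operation, except inside one copy
    of a child, where the edges are the old ones. Block [k] comes right after segment [k], and
    different copies of a child are separate children, joined by the operation of that child. *)
Definition ladj (p q : wt V) : bool :=
  match p, q with
  | wB u, wB v => a u v
  | wB u, wC v _ => a u v
  | wC u _, wB v => a u v
  | wB _, wS _ j => sop j
  | wS _ j, wB _ => sop j
  | wC u i, wC v i' => if sc u v && negb (i =? i') then a x u else a u v
  | wC u _, wS k j => if sg u <=? k then sop j else a x u
  | wS k j, wC u _ => if sg u <=? k then sop j else a x u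
  | wS k j, wS k' j' =>
      if k <? k' then sop j' else if k' <? k then sop j
      else if j <? j' then sop j' else if j' <? j then sop j else false
  end.

Definition lset (p : wt V) : Prop :=
  match p with
  | wB z => P z /\ (z = x \/ lt x z (s 0))
  | wC z i => tailv z /\ i < n
  | wS k j => j < 3 * n
  end.

Definition lop (p : wt V) : bool := match p with wB z => a x z | wC z _ => a x z | wS _ j => sop j end.

Definition istail (p : wt V) : Prop := lset p /\ match p with wB _ => False | _ => True end.

(** The order of the new chain, in which the copies of one child are consecutive. Vertices in the
    same copy of a child are left incomparable. *)
Definition pl (p q : wt V) : Prop :=
  match p, q with
  | wC u i, wC v j => slt V idx a x (rp u) (rp v) \/ (rp u = rp v /\ i < j)
  | wC u _, wS k _ => sg u <= k
  | wS k _, wC u _ => k < sg u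
  | wS k j, wS k' j' => k < k' \/ (k = k' /\ j < j')
  | _, _ => False
  end.

Lemma pl_total p q : istail p -> istail q -> p <> q ->
  pl p q \/ pl q p \/ exists u v i, p = wC u i /\ q = wC v i /\ rp u = rp v.
Proof.
  intros [Hp Tp] [Hq Tq] N. destruct p as [u|u i|k j], q as [v|v i'|k' j']; try tauto; cbn.
  - destruct (slt_tot V idx idx_inj a x (rp u) (rp v)) as [E|[L|L]]; auto.
    destruct (lt_eq_lt_dec i i') as [[L|L]|L]; auto. right; right. subst. eauto 6.
  - destruct (le_lt_dec (sg u) k'); auto.
  - destruct (le_lt_dec (sg v) k); auto.
  - destruct (lt_eq_lt_dec k k') as [[L|L]|L]; auto. subst.
    destruct (lt_eq_lt_dec j j') as [[L|L]|L]; auto. subst. congruence.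
Qed.

Lemma tail_base u v : P u -> (u = x \/ lt x u (s 0)) -> tailv v -> a u v = a x v.
Proof.
  intros Pu [->|L] [Pv [Nv Lv]]; auto. apply (mlt_adj V a all a_sym P4); auto.
  destruct (lt_cot u v (s 0) L); tauto.
Qed.

Lemma pl_adj p q : istail p -> istail q -> pl p q -> ladj p q = lop q /\ ladj q p = lop q.
Proof.
  intros [Hp Tp] [Hq Tq] H. destruct p as [u|u i|k j], q as [v|v i'|k' j']; try tauto; cbn [ladj lset lop pl] in *.
  - destruct Hp as [Hu Li], Hq as [Hv Li'].
    assert (Sc : forall u v, tailv u -> tailv v -> sc u v = if excluded_middle_informative (rp u = rp v) then true else false).
    { intros u' v' Hu' Hv'. unfold sc. pose proof (rp_chd u' v' Hu' Hv').
      destruct (excluded_middle_informative (chd x u' v')), (excluded_middle_informative (rp u' = rp v')); tauto. }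
    rewrite !Sc by auto. destruct H as [L|[E L]].
    + assert (N : rp u <> rp v) by (intros E; rewrite E in L; eapply slt_irr; eauto).
      destruct (excluded_middle_informative (rp u = rp v)); [contradiction|].
      destruct (excluded_middle_informative (rp v = rp u)); [congruence|]. cbn.
      rewrite (a_sym v u). assert (E : a u v = a x v); [|auto]. rewrite (rp_op v) by auto.
      destruct Hu as [Pu [Nu _]], Hv as [Pv [Nv _]]. destruct (rp_spec u Pu Nu). destruct (rp_spec v Pv Nv).
      apply (skel_adj V idx idx_inj a a_sym P4 x (rp u) (rp v)); auto; [apply H|apply H1].
    + destruct (excluded_middle_informative (rp u = rp v)); [|contradiction].
      destruct (excluded_middle_informative (rp v = rp u)); [|congruence].
      destruct (Nat.eqb_spec i i'); [lia|]. destruct (Nat.eqb_spec i' i); [lia|]. cbn.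
      split; auto. now rewrite (rp_op u), (rp_op v), E.
  - destruct (Nat.leb_spec (sg u) k'); auto; lia.
  - destruct (Nat.leb_spec (sg v) k); auto; lia.
  - destruct (Nat.ltb_spec k k'), (Nat.ltb_spec k' k), (Nat.ltb_spec j j'), (Nat.ltb_spec j' j); auto; lia.
Qed.

(** The tail is spread out along itself. The [n] copies of segment [k] go by [s_abs] into segments
    from [st k] on and before [md k]; each leaf of block [k] gets one of the next [3 * n] segments,
    where [s_ops] provides a vertex of the right operation. *)
Lemma tail_embeds : gemb ladj lset a P.
Proof.
  destruct (choice_fun (fun (km : nat * nat) (mf : nat * (V -> nat -> V)) => snd km <= fst mf /\
     forall r, seg s (fst km) r -> forall i, i < n ->
       (exists l, snd km <= l /\ l < fst mf /\ seg s l (snd mf r i)) /\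
       lle (clab vw r) (clab vw (snd mf r i)) /\
       (forall j, j < n -> i < j -> clt vw (snd mf r i) (snd mf r j)) /\
       (forall r', seg s (fst km) r' -> clt vw r r' -> forall j, j < n -> clt vw (snd mf r i) (snd mf r' j))))
    as [mf Hmf].
  { intros [k m]. destruct (s_abs k m) as [m' [L [f Hf]]]. exists (m', f). split; auto. }
  pose (st := fix st k := match k with 0 => 0 | S k => fst (mf (k, st k)) + 3 * n end).
  pose (md k := fst (mf (k, st k))). pose (F k := snd (mf (k, st k))).
  assert (st_S : forall k, st (S k) = md k + 3 * n) by reflexivity.
  assert (st_md : forall k, st k <= md k) by (intros k; apply (Hmf (k, st k))).
  assert (st_mono : forall k k', k < k' -> md k + 3 * n <= st k').
  { intros k k' L. induction L as [|k' L IH]; [rewrite st_S; lia|]. rewrite st_S. specialize (st_md k'). lia. }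
  assert (HF : forall k r, seg s k r -> forall i, i < n ->
       (exists l, st k <= l /\ l < md k /\ seg s l (F k r i)) /\
       lle (clab vw r) (clab vw (F k r i)) /\
       (forall j, j < n -> i < j -> slt V idx a x (F k r i) (F k r j)) /\
       (forall r', seg s k r' -> slt V idx a x r r' -> forall j, j < n -> slt V idx a x (F k r i) (F k r' j))).
  { intros k. apply (Hmf (k, st k)). }
  destruct (choice_fun (fun (kj : nat * nat) r => seg s (md (fst kj) + snd kj) r /\ a x r = sop (snd kj))) as [g Hg].
  { intros [k j]. apply s_ops. }
  destruct (choice_fun (fun (rr : V * V) (h : V -> V) => sk (fst rr) -> sk (snd rr) ->
     lle (clab vw (fst rr)) (clab vw (snd rr)) ->
     (forall u, chd x (fst rr) u -> chd x (snd rr) (h u)) /\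
     (forall u v, chd x (fst rr) u -> chd x (fst rr) v -> h u = h v -> u = v) /\
     (forall u v, chd x (fst rr) u -> chd x (fst rr) v -> a (h u) (h v) = a u v))) as [h Hh].
  { intros [r r']. cbn [fst snd]. destruct (classic (sk r /\ sk r' /\ lle (clab vw r) (clab vw r'))) as [[H1 [H2 H3]]|H].
    - destruct (sk_label r r' H1 H2 H3) as [h Hh]. exists h. auto.
    - exists (fun z => z). tauto. }
  (* [tau] chooses the target child through its representative, [psi] the vertex inside that
     child. *)
  pose (tau p := match p with wB z => x | wC z i => F (sg z) (rp z) i | wS k j => g (k, j) end).
  pose (psi p := match p with wB z => z | wC z i => h (rp z, F (sg z) (rp z) i) z | wS k j => g (k, j) end).
  assert (Lev : forall p, istail p -> exists l, seg s l (tau p) /\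
      match p with wB _ => True | wC z _ => st (sg z) <= l /\ l < md (sg z) | wS k j => l = md k + j end).
  { intros [z|z i|k j] [Hp Tp]; [tauto| |].
    - destruct Hp as [Hz Li]. destruct (HF (sg z) (rp z) (rp_seg z Hz) i Li) as [[l [L1 [L2 L3]]] _]. exists l. auto.
    - exists (md k + j). split; auto. apply (Hg (k, j)). }
  assert (Tsk : forall p, istail p -> sk (tau p)) by (intros p Hp; destruct (Lev p Hp) as [l [H _]]; apply H).
  assert (Top : forall p, istail p -> a x (tau p) = lop p).
  { intros [z|z i|k j] [Hp Tp]; [tauto| |].
    - destruct Hp as [Hz Li]. destruct (HF (sg z) (rp z) (rp_seg z Hz) i Li) as [_ [[E _] _]].
      cbn [lop tau]. rewrite (rp_op z Hz). symmetry. exact E.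
    - apply (Hg (k, j)). }
  assert (Psi : forall p, istail p -> chd x (tau p) (psi p)).
  { intros [z|z i|k j] Hp; [destruct Hp; tauto| |apply chd_self].
    pose proof (Tsk _ Hp) as Ht. destruct Hp as [[Hz Li] _].
    destruct (HF (sg z) (rp z) (rp_seg z Hz) i Li) as [_ [Hl _]]. pose proof (rp_seg z Hz) as Hs.
    apply (Hh (rp z, F (sg z) (rp z) i)); auto; [apply Hs|]. destruct Hz as [Pz [Nz _]]. now apply rp_spec. }
  assert (Ord : forall p q, istail p -> istail q -> pl p q -> slt V idx a x (tau p) (tau q)).
  { intros p q Hp Hq H. destruct (Lev p Hp) as [l [S1 B1]]. destruct (Lev q Hq) as [l' [S2 B2]].
    destruct p as [u|u i|k j], q as [v|v i'|k' j']; cbn in H; try tauto.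
    - destruct Hp as [[Hu Li] _], Hq as [[Hv Li'] _].
      pose proof (rp_seg u Hu) as Su. pose proof (rp_seg v Hv) as Sv. destruct H as [L|[E L]].
      + destruct (lt_eq_lt_dec (sg u) (sg v)) as [[Ls|Ls]|Ls].
        * apply (seg_slt l l'); auto. specialize (st_mono _ _ Ls). lia.
        * cbn [tau]. rewrite <- Ls in *. apply (HF (sg u) (rp u) Su i Li); auto.
        * exfalso. apply (slt_irr V idx a a_sym x (rp u)). eapply (slt_trans V idx idx_inj a a_sym P4 x); [exact L|]. eapply seg_slt; eauto.
      + cbn [tau]. assert (Es : sg u = sg v) by (apply sg_unique; auto; rewrite <- E; auto).
        rewrite <- E, <- Es. apply (proj1 (proj2 (proj2 (HF (sg u) (rp u) Su i Li)))); auto.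
    - apply (seg_slt l l'); auto. destruct (Nat.eq_dec (sg u) k') as [E|E]; [rewrite E in B1; lia|].
      specialize (st_mono (sg u) k' ltac:(lia)). specialize (st_md k'). lia.
    - apply (seg_slt l l'); auto. specialize (st_mono k (sg v) H). destruct Hp as [Hp _]. cbn in Hp. lia.
    - apply (seg_slt l l'); auto. destruct Hp as [Hp _]. cbn in Hp. destruct H as [H|[-> H]]; [|lia].
      specialize (st_mono k k' H). specialize (st_md k'). lia. }
  assert (Cross : forall p q, istail p -> istail q -> pl p q -> a (psi p) (psi q) = lop q /\ psi p <> psi q).
  { intros p q Hp Hq H. pose proof (Tsk p Hp) as K1. pose proof (Tsk q Hq) as K2. split.
    - rewrite (skel_adj V idx idx_inj a a_sym P4 x (tau p) (tau q)); auto; [apply K1|apply K2].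
    - intros E. pose proof (Psi p Hp) as C1. pose proof (Psi q Hq) as C2. rewrite E in C1.
      assert (Et : tau p = tau q) by (eapply (rep_unique V idx idx_inj a a_sym P4 x); eauto; [apply K1|apply K2]).
      pose proof (Ord p q Hp Hq H) as Q. rewrite Et in Q. eapply slt_irr; eauto. }
  assert (Base : forall u q, lset (wB u) -> istail q -> a u (psi q) = lop q /\ u <> psi q).
  { intros u q [Pu Hu] Hq. pose proof (Tsk q Hq) as K2. pose proof (Psi q Hq) as C2.
    assert (Nq : tau q <> x) by apply K2. destruct (Lev q Hq) as [l [[_ [L1 _]] _]].
    assert (Tq : tailv (psi q)).
    { split; [eapply (chd_sub V a a_sym P4 P x (tau q)); eauto; apply K2|]. split; [eapply chd_neq; eauto|].
      rewrite (chd_lt (tau q)) by auto. intros Q. apply L1. apply (s_le 0); auto. lia. }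
    split.
    - rewrite (tail_base u (psi q)), <- Top by auto. apply (chd_adj_x V a a_sym P4); auto.
    - intros ->. destruct Tq as [_ [N L]]. tauto. }
  assert (PsiP : forall p, lset p -> P (psi p)).
  { intros p Hp. destruct p as [z|z i|k j] eqn:Ep; [apply Hp| |];
      (assert (Ht : istail p) by (rewrite Ep; split; auto); rewrite <- Ep; pose proof (Tsk p Ht) as K;
       eapply (chd_sub V a a_sym P4 P x (tau p)); eauto; apply K). }
  assert (Same : forall u v i, tailv u -> tailv v -> i < n -> rp u = rp v ->
     a (psi (wC u i)) (psi (wC v i)) = a u v /\ (psi (wC u i) = psi (wC v i) -> u = v)).
  { intros u v i Hu Hv Li E. pose proof (rp_seg u Hu) as Su.
    assert (Es : sg u = sg v) by (apply sg_unique; auto; rewrite <- E; auto).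
    destruct (HF (sg u) (rp u) Su i Li) as [[l [_ [_ Sl]]] [Hl _]].
    destruct (Hh (rp u, F (sg u) (rp u) i)) as [_ [G2 G3]]; auto; [apply Su|apply Sl|]. cbn [fst snd] in *.
    cbn [psi]. rewrite <- Es, <- E. destruct Hu as [Pu [Nu _]], Hv as [Pv [Nv _]].
    destruct (rp_spec u Pu Nu) as [_ Cu]. destruct (rp_spec v Pv Nv) as [_ Cv]. rewrite <- E in Cv. auto. }
  assert (Main : forall p q, lset p -> lset q -> a (psi p) (psi q) = ladj p q /\ (psi p = psi q -> p = q)).
  { intros p q Hp Hq.
    assert (T : forall p, lset p -> istail p \/ exists z, p = wB z).
    { intros [z|z i|k j] H; [eauto|left; split; auto|left; split; auto]. }
    destruct (T p Hp) as [Tp|[u ->]]; destruct (T q Hq) as [Tq|[v ->]].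
    - destruct (classic (p = q)) as [->|N].
      { split; auto. rewrite a_irr. destruct q as [z|z i|k j]; cbn [ladj]; [now rewrite a_irr| |].
        - rewrite Nat.eqb_refl, andb_false_r. now rewrite a_irr.
        - now rewrite !Nat.ltb_irrefl. }
      destruct (pl_total p q Tp Tq N) as [H|[H|[u [v [i [-> [-> E]]]]]]].
      + destruct (Cross p q Tp Tq H) as [C1 C2]. destruct (pl_adj p q Tp Tq H) as [A1 _]. split; [congruence|tauto].
      + destruct (Cross q p Tq Tp H) as [C1 C2]. destruct (pl_adj q p Tq Tp H) as [_ A1].
        rewrite a_sym. split; [congruence|]. intros Q. symmetry in Q. tauto.
      + destruct Hp as [Hu Li], Hq as [Hv _]. destruct (Same u v i Hu Hv Li E) as [S1 S2]. split.
        * rewrite S1. cbn. now rewrite Nat.eqb_refl, andb_false_r.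
        * intros Q. f_equal. auto.
    - destruct (Base v p Hq Tp) as [B1 B2]. split.
      + rewrite a_sym. change (psi (wB v)) with v. rewrite B1. destruct Tp as [Hp' Tp].
        destruct p as [z|z i|k j]; cbn; [tauto| |auto]. rewrite (a_sym z v). symmetry.
        destruct Hq. apply tail_base; auto. apply Hp.
      + intros Q. symmetry in Q. tauto.
    - destruct (Base u q Hp Tq) as [B1 B2]. split; [|tauto].
      change (psi (wB u)) with u. rewrite B1. destruct Tq as [Hq' Tq].
      destruct q as [z|z i|k j]; cbn; [tauto| |auto]. symmetry. destruct Hp. apply tail_base; auto. apply Hq.
    - split; auto. intros Q. f_equal. exact Q. }
  exists psi. split; [exact PsiP|]. split; intros p q Hp Hq; apply Main; auto.
Qed.

Lemma base_embeds : gemb a P ladj lset.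
Proof.
  exists (fun z => if excluded_middle_informative (z = x \/ lt x z (s 0)) then wB z else wC z 0).
  split; [|split].
  - intros z Pz. destruct excluded_middle_informative as [H|H]; cbn; [auto|]. split; [|lia]. split; auto.
  - intros u v _ _. repeat destruct excluded_middle_informative; congruence.
  - intros u v _ _. repeat destruct excluded_middle_informative; cbn; rewrite ?andb_false_r; auto.
Qed.

Lemma sc_sym u v : sc u v = sc v u /\ (sc u v = true -> a x u = a x v).
Proof.
  assert (G : forall u v, chd x u v -> chd x v u /\ a x u = a x v).
  { intros u' v' H. destruct (classic (u' = x)) as [->|N].
    - destruct H as [_ [->|H]]; [split; auto; apply chd_self|]. exfalso. eapply mlt_x; eauto.
    - rewrite (chd_eq V a a_sym P4 x u' v') by auto. split; [apply chd_self|].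
      symmetry. now apply (chd_adj_x V a a_sym P4). }
  unfold sc. destruct (excluded_middle_informative (chd x u v)) as [H|H], (excluded_middle_informative (chd x v u)) as [H'|H'];
    split; auto; try discriminate; try (intros _; now apply G); exfalso; [apply H'|apply H]; now apply G.
Qed.

Lemma ladj_sym p q : ladj p q = ladj q p.
Proof.
  destruct p as [u|u i|k j], q as [v|v i'|k' j']; cbn [ladj]; auto.
  - destruct (sc_sym u v) as [E H]. rewrite <- E, (Nat.eqb_sym i' i), (a_sym v u).
    destruct (sc u v); [|reflexivity]. rewrite H; auto.
  - destruct (Nat.ltb_spec k k'), (Nat.ltb_spec k' k), (Nat.ltb_spec j j'), (Nat.ltb_spec j' j); auto; lia.
Qed.

Lemma lset_p4free : p4free ladj lset.
Proof.
  eapply p4free_emb; [exact tail_embeds|]. intros p q r t _ _ _ _. apply P4; auto.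
Qed.

Local Notation L := (mlt ladj lset).

(** The vertices placed before the [j]-th leaf of block [k]. *)
Definition bel (k j : nat) (z : wt V) : Prop :=
  match z with wB _ => True | wC u _ => sg u <= k | wS k' j' => k' < k \/ (k' = k /\ j' < j) end.

Lemma bel_high p : exists k0, forall k, k0 <= k -> bel k 0 p.
Proof.
  destruct p as [u|u i|k j]; cbn; [exists 0; auto|exists (sg u); auto|exists (S k); auto].
Qed.

Lemma bel_mono k j j' p : j <= j' -> bel k j p -> bel k j' p.
Proof. intros Hj. destruct p; cbn; auto. lia. Qed.

Lemma bel_adj k j p : bel k j p -> ladj p (wS k j) = sop j.
Proof.
  destruct p as [u|u i|k' j']; cbn [ladj bel]; auto.
  - destruct (Nat.leb_spec (sg u) k); auto; lia.
  - intros H. destruct (Nat.ltb_spec k' k), (Nat.ltb_spec k k'), (Nat.ltb_spec j' j), (Nat.ltb_spec j j'); auto; lia.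
Qed.

Lemma base_adj v q : lset (wB v) -> istail q -> ladj (wB v) q = lop q.
Proof.
  intros [Pv Hv] [Hq Tq]. destruct q as [w|w i|k j]; cbn; [tauto| |auto]. apply tail_base; auto. apply Hq.
Qed.

Lemma bel_out k j p q : lset p -> lset q -> bel k j p -> ~ bel k j q -> istail q /\ ladj p q = lop q.
Proof.
  intros Hp Hq Bp Bq.
  assert (Tq : istail q) by (split; auto; destruct q; cbn in Bq; tauto). split; auto.
  destruct p as [u|u i|k1 j1].
  - now apply base_adj.
  - apply pl_adj; auto; [split; auto|]. destruct q as [v|v i'|k2 j2]; cbn in *; [tauto| |lia]. left.
    eapply seg_slt; [|apply rp_seg, Hp|apply rp_seg, Hq]. lia.
  - apply pl_adj; auto; [split; auto|]. destruct q as [v|v i'|k2 j2]; cbn in *; [tauto| |]; lia.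
Qed.

Lemma sop_0 : sop 0 = false.
Proof. unfold sop. destruct (Nat.leb_spec n 0); auto; lia. Qed.

Lemma sop_mid j : n <= j < 2 * n -> sop j = true.
Proof. intros H. unfold sop. destruct (Nat.leb_spec n j), (Nat.ltb_spec j (2 * n)); auto; lia. Qed.

Lemma sop_low j : j < n -> sop j = false.
Proof. intros H. unfold sop. destruct (Nat.leb_spec n j); auto; lia. Qed.

Lemma sop_high j : 2 * n <= j -> sop j = false.
Proof. intros H. unfold sop. destruct (Nat.ltb_spec j (2 * n)); [lia|]. apply andb_false_r. Qed.

(** A sufficiently high block has leaves of both operations; one whose operation differs from
    [ladj p q] separates. *)
Lemma separator p q : lset p -> lset q -> exists w, lset w /\ w <> p /\ prec ladj p q w.
Proof.
  intros Hp Hq. destruct (bel_high p) as [k1 H1]. destruct (bel_high q) as [k2 H2].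
  pose (k := max k1 k2). assert (Bp : bel k 0 p) by (apply H1; lia). assert (Bq : bel k 0 q) by (apply H2; lia).
  pose (j := if ladj p q then 0 else n).
  assert (Hj : j < 3 * n /\ sop j <> ladj p q).
  { unfold j. destruct (ladj p q); [rewrite sop_0|rewrite sop_mid by lia]; split; auto; try discriminate; lia. }
  exists (wS k j). split; [apply Hj|]. split; [intros E; rewrite <- E in Bp; cbn in Bp; lia|].
  split; rewrite !bel_adj by (apply (bel_mono k 0); auto; lia); auto. apply not_eq_sym, Hj.
Qed.

(** The separator [w] lies above the module of [p] and [q], so the embedding [f] into [P] maps this
    module into that of [f p] and [f w], which is small by [P_small]. *)
Lemma lset_mm p q : lset p -> lset q -> p <> q -> gemb ladj (mm ladj lset p q) a C.
Proof.
  intros Hp Hq N. destruct (separator p q Hp Hq) as [w [Hw [Nw Q]]].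
  destruct tail_embeds as [f [F1 [F2 F3]]].
  assert (Nf : f p <> f w) by (intros E; apply Nw; symmetry; apply F2; auto).
  eapply gemb_trans; [|apply (P_small (f p) (f w)); auto].
  exists f. split; [|split].
  - intros z [Hz Mz]. split; auto. apply mlt_asym; auto.
    apply (mlt_emb a all ladj lset f); auto.
    destruct (mlt_cotrans _ ladj lset ladj_sym lset_p4free p q z w) as [K|K]; auto; [left; auto|contradiction].
  - intros u v [Hu _] [Hv _]. auto.
  - intros u v [Hu _] [Hv _]. auto.
Qed.

Lemma lset_no_top o : ~ top ladj lset o.
Proof.
  intros [p [q [Hp [Hq [N [_ H]]]]]]. destruct (separator p q Hp Hq) as [w [Hw [_ Q]]]. eapply H; eauto.
Qed.

(** The module ends exactly with the middle third of block [k]: every other vertex up to there is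
    joined to [wS k n], and beyond it the last third separates the vertices of operation [true]. *)
Lemma above_block k p z : lset p -> lset z -> bel k 0 p -> (L p (wS k n) z <-> ~ bel k (2 * n) z).
Proof.
  intros Hp Hz Bp.
  assert (Bp' : bel k (2 * n) p) by (apply (bel_mono k 0); auto; lia).
  assert (Ep : ladj p (wS k n) = true) by (rewrite bel_adj, sop_mid; auto; [lia|apply (bel_mono k 0); auto; lia]).
  assert (Hy : lset (wS k n)) by (cbn; lia).
  assert (By : bel k (2 * n) (wS k n)) by (cbn; lia).
  split.
  - intros H Bz.
    assert (NP : forall w, bel k (2 * n) w -> ~ prec ladj p (wS k n) w).
    { intros w Bw [Q1 Q2]. rewrite Ep in Q1. destruct (ladj p w) eqn:E; [auto|]. rewrite ladj_sym in Q2.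
      destruct w as [u|u i|k' j']; cbn [ladj bel] in *.
      - rewrite sop_mid in Q2 by lia. discriminate.
      - destruct (Nat.leb_spec (sg u) k); [|lia]. rewrite sop_mid in Q2 by lia. discriminate.
      - destruct (Nat.eq_dec k' k) as [->|Nk].
        + destruct (Nat.eq_dec j' n) as [->|Nj]; [congruence|].
          rewrite !Nat.ltb_irrefl in Q2. destruct (Nat.ltb_spec j' n), (Nat.ltb_spec n j'); try lia;
            rewrite sop_mid in Q2 by lia; discriminate.
        + destruct (Nat.ltb_spec k' k); [|lia]. rewrite sop_mid in Q2 by lia. discriminate. }
    destruct H as [H|[w [Hw [H1 H2]]]]; [exact (NP z Bz H)|].
    assert (Bw : ~ bel k (2 * n) w) by (intros Bw; exact (NP w Bw H1)).
    destruct (bel_out k (2 * n) p w) as [_ E1]; auto. destruct (bel_out k (2 * n) z w) as [_ E2]; auto.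
    destruct H2 as [Q1 Q2]. apply Q1. rewrite E1, <- Q2, ladj_sym, E2. auto.
  - intros Bz.
    destruct (bel_out k (2 * n) p z) as [Tz E1]; auto. destruct (bel_out k (2 * n) (wS k n) z) as [_ E2]; auto.
    destruct (lop z) eqn:Ez; [|left; split; congruence].
    assert (Hw : lset (wS k (2 * n))) by (cbn; lia).
    assert (Ew : forall q, bel k (2 * n) q -> ladj q (wS k (2 * n)) = false) by (intros q Bq; rewrite bel_adj, sop_high; auto).
    right. exists (wS k (2 * n)). split; auto. split; split; rewrite ?Ew, ?Ep by auto; try congruence.
    destruct (classic (bel k (S (2 * n)) z)) as [Bz'|Bz'].
    + exfalso. assert (z = wS k (2 * n)).
      { destruct z as [u|u i|k' j']; cbn in Bz, Bz'; try tauto. f_equal; lia. }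
      subst z. cbn [lop] in Ez. rewrite sop_high in Ez by lia. discriminate.
    + destruct (bel_out k (S (2 * n)) (wS k (2 * n)) z) as [_ E3]; auto; [cbn; lia|]. congruence.
Qed.

(** Vertices before the block are not joined to its first third, and the first third is not joined
    to [p]. Hence the leaves are those of the middle third. *)
Lemma block_leaves k p : lset p -> bel k 0 p -> card (leaf ladj (mm ladj lset p (wS k n)) (ladj p (wS k n))) n.
Proof.
  intros Hp Bp.
  assert (Ep : ladj p (wS k n) = true) by (rewrite bel_adj, sop_mid; auto; [lia|apply (bel_mono k 0); auto; lia]).
  assert (HM : forall z, mm ladj lset p (wS k n) z <-> lset z /\ bel k (2 * n) z).
  { intros z. unfold mm. split; intros [Hz H]; split; auto.
    - apply NNPP; intros Q. apply H. now apply above_block.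
    - rewrite above_block; auto. }
  rewrite Ep. exists (map (wS k) (seq n n)). split; [|split].
  - apply Injective_map_NoDup; [intros i j E; congruence|apply seq_NoDup].
  - now rewrite length_map, length_seq.
  - intros z. rewrite in_map_iff. split.
    + intros [Mz Lz]. apply HM in Mz. destruct Mz as [Hz Bz].
      assert (Low : bel k 0 z -> False).
      { intros B0. assert (E : ladj z (wS k 0) = true); [|rewrite bel_adj, sop_0 in E; auto; discriminate].
        apply Lz; [apply HM; split; cbn; lia|]. intros <-. cbn in B0. lia. }
      destruct z as [u|u i|k' j']; cbn in Hz, Bz, Low; try tauto.
      assert (k' = k) by lia. subst k'.
      destruct (le_lt_dec n j') as [Hj|Hj]; [exists j'; split; auto; apply in_seq; lia|].
      exfalso. assert (E : ladj (wS k j') p = true).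
      { apply Lz; [apply HM; split; auto; apply (bel_mono k 0); auto; lia|]. intros ->. cbn in Bp. lia. }
      rewrite ladj_sym, bel_adj, sop_low in E; auto; [discriminate|]. apply (bel_mono k 0); auto; lia.
    + intros [j [<- Hj]]. apply in_seq in Hj. split; [apply HM; split; cbn; lia|].
      intros u Mu Nu. apply HM in Mu. destruct Mu as [Hu Bu]. rewrite ladj_sym.
      destruct (classic (bel k j u)) as [B|B]; [rewrite bel_adj, sop_mid; auto; lia|].
      destruct u as [v|v i|k' j']; cbn in B, Bu; try tauto. assert (k' = k) by lia. subst k'.
      assert (j' <> j) by congruence. rewrite ladj_sym, bel_adj, sop_mid; cbn; auto; lia.
Qed.

(* Vertices of equal operation that no vertex of the opposite operation separates lie in the same
   modules around [wB x]. *)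
Definition sim (p q : wt V) : Prop := istail p /\ istail q /\ lop p = lop q /\
  forall w, lset w -> lop w <> lop p -> ladj w p = ladj w q.

Lemma x0_in : lset (wB x).
Proof. cbn; auto. Qed.

Lemma x0_adj p : istail p -> ladj (wB x) p = lop p.
Proof. apply base_adj, x0_in. Qed.

Lemma sim_mm y p q : lset y -> sim p q -> mm ladj lset (wB x) y p -> mm ladj lset (wB x) y q.
Proof.
  intros Hy [Tp [Tq [E H]]] [Hp Np]. split; [apply Tq|]. intros K.
  destruct (mlt_cotrans _ ladj lset ladj_sym lset_p4free (wB x) y p q x0_in Hy Hp (proj1 Tq) K) as [Q|Q]; [auto|].
  destruct Q as [[Q _]|[w [Hw [[Q1 Q2] [Q3 Q4]]]]].
  - apply Q. rewrite !x0_adj; auto.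
  - rewrite (x0_adj p) in Q1 by auto. rewrite (x0_adj q) in Q3, Q4 by auto.
    assert (Ew : ladj (wB x) w = lop w).
    { destruct w as [v|v i|k j]; cbn; auto. }
    rewrite Ew in *. rewrite <- H in Q4 by congruence. rewrite ladj_sym in Q2. congruence.
Qed.

Lemma rp_sg u v : tailv u -> tailv v -> rp u = rp v -> sg u = sg v.
Proof. intros Hu Hv E. apply sg_unique; auto. rewrite <- E. now apply rp_seg. Qed.

Lemma sim_child u v i i' : tailv u -> tailv v -> i < n -> i' < n -> rp u = rp v -> sim (wC u i) (wC v i').
Proof.
  intros Hu Hv Li Li' E.
  assert (T1 : istail (wC u i)) by (repeat split; auto; apply Hu).
  assert (T2 : istail (wC v i')) by (repeat split; auto; apply Hv).
  assert (Eo : lop (wC u i) = lop (wC v i')) by (cbn; now rewrite (rp_op u), (rp_op v), E).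
  split; auto. split; auto. split; auto. intros w Hw N.
  destruct w as [z|z l|k j].
  - destruct Hw as [Pz Hz]. cbn in Eo |- *. rewrite !(tail_base z) by auto. exact Eo.
  - assert (Tw : istail (wC z l)) by (split; auto). assert (Hz : tailv z) by apply Hw.
    assert (Nr : rp z <> rp u).
    { intros Q. apply N. cbn. now rewrite (rp_op z), (rp_op u), Q. }
    destruct (slt_tot V idx idx_inj a x (rp z) (rp u)) as [Q|[Q|Q]]; [contradiction| |].
    + rewrite (proj1 (pl_adj (wC z l) (wC u i) Tw T1 (or_introl Q))).
      rewrite E in Q. rewrite (proj1 (pl_adj (wC z l) (wC v i') Tw T2 (or_introl Q))). exact Eo.
    + rewrite (proj2 (pl_adj (wC u i) (wC z l) T1 Tw (or_introl Q))).
      rewrite E in Q. rewrite (proj2 (pl_adj (wC v i') (wC z l) T2 Tw (or_introl Q))). reflexivity.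
  - cbn in Eo |- *. rewrite (rp_sg u v) by auto. now rewrite Eo.
Qed.

(** A vertex of the other operation lies entirely before or entirely after the third that contains
    both leaves. *)
Lemma sim_block k j j' : j < 3 * n -> j' < 3 * n -> j / n = j' / n -> sim (wS k j) (wS k j').
Proof.
  intros Hj Hj' E.
  assert (Hd : (j < n <-> j' < n) /\ (j < 2 * n <-> j' < 2 * n)).
  { pose proof (Nat.div_mod_eq j n). pose proof (Nat.div_mod_eq j' n).
    pose proof (Nat.mod_upper_bound j n ltac:(lia)). pose proof (Nat.mod_upper_bound j' n ltac:(lia)).
    rewrite <- E in *. destruct (j / n) as [|[|d]]; nia. }
  assert (Eo : sop j = sop j').
  { unfold sop. destruct (Nat.leb_spec n j), (Nat.leb_spec n j'), (Nat.ltb_spec j (2 * n)), (Nat.ltb_spec j' (2 * n)); auto; lia. }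
  split; [split; cbn; auto|]. split; [split; cbn; auto|]. split; [exact Eo|]. intros w Hw N.
  destruct w as [z|z l|k' i]; cbn [ladj lop lset] in *.
  - exact Eo.
  - now rewrite Eo.
  - rewrite Eo. destruct (k' <? k); auto. destruct (k <? k'); auto.
    assert (Hi : (i < j <-> i < j') /\ (j < i <-> j' < i)).
    { unfold sop in N. destruct (Nat.leb_spec n i), (Nat.leb_spec n j), (Nat.ltb_spec i (2 * n)), (Nat.ltb_spec j (2 * n));
        cbn in N; try congruence; lia. }
    destruct (Nat.ltb_spec i j), (Nat.ltb_spec i j'), (Nat.ltb_spec j i), (Nat.ltb_spec j' i); auto; lia.
Qed.

Section LeafCount.
Variable y : wt V.
Hypothesis y_in : lset y.
Hypothesis y_high : L (wB x) (wS 0 n) y.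
Local Notation M := (mm ladj lset (wB x) y).
Local Notation Z := (leaf ladj M (ladj (wB x) y)).

Lemma base_block_in j : j < 2 * n -> M (wS 0 j).
Proof.
  intros Hj. split; [cbn; lia|]. intros K.
  assert (K' : L (wB x) (wS 0 n) (wS 0 j)).
  { eapply (mlt_trans _ ladj lset ladj_sym lset_p4free _ _ y); eauto; try (cbn; lia). apply x0_in. }
  apply above_block in K'; cbn in *; auto; lia.
Qed.

(** A base vertex is joined differently to [wS 0 0] and [wS 0 n], which both lie in the module. *)
Lemma leaf_tail z : Z z -> istail z /\ lop z = ladj (wB x) y.
Proof.
  intros [Mz Hz].
  assert (Tz : istail z).
  { split; [apply Mz|]. destruct z as [v|v i|k j]; auto.
    pose proof (Hz (wS 0 0) ltac:(apply base_block_in; lia) ltac:(discriminate)) as E1.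
    pose proof (Hz (wS 0 n) ltac:(apply base_block_in; lia) ltac:(discriminate)) as E2.
    cbn in E1, E2. rewrite sop_0 in E1. rewrite sop_mid in E2 by lia. congruence. }
  split; auto. rewrite <- x0_adj, ladj_sym by auto. apply Hz; [apply mm_in_l; auto using ladj_sym, x0_in|].
  intros <-. destruct Tz; auto.
Qed.

(** In a larger child some [w] is joined to [u] against the operation, and its copy lies in the
    module by [sim_mm]. *)
Lemma leaf_child_trivial u i v : Z (wC u i) -> tailv v -> rp u = rp v -> v = u.
Proof.
  intros HZ Hv E. destruct (leaf_tail _ HZ) as [[[Hu Li] _] Eo]. apply NNPP; intros N.
  assert (Hw : exists w, tailv w /\ rp u = rp w /\ w <> u /\ a u w <> a x u).
  { assert (Cv : chd x u v) by now apply rp_chd. destruct Hu as [Pu [Nu Lu]].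
    assert (G : forall w, chd x u w -> tailv w).
    { intros w Hw. split; [eapply (chd_sub V a a_sym P4 P x u); eauto|]. split; [eapply chd_neq; eauto|].
      now rewrite (chd_lt u). }
    assert (Hu : tailv u) by (split; auto).
    rewrite (a_sym x u).
    destruct Cv as [_ [->|[[Q1 Q2]|[w [_ [[Q1 Q2] [Q3 Q4]]]]]]]; [congruence|exists v; auto|].
    exists w. assert (Cw : chd x u w) by (split; auto; right; left; split; auto).
    split; auto. split; [apply rp_chd; auto|]. split; auto.
    intros ->. apply (prec_x V a a_sym u v). split; auto. }
  destruct Hw as [w [Tw [Ew [Nw Aw]]]].
  assert (Mw : M (wC w i)) by (eapply sim_mm; [auto|apply (sim_child u w i i); auto|apply HZ]).
  destruct HZ as [_ HZ]. specialize (HZ (wC w i) Mw ltac:(congruence)). rewrite <- Eo in HZ. cbn in HZ.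
  rewrite Nat.eqb_refl, andb_false_r in HZ. exact (Aw HZ).
Qed.

Lemma leaf_sim z z' : Z z -> sim z z' ->
  (forall t i, z' = wC t i -> forall v, tailv v -> rp t = rp v -> v = t) -> Z z'.
Proof.
  intros HZ Hs Ht. destruct (leaf_tail z HZ) as [Tz Eo]. pose proof Hs as [_ [Tz' [Eo' Hsep]]].
  assert (Mz' : M z') by (eapply sim_mm; eauto; apply HZ).
  split; auto. intros t Mt Nt. assert (Hin : lset t) by apply Mt.
  destruct (classic (t = z)) as [->|Ntz]; [rewrite ladj_sym; apply HZ; auto|].
  destruct (bool_dec (lop t) (lop z)) as [E|E].
  - destruct (classic (istail t)) as [Tt|Tt].
    + destruct (pl_total z' t Tz' Tt (not_eq_sym Nt)) as [H|[H|[u [v [i [-> [-> Er]]]]]]].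
      * rewrite (proj1 (pl_adj z' t Tz' Tt H)). congruence.
      * rewrite (proj2 (pl_adj t z' Tt Tz' H)). congruence.
      * exfalso. apply Nt. f_equal. apply (Ht u i eq_refl); auto. apply Hin.
    + destruct t as [v|v i|k j]; [|exfalso; apply Tt; split; auto..].
      rewrite ladj_sym, base_adj by auto. congruence.
  - rewrite ladj_sym, <- Hsep by auto. rewrite ladj_sym. apply HZ; auto.
Qed.

(** Leaves come in groups of [n]: the [n] copies of a one-vertex child, or a full third of an
    inserted block. *)
Lemma leaf_blocks m : card Z m -> Nat.divide n m.
Proof.
  intros [l [Nl [<- Hl]]].
  apply (blocks_divide n (fun z => match z with wB _ => 0 | wC _ i => i | wS _ j => j mod n end)
    (fun z i => match z with wB v => wB v | wC v _ => wC v i | wS k j => wS k (n * (j / n) + i) end)); auto.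
  intros z Hz. apply Hl in Hz. destruct (leaf_tail z Hz) as [[Hin Tz] _].
  destruct z as [v|v i|k j]; [tauto| |].
  - destruct Hin as [Hv Li]. split; auto. split; auto. intros i' Li'. split; [|auto]. apply Hl.
    apply (leaf_sim (wC v i)); auto; [apply sim_child; auto|].
    intros t i1 E v' Tv' E'. injection E as -> ->. apply (leaf_child_trivial t i); auto.
  - cbn in Hin. pose proof (Nat.div_mod_eq j n) as Ej. pose proof (Nat.mod_upper_bound j n ltac:(lia)) as Lj.
    split; auto. split; [now rewrite <- Ej|]. intros i Li.
    assert (Ed : (n * (j / n) + i) / n = j / n).
    { rewrite Nat.mul_comm, Nat.div_add_l, (Nat.div_small i) by lia. lia. }
    assert (Em : (n * (j / n) + i) mod n = i).
    { rewrite Nat.mul_comm, Nat.add_comm, Nat.Div0.mod_add, Nat.mod_small; auto. }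
    split; [|split; [exact Em|intros j'; now rewrite Ed]]. apply Hl.
    apply (leaf_sim (wS k j)); auto; [|intros t i1 E; discriminate].
    apply sim_block; auto. assert (j / n < 3) by (apply Nat.Div0.div_lt_upper_bound; lia). nia.
Qed.

End LeafCount.

Lemma lset_limit_inv : limit_inv n ladj lset.
Proof.
  split; [apply lset_no_top|]. split.
  - exists (wB x), (wS 0 n). split; [apply x0_in|]. split; [cbn; lia|]. split; [discriminate|].
    intros y Hy Ly m. now apply leaf_blocks.
  - intros p q Hp Hq N. destruct (bel_high p) as [k1 H1]. destruct (bel_high q) as [k2 H2].
    pose (k := max k1 k2). assert (Bp : bel k 0 p) by (apply H1; lia). assert (Bq : bel k 0 q) by (apply H2; lia).
    exists (wS k n). split; [cbn; lia|]. split; [|now apply block_leaves].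
    assert (E : forall r, bel k 0 r -> ladj r (wS k 0) = false /\ ladj r (wS k n) = true).
    { intros r Br. rewrite !bel_adj, sop_0, sop_mid; auto; [lia|]. apply (bel_mono k 0); auto; lia. }
    destruct (E p Bp) as [E1 E2]. destruct (E q Bq) as [E3 E4].
    destruct (ladj p q) eqn:Epq; [right|left; split; congruence].
    exists (wS k 0). split; [cbn; lia|]. split; split; try congruence.
    rewrite bel_adj, sop_mid; [auto|lia|cbn; lia].
Qed.


End Tail.

Lemma limit_piece n : 1 <= n -> exists k, piece_ok V a C (wt V) P k /\ inv n (padj _ k) (pset _ k).
Proof.
  intros Hn. destruct (good_sequence n Hn) as [s [_ [S2 [S3 [S4 S5]]]]].
  exists (Piece _ (ladj n s S3) (lset n s)). split; [split; cbn [padj pset]|right; cbn [padj pset]].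
  - now apply base_embeds.
  - now apply tail_embeds.
  - intros o T. exfalso. exact (lset_no_top n s Hn S3 o T).
  - intros p q Hp Hq N. now apply lset_mm.
  - now apply lset_limit_inv.
Qed.

End Limit.

(** * Siblings of a countable cograph *)

Definition induced {W : Type} (b : W -> W -> bool) (T : W -> Prop)
  (b_sym : forall p q, T p -> T q -> b p q = true -> b q p = true)
  (b_irr : forall p, T p -> b p p <> true) : graph :=
  @Graph {p | T p} (fun p q => b (proj1_sig p) (proj1_sig q) = true)
    (fun p q => b_sym _ _ (proj2_sig p) (proj2_sig q)) (fun p => b_irr _ (proj2_sig p)).

Lemma sig_val_inj {W} (T : W -> Prop) (p q : {p | T p}) : proj1_sig p = proj1_sig q -> p = q.
Proof. destruct p as [p Hp], q as [q Hq]. cbn. intros <-. f_equal. apply proof_irrelevance. Qed.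

Lemma induced_iso_giso {W} (b b' : W -> W -> bool) T T' sym irr sym' irr' :
  (exists p, T p) -> isomorphic (@induced W b T sym irr) (@induced W b' T' sym' irr') -> giso b T b' T'.
Proof.
  intros [p0 Hp0] [f [g [GF [FG FA]]]]. cbn in *.
  assert (HF : forall p, exists q, forall H : T p, q = proj1_sig (f (exist _ p H))).
  { intros p. destruct (classic (T p)) as [H|H]; [|exists p; tauto].
    exists (proj1_sig (f (exist _ p H))). intros H'. now rewrite (proof_irrelevance _ H H'). }
  assert (HG : forall q, exists p, forall H : T' q, p = proj1_sig (g (exist _ q H))).
  { intros q. destruct (classic (T' q)) as [H|H]; [|exists p0; tauto].
    exists (proj1_sig (g (exist _ q H))). intros H'. now rewrite (proof_irrelevance _ H H'). }
  destruct (choice_fun _ HF) as [f' Hf]. destruct (choice_fun _ HG) as [g' Hg].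
  exists f', g'. split; [|split; [|split; [|split]]].
  - intros p Hp. rewrite (Hf p Hp). apply proj2_sig.
  - intros q Hq. rewrite (Hg q Hq). apply proj2_sig.
  - intros p Hp. rewrite (Hf p Hp). rewrite (Hg _ (proj2_sig _)).
    replace (exist _ _ _) with (f (exist T p Hp)) by now apply sig_val_inj. now rewrite GF.
  - intros q Hq. rewrite (Hg q Hq). rewrite (Hf _ (proj2_sig _)).
    replace (exist _ _ _) with (g (exist T' q Hq)) by now apply sig_val_inj. now rewrite FG.
  - intros p q Hp Hq. rewrite (Hf p Hp), (Hf q Hq). specialize (FA (exist _ p Hp) (exist _ q Hq)). cbn in FA.
    destruct (b p q), (b' _ _); auto; exfalso; intuition discriminate.
Qed.

Section Classes.
Variables (V : Type) (idx : V -> nat).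
Hypothesis idx_inj : forall x y, idx x = idx y -> x = y.
Variable a : V -> V -> bool.
Hypothesis a_sym : forall x y, a x y = a y x.
Hypothesis a_irr : forall x, a x x = false.
Local Notation all := (fun _ : V => True).
Hypothesis P4 : p4free a all.
Variable C : V -> Prop.
Hypothesis C_bad : bad V a C.
Hypothesis C_min : forall C', bad V a C' -> gemb a C' a C -> gemb a C a C'.
Local Notation cls := (eqv V a C).
Local Notation md := (mm a all).

Lemma class_mm c u v : cls c u -> cls c v -> u <> v -> gemb a (md u v) a C.
Proof.
  intros Hu Hv N. assert (K : cls u v).
  { eapply (eqv_trans V idx idx_inj a a_sym P4); [|exact Hv]. now apply (eqv_sym V idx idx_inj a a_sym P4). }
  destruct K; [contradiction|auto].
Qed.

Lemma bad_inh : exists x, C x.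
Proof.
  apply NNPP; intros H. apply (proj2 C_bad). apply (good_hom a _ true). intros x y Cx. exfalso. eauto.
Qed.

(** Classes into which [C] does not embed are kept as they are. Their invariants are left open,
    since an isomorphism can match a class containing a copy of [C] only with another such class. *)
Lemma class_piece n c : 1 <= n -> exists k, piece_ok V a C (wt V) (cls c) k /\
  (gemb a C a (cls c) -> inv n (padj _ k) (pset _ k)).
Proof.
  intros Hn.
  assert (Pc : closed a all (cls c)) by now apply (eqv_closed V idx).
  assert (Hc : cls c c) by (left; auto).
  destruct (classic (gemb a C a (cls c))) as [G|G].
  - assert (Two : exists y, cls c y /\ y <> c).
    { destruct bad_inh as [u Cu]. destruct (bad_other V a C u C_bad Cu) as [v [Cv Nv]].
      destruct G as [f [F1 [F2 F3]]]. destruct (classic (f u = c)) as [E|E]; [|eauto].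
      exists (f v). split; auto. intros E'. apply Nv. apply F2; auto; congruence. }
    destruct (classic (exists x y, cls c x /\ cls c y /\ x <> y /\ forall z, cls c z -> ~ mlt a all x y z))
      as [[x [y [Px [Py [N H]]]]]|H].
    + destruct (rooted_piece V idx idx_inj a a_sym a_irr P4 C C_bad C_min (cls c) x y Pc Px Py N H) with (n := n)
        as [k [K1 K2]]; auto; [|eauto].
      eapply gemb_trans; [|apply (class_mm c x y); auto]. apply gemb_incl. intros z Hz. split; auto.
    + destruct (limit_piece V idx idx_inj a a_sym a_irr P4 C C_min (cls c) c Pc Hc Two) with (n := n)
        as [k [K1 K2]]; eauto.
      * intros u v Hu Hv N. apply NNPP; intros Q. apply H. exists u, v. split; auto. split; auto. split; auto.
        intros z Hz L. apply Q. eauto.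
      * intros u v Hu Hv N. now apply (class_mm c).
  - exists (Piece (wt V) (fun p q => match p, q with wB u, wB v => a u v | _, _ => false end)
      (fun p => match p with wB u => cls c u | _ => False end)).
    split; [|tauto]. split; cbn [padj pset].
    + exists wB. split; [auto|]. split; [congruence|auto].
    + exists (fun p => match p with wB u => u | _ => c end). split; [|split].
      * intros [u|u i|k j]; tauto.
      * intros [u|u i|k j] [v|v i'|k' j']; try tauto. congruence.
      * intros [u|u i|k j] [v|v i'|k' j']; tauto.
    + intros o [[u|u i|k j] [[v|v i'|k' j'] [Hu [Hv [N [E H]]]]]]; try tauto.
      exists u, v. split; auto. split; auto. split; [congruence|]. split; auto.
      intros w Hw Q. exact (H (wB w) Hw Q).
    + intros [u|u i|k j] [v|v i'|k' j'] Hu Hv N; try tauto.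
      eapply gemb_trans; [|apply (class_mm c u v); auto; congruence].
      exists (fun p => match p with wB u => u | _ => c end). split; [|split].
      * intros [z|z i|k j] [Hz Mz]; try tauto. split; [exact I|]. intros [Q|[w [_ [Q1 Q2]]]].
        { apply Mz. left. exact Q. }
        destruct (classic (cls c w)) as [Hw|Hw].
        { apply Mz. right. exists (wB w). auto. }
        (* A vertex [w] outside the class is joined alike to [u] and to [z], so it cannot witness a
           separation. *)
        destruct Q2 as [Q2 Q3]. apply Q2. rewrite <- Q3, (a_sym w z).
        apply (closed_adj V a all a_sym P4 (cls c)); auto.
      * intros [z|z i|k j] [z'|z' i'|k' j'] [Hz _] [Hz' _]; try tauto. congruence.
      * intros [z|z i|k j] [z'|z' i'|k' j'] [Hz _] [Hz' _]; tauto.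
Qed.

Lemma big_class : exists c, crep V idx a C c /\ gemb a C a (cls c).
Proof.
  destruct bad_inh as [x Cx]. destruct (crep_exists V idx idx_inj a a_sym P4 C x) as [c [Hc Ec]].
  exists c. split; auto. apply gemb_incl. intros z Cz. eapply (eqv_trans V idx idx_inj a a_sym P4); [exact Ec|].
  apply (eqv_of_closed V idx idx_inj a C C); auto; [apply C_bad|apply gemb_refl].
Qed.

Lemma substituted_family : exists H : nat -> V -> piece (wt V),
  (forall n c, piece_ok V a C (wt V) (cls c) (H n c)) /\
  forall n m, 1 <= n -> 1 <= m -> n <> m -> ~ Nat.divide n m ->
    ~ giso (sadj V a _ (H n)) (sset V idx a C _ (H n)) (sadj V a _ (H m)) (sset V idx a C _ (H m)).
Proof.
  destruct (choice_fun (fun (nc : nat * V) k => piece_ok V a C (wt V) (cls (snd nc)) k /\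
    (1 <= fst nc -> gemb a C a (cls (snd nc)) -> inv (fst nc) (padj _ k) (pset _ k)))) as [H HH].
  (* The maximum only makes the choice total; for positive [n] it equals [n]. *)
  { intros [n c]. cbn. destruct (class_piece (max 1 n) c ltac:(lia)) as [k [K1 K2]]. exists k. split; auto.
    intros L. now replace (max 1 n) with n in K2 by lia. }
  exists (fun n c => H (n, c)).
  assert (OK : forall n c, piece_ok V a C (wt V) (cls c) (H (n, c))) by (intros n c; apply (HH (n, c))).
  split; [exact OK|]. intros n m Hn Hm N D Iso. destruct big_class as [c [Hc Gc]].
  destruct (subst_iso_fibers idx a C idx_inj a_sym P4 (fun c => H (n, c)) (fun c => H (m, c))) with (c := c)
    as [d [Hd Id]]; auto.
  assert (I1 : inv n (padj _ (H (m, d))) (pset _ (H (m, d)))).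
  { eapply inv_iso; [exact Id|]. now apply (HH (n, c)). }
  assert (I2 : inv m (padj _ (H (m, d))) (pset _ (H (m, d)))).
  { apply (HH (m, d)); auto. cbn. eapply gemb_trans; [exact Gc|]. eapply gemb_trans; [apply (OK n c)|].
    eapply gemb_trans; [|apply (OK m d)]. destruct Id as [f [g [F [G [GF [FG FA]]]]]]. exists f.
    split; [auto|]. split; [|auto]. intros u v Hu Hv E. rewrite <- (GF u), <- (GF v), E; auto. }
  exact (inv_exclusive _ _ n m I1 I2 N D).
Qed.

End Classes.

(** * Boolean adjacency and the final dichotomy *)

Definition adjb (G : graph) (x y : vert G) : bool := if excluded_middle_informative (adj G x y) then true else false.

Lemma adjb_true G x y : adjb G x y = true <-> adj G x y.
Proof. unfold adjb. destruct excluded_middle_informative; split; auto; discriminate. Qed.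

Lemma adjb_eq G H x y u v : adjb G x y = adjb H u v <-> (adj G x y <-> adj H u v).
Proof.
  rewrite <- !adjb_true. destruct (adjb G x y), (adjb H u v); split; intros E; auto; try discriminate; try tauto;
    exfalso; intuition discriminate.
Qed.

Lemma adjb_sym G x y : adjb G x y = adjb G y x.
Proof. apply adjb_eq. split; apply adj_sym. Qed.

Lemma adjb_irr G x : adjb G x x = false.
Proof. destruct (adjb G x x) eqn:E; auto. apply adjb_true in E. exfalso. exact (adj_irrefl G x E). Qed.

Lemma cograph_p4free G : cograph G -> p4free (adjb G) (fun _ => True).
Proof.
  intros HG p q r s _ _ _ _ [E1 [E2 [E3 [E4 [E5 E6]]]]]. apply HG.
  pose (f := fun k : {k : nat | k < 4} => match proj1_sig k with 0 => p | 1 => q | 2 => r | _ => s end).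
  assert (F : forall i j, (proj1_sig i = S (proj1_sig j) \/ proj1_sig j = S (proj1_sig i)) <-> adjb G (f i) (f j) = true).
  { intros [[|[|[|[|i]]]] Hi] [[|[|[|[|j]]]] Hj]; try lia; unfold f; cbn [proj1_sig];
      rewrite ?adjb_irr, ?(adjb_sym G q p), ?(adjb_sym G r q), ?(adjb_sym G s r), ?(adjb_sym G r p), ?(adjb_sym G s q),
        ?(adjb_sym G s p), ?E1, ?E2, ?E3, ?E4, ?E5, ?E6; split; intros K; auto; try discriminate; lia. }
  exists f. split; [|intros i j; rewrite <- (adjb_true G); apply F].
  assert (Ne : p <> q /\ p <> r /\ p <> s /\ q <> r /\ q <> s /\ r <> s).
  { pose proof (adjb_sym G p r). pose proof (adjb_irr G p). pose proof (adjb_irr G q). pose proof (adjb_irr G r).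
    repeat split; intros Q; subst; congruence. }
  destruct Ne as [N1 [N2 [N3 [N4 [N5 N6]]]]].
  intros [[|[|[|[|i]]]] Hi] [[|[|[|[|j]]]] Hj] E; unfold f in E; cbn in E; apply sig_val_inj; cbn; auto; try lia;
    congruence.
Qed.

Theorem theorem1 (G : graph) :
  countable_graph G -> cograph G ->
  one_sibling G \/ infinitely_many_siblings G.
Proof.
  intros [idx idx_inj] HG.
  set (V := vert G) in *. set (a := adjb G).
  assert (a_sym : forall x y, a x y = a y x) by apply adjb_sym.
  assert (a_irr : forall x, a x x = false) by apply adjb_irr.
  assert (P4 : p4free a (fun _ => True)) by now apply cograph_p4free.
  destruct (classic (good a (fun _ => True))) as [Hgood|Hbad].
  - left. intros H [[g [G1 G2]] [f [F1 F2]]].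
    destruct (one_sibling_good V a a_sym a_irr (vert H) (adjb H) (adjb_irr H) f g) as [h [k [K1 [K2 K3]]]]; auto.
    + intros x y. apply adjb_eq. symmetry. apply F2.
    + intros x y. apply adjb_eq. symmetry. apply G2.
    + exists h, k. split; auto. split; auto. intros x y. apply adjb_eq. symmetry. apply K3.
  - right.
    destruct (minimal_bad_module V idx idx_inj a a_sym a_irr P4 (fun _ => True)) as [C [C_bad C_min]].
    { split; auto. split; [intros z; auto|auto]. }
    destruct (substituted_family V idx idx_inj a a_sym a_irr P4 C C_bad C_min) as [H [OK NI]].
    pose (b n := sadj V a _ (H n)). pose (T n := sset V idx a C _ (H n)).
    assert (To : forall n, gemb a (fun _ => True) (b n) (T n)) by (intros n; apply subst_to; auto).
    assert (From : forall n, gemb (b n) (T n) a (fun _ => True)) by (intros n; apply subst_from; auto).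
    assert (b_sym : forall n p q, T n p -> T n q -> b n p q = true -> b n q p = true).
    { intros n p q Hp Hq. destruct (From n) as [f [_ [_ F]]]. rewrite <- !F by auto. now rewrite a_sym. }
    assert (b_irr : forall n p, T n p -> b n p p <> true).
    { intros n p Hp. destruct (From n) as [f [_ [_ F]]]. rewrite <- F, a_irr by auto. discriminate. }
    assert (Inh : forall n, exists p, T n p).
    { intros n. destruct (bad_inh V a C C_bad) as [x _]. destruct (To n) as [f [F _]]. exists (f x). auto. }
    intros N. exists (fun i => induced (b (S N + i)) (T (S N + i)) (b_sym _) (b_irr _)). split.
    + intros i _. set (n := S N + i). split.
      * destruct (From n) as [f [_ [F2 F3]]]. exists (fun p => f (proj1_sig p)). split.
        -- intros p q E. apply sig_val_inj, F2; auto; apply proj2_sig.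
        -- intros p q. cbn. rewrite <- (adjb_true G). fold a. rewrite F3 by apply proj2_sig. tauto.
      * destruct (To n) as [f [F1 [F2 F3]]]. exists (fun x => exist _ (f x) (F1 x I)). split.
        -- intros x y E. injection E as E. auto.
        -- intros x y. cbn. rewrite <- (adjb_true G). fold a. rewrite F3 by auto. tauto.
    + intros i j Li Lj Nij Iso. apply induced_iso_giso in Iso; auto.
      apply (NI (S N + i) (S N + j)); auto; try lia.
      (* The parameters run from [N + 1] to [2 * N]: the factor [0] is impossible, [1] would make
         them equal, and a larger factor exceeds the range. *)
      intros [[|[|k]] D]; nia.
Qed.
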